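(* Let $n\ge 1$, $d\ge1$ and $g$ be integers with $0<g\le 4$ and $d\ge \max(n,2g-2)$. Let $M^n_d$ be the space of nondegenerate morphisms $f:\mathbb{P}^1\to\mathbb{P}^n$ of degree $d$ over $\mathbb{C}$, and let $M^n_{d,g}\subset M^n_d$ be the subvariety of those morphisms whose image curve $f(\mathbb{P}^1)$ has arithmetic genus $g$. Then \[ \operatorname{cod}(M^n_{d,g},M^n_d)\ \ge\ (n-2)g . \]
   Context: Work over $\mathbb{C}$. A morphism $f=(f_0,\dots,f_n):\mathbb{P}^1\to\mathbb{P}^n$ of degree $d$ is given by homogeneous polynomials $f_i=a_{i,0}t^d+a_{i,1}t^{d-1}u+\dots+a_{i,d}u^d$ of degree $d$ in homogeneous coordinates $t,u$ on $\mathbb{P}^1$, and is identified with its tuple of coefficients $(a_{i,j})$; nondegenerate means the image is not contained in a hyperplane. The arithmetic genus of the rational image curve $C=f(\mathbb{P}^1)$ is $g=\sum_{P\in C}\delta_P$, the sum of the delta-invariants of its singular points (singularities may be multibranch, e.g. nodes, tacnodes, triple points, or cusps). *)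

(* Defs.v *)
From HB Require Import structures.
From mathcomp Require Import all_boot all_order all_algebra.
From mathcomp Require Import mpoly.

Set Implicit Arguments.
Unset Strict Implicit.
Unset Printing Implicit Defensive.

Import Order.TTheory GRing.Theory Num.Theory.
Local Open Scope ring_scope.

Section Rational_curves.

Variable C : fieldType.

(* Parameter space.  A morphism f = (f_0,...,f_n) : P^1 -> P^n of degree d *)
(* is identified with its coefficient tuple (a_{i,j}), 0<=i<=n, 0<=j<=d,   *)
(* f_i = sum_j a_{i,j} t^(d-j) u^j.  The tuple is a point of the affine    *)
(* space C^((n+1)(d+1)), coordinates indexed via mxvec_index.              *)

Definition npar (n d : nat) : nat := (n.+1 * d.+1)%N.

Definition coefs (n d : nat) (x : 'I_(npar n d) -> C) (i : 'I_n.+1)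
  (j : 'I_d.+1) : C := x (mxvec_index i j).

Definition form_eval (n d : nat) (x : 'I_(npar n d) -> C) (i : 'I_n.+1)
  (t u : C) : C :=
  \sum_(j < d.+1) coefs x i j * t ^+ (d - j) * u ^+ j.

Definition is_morphism (n d : nat) (x : 'I_(npar n d) -> C) : Prop :=
  forall t u : C, (forall i, form_eval x i t u = 0) -> t = 0 /\ u = 0.

Definition nondegenerate (n d : nat) (x : 'I_(npar n d) -> C) : Prop :=
  forall lam : 'I_n.+1 -> C,
    (forall j : 'I_d.+1, \sum_(i < n.+1) lam i * coefs x i j = 0) ->
    forall i, lam i = 0.

Definition Mnd (n d : nat) (x : 'I_(npar n d) -> C) : Prop :=
  is_morphism x /\ nondegenerate x.

(* Arithmetic genus of the image curve, via its Hilbert polynomial.       *)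
(* The homogeneous coordinate ring of C = f(P^1) is the graded subring of *)
(* C[t,u] generated by the f_i; its degree-m part is spanned by the       *)
(* degree-m monomials in the f_i.  We compute its dimension after the     *)
(* (injective on forms of degree md) dehomogenisation u = 1.              *)

Definition dehom (n d : nat) (x : 'I_(npar n d) -> C) (i : 'I_n.+1)
  : {poly C} :=
  \sum_(j < d.+1) coefs x i j *: 'X^(d - j).

Definition hilb_fun (n d : nat) (x : 'I_(npar n d) -> C) (m : nat) : nat :=
  \rank (\matrix_(r < #|{: {ffun 'I_n.+1 -> 'I_m.+1}}|, k < (m * d).+1)
     (let e := enum_val r in
      if (\sum_(i < n.+1) (e i : nat) == m)%N
      then (\prod_(i < n.+1) dehom x i ^+ e i)`_k else 0)).

(* the image curve has arithmetic genus g: its Hilbert polynomial is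
   a*m + 1 - g  (h(m) agrees with it for all m large) *)
Definition image_arith_genus (n d : nat) (x : 'I_(npar n d) -> C)
  (g : int) : Prop :=
  exists a : int, exists m0 : nat, forall m : nat, (m0 <= m)%N ->
    (hilb_fun x m)%:Z = a * m%:Z + 1 - g.

Definition Mndg (n d : nat) (g : int) (x : 'I_(npar n d) -> C) : Prop :=
  Mnd x /\ image_arith_genus x g.

(* Dimension of a subset S of the affine space C^N: the Krull dimension   *)
(* of C[X_1..X_N]/I(S), i.e. of the Zariski closure of S.                  *)

Definition is_ideal (N : nat) (I : {mpoly C[N]} -> Prop) : Prop :=
  [/\ I 0, (forall p q, I p -> I q -> I (p + q)) &
      (forall p q, I q -> I (p * q))].

Definition is_prime_ideal (N : nat) (I : {mpoly C[N]} -> Prop) : Prop :=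
  [/\ is_ideal I, ~ I 1 & (forall p q, I (p * q) -> I p \/ I q)].

Definition vanishing_ideal (N : nat) (S : ('I_N -> C) -> Prop)
  (p : {mpoly C[N]}) : Prop :=
  forall x, S x -> p.@[x] = 0.

Definition dim_ge (N : nat) (S : ('I_N -> C) -> Prop) (k : nat) : Prop :=
  exists P : nat -> {mpoly C[N]} -> Prop,
    (forall i, (i <= k)%N ->
       is_prime_ideal (P i) /\ (forall p, vanishing_ideal S p -> P i p)) /\
    (forall i, (i < k)%N ->
       (forall p, P i p -> P i.+1 p) /\ (exists p, P i.+1 p /\ ~ P i p)).

Definition codim_ge (N : nat) (S T : ('I_N -> C) -> Prop) (c : int) : Prop :=
  forall k : nat, dim_ge S k ->
    exists k' : nat, dim_ge T k' /\ k%:Z + c <= k'%:Z.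

End Rational_curves.

(* Main.v *)
Require Import Defs.
From HB Require Import structures.
From mathcomp Require Import all_boot all_order all_algebra.
From mathcomp Require Import perm mpoly.
From mathcomp Require Import zify ring.
From Stdlib Require Import Classical ClassicalEpsilon FunctionalExtensionality.
Set Implicit Arguments.
Unset Strict Implicit.
Unset Printing Implicit Defensive.
Import GRing.Theory.
Local Open Scope ring_scope.

(* Put N = (n+1)(d+1). Nondegenerate morphisms are Zariski dense in affine
   N-space, so for n > 2 it suffices that any N - (n-2)g + 1 polynomials are
   algebraically dependent on the curves of genus g. Dependence follows from a
   parametrisation by counting polynomials of bounded degree; parameters that
   may be chosen generically for each curve cost nothing.

   If f is not birational onto its image, then r = floor((d+1)/2) generic points
   have partners with the same image. The partners are algebraic over f_0, f_1
   and the points, and each other coordinate satisfies r linear conditions.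

   Otherwise the image has a conductor c, a form of degree e. The Hilbert
   polynomial and a duality argument give e = b + g with b <= g, where b is the
   dimension of the coordinate ring modulo c. Let h, w, y be combinations of the
   f_i, with h and y generic. The roots of c are algebraic over the plane curve
   (h, w, y). If the products of h, w, y span all the h f_k modulo c, then at
   most b of them do, so each of the n-2 remaining coordinates depends on only
   b + (d+1-e) = d+1-g parameters.

   This can fail only when the f_i span four dimensions modulo c, which forces
   b = g = 4 and e = 8. If d > 6, three coordinates are then congruent to
   multiples of h modulo a form s with c | s^2. If d = 6, then n = 3 and the
   curve is a sextic on a quadric. Both families are counted directly. *)

(** * Krull dimension and algebraic dependence *)

Section MpolyEval.

(** The hypotheses on [g] and [d] enter through e = b + g <= 2g <= d + 2. If e <= d + 1, each
    residual coordinate is counted through the multiples of [c] of degree d. If e = d + 2, the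
    coordinates are independent modulo [c], so n + 1 <= b <= 4, which leaves only sextics in P^3.
    The bound g <= 4 limits b to 4: up to three dimensions modulo [c] are spanned by h, w, y
    themselves, and with four dimensions the products h f_k already fill degree two modulo [c].
    Conductors, partners and auxiliary combinations vary with the curve and come in no algebraic
    family. Dimension is therefore measured by the growth of spaces of functions on an abstract set:
    any pointwise choice can be adjoined as a new function, finite case distinctions are free, and
    only the functions adjoined without an algebraic equation are counted. The planar count is 3(d +
    1) for h, w, y plus d + 1 - g for each of n - 2 coordinates, that is N - (n - 2)g; the other
    three coordinates are recovered linearly from h, w, y. *)

Lemma mmap_muni (R : ringType) (A : comRingType) (f : {rmorphism R -> A}) r
    (h : 'I_r.+1 -> A) (F : {mpoly R[r.+1]}) :
  mmap f h F =
  (map_poly (mmap f (fun i => h (widen_ord (leqnSn r) i))) (muni F)).[h ord_max].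
Proof.
rewrite muniE raddf_sum /= horner_sum; apply: eq_bigr => m _.
rewrite -!mul_polyC !rmorphM /= !map_polyC !map_polyXn /=.
rewrite !hornerE /= mmapZ mmapX.
rewrite /mmap1 big_ord_recr /= mulrA; congr (_ * _ * _).
by apply: eq_bigr => i _; rewrite mnmE.
Qed.

Lemma muni_eq0 (R : comRingType) r (F : {mpoly R[r.+1]}) : muni F = 0 -> F = 0.
Proof.
move=> F0; rewrite -[F]comp_mpoly_id /comp_mpoly mmap_muni F0.
by rewrite rmorph0 horner0.
Qed.

Variable C : closedFieldType.

Lemma closed_infinite (s : seq C) : exists x, x \notin s.
Proof.
case: s => [|a s]; first by exists 0.
have /closed_rootP[x] :
    size (\prod_(b <- a :: s) ('X - b%:P) + 1 : {poly C}) != 1%N.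
  by rewrite size_polyDl size_prod_XsubC ?size_poly1.
rewrite rootE hornerD hornerC => px0; exists x; apply/negP => xs.
by move: px0; rewrite -[X in X + 1]/(_.[x]) (rootP _) ?add0r ?oner_eq0 ?root_prod_XsubC.
Qed.

Definition cofinite (P : C -> Prop) := exists s : seq C, forall x, x \notin s -> P x.

Lemma cofinite_and P Q : cofinite P -> cofinite Q -> cofinite (fun x => P x /\ Q x).
Proof.
move=> [s sP] [u uQ]; exists (s ++ u) => x; rewrite mem_cat negb_or => /andP[xs xu].
by split; [apply: sP | apply: uQ].
Qed.

Lemma cofinite_imp (P Q : C -> Prop) : (forall x, P x -> Q x) -> cofinite P -> cofinite Q.
Proof. by move=> PQ [s sP]; exists s => x /sP /PQ. Qed.

Lemma cofinite_ex P : cofinite P -> exists x, P x.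
Proof. by move=> [s sP]; have [x /sP] := closed_infinite s; exists x. Qed.

Lemma cofinite_all (T : eqType) (u : seq T) (P : T -> C -> Prop) :
  (forall t, t \in u -> cofinite (P t)) ->
  cofinite (fun x => forall t, t \in u -> P t x).
Proof.
elim: u => [|a u IH] Pu; first by exists [::].
have [|t tu|s sP] := cofinite_and (Pu a _) (IH _); first by rewrite inE eqxx.
  by apply: Pu; rewrite inE tu orbT.
by exists s => x /sP[Pa Px] t; rewrite inE => /predU1P[->|/Px].
Qed.

Lemma cofinite_neq a : cofinite (fun x : C => x <> a).
Proof. by exists [:: a] => x; rewrite inE => /eqP. Qed.

Lemma cofinite_poly (p : {poly C}) : p != 0 -> cofinite (fun x => p.[x] != 0).
Proof.
move=> p0; have [s Es] := closed_field_poly_normal p.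
exists s => x xs; rewrite Es hornerZ mulf_neq0 ?lead_coef_eq0 //.
by rewrite -[_ != 0]/(~~ root _ _) root_prod_XsubC.
Qed.

Lemma cofinite_poly0 (p : {poly C}) : cofinite (fun x => p.[x] = 0) -> p = 0.
Proof.
move=> p0; apply/eqP/negPn/negP => /cofinite_poly /(cofinite_and p0) /cofinite_ex.
by move=> [x [->]]; rewrite eqxx.
Qed.

Lemma mpoly_nonvanish r (F : {mpoly C[r]}) : (forall v, F.@[v] = 0) -> F = 0.
Proof.
elim: r F => [|r IH] F F0.
  have EF := F0 (fun=> 0); apply/mpolyP => m; rewrite mcoeff0 -EF.
  have E (m' : 'X_{1..0}) : m' = 0%MM by apply/mnmP => -[].
  rewrite mevalE; case Es: (msupp F) => [|m1 s].
    by rewrite big_nil memN_msupp_eq0 // Es.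
  have := msupp_uniq F; rewrite Es; case: s {Es} => [|m2 s]; last first.
    by rewrite (E m1) (E m2) /= inE eqxx.
  by rewrite big_seq1 big_ord0 mulr1 (E m) (E m1).
apply: muni_eq0; apply/polyP => k; rewrite coef0; apply: IH => v.
pose p : {poly C} := map_poly (meval v) (muni F).
suff -> : ((muni F)`_k).@[v] = p`_k.
  rewrite (_ : p = 0) ?coef0 //; apply: cofinite_poly0; exists [::] => x _.
  pose w (i : 'I_r.+1) := if unlift ord_max i is Some j then v j else x.
  have := F0 w; rewrite /meval mmap_muni /w unlift_none => <-; congr (_.[x]).
  apply: eq_map_poly => q; apply: meval_eq => i.
  have -> : widen_ord (leqnSn r) i = lift ord_max i by apply/val_inj; rewrite /= /bump leqNgt ltn_ord.
  by rewrite liftK.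
by rewrite coef_map.
Qed.

Lemma meval_mmapC N r (y : 'I_r -> {mpoly C[N]}) (F : {mpoly C[r]}) x :
  (mmap (@mpolyC N C) y F).@[x] = F.@[fun i => (y i).@[x]].
Proof.
rewrite /mmap raddf_sum /= mevalE; apply: eq_bigr => m _.
rewrite mevalM mevalC; congr (_ * _).
by rewrite /mmap1 rmorph_prod; apply: eq_bigr => i _; rewrite rmorphXn.
Qed.
End MpolyEval.

Section KrullBound.
Variable C : closedFieldType.

(** Transcendence degree at most [D]: the ring of polynomial functions on [S] has no [D.+1]
    algebraically independent elements. [S] may be reducible. *)
Definition alg_dep N (S : ('I_N -> C) -> Prop) (D : nat) :=
  forall p : 'I_D.+1 -> {mpoly C[N]}, exists F : {mpoly C[D.+1]},
    F <> 0 /\ forall x, S x -> F.@[fun i => (p i).@[x]] = 0.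

(* If [y] is algebraically independent modulo a prime [Q] and [q] lies in [Q]
   but not in the prime [P], then [y, q] is independent modulo [P]: strip
   powers of [q] from a relation and reduce it modulo [Q]. *)
Lemma indep_extend N r (P Q : {mpoly C[N]} -> Prop) (y : 'I_r -> {mpoly C[N]}) q :
    is_prime_ideal P -> is_prime_ideal Q -> (forall p, P p -> Q p) ->
    Q q -> ~ P q ->
    (forall F, Q (mmap (@mpolyC N C) y F) -> F = 0) ->
  exists y' : 'I_r.+1 -> {mpoly C[N]},
    forall F, P (mmap (@mpolyC N C) y' F) -> F = 0.
Proof.
move=> [[P0 PD PM] P1 Pp] [[Q0 QD QM] Q1 Qp] PQ Qq nPq yi.
exists (fun i => if unlift ord_max i is Some j then y j else q) => F.
rewrite mmap_muni unlift_none => PF; apply: muni_eq0; move: PF.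
have -> : map_poly (mmap (@mpolyC N C)
   (fun i => if unlift ord_max (widen_ord (leqnSn r) i) is Some j then y j else q))
   (muni F) = map_poly (mmap (@mpolyC N C) y) (muni F).
  apply: eq_map_poly => p; apply: eq_bigr => m _; congr (_ * _).
  apply: mmap1_eq => i.
  have -> : widen_ord (leqnSn r) i = lift ord_max i.
    by apply/val_inj; rewrite /= /bump leqNgt ltn_ord.
  by rewrite liftK.
elim/poly_ind: (muni F) => // G c IH.
rewrite rmorphD rmorphM /= map_polyX map_polyC /= hornerMXaddC => PG.
have c0 : c = 0.
  apply: yi; set u := mmap _ _ c; set v := _ * q in PG.
  have -> : u = (-1) * v + (v + u) by ring.
  by apply: QD; [apply: (QM); apply: (QM) | apply: PQ].
move: PG; rewrite c0 raddf0 !addr0 => /Pp[/IH->|//].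
by rewrite mul0r.
Qed.

(** Going down a chain of primes from its top, each strict inclusion adds one element independent
    modulo the smaller prime. A chain longer than [D] gives [D.+1] elements independent modulo a
    prime that contains the vanishing ideal. *)
Lemma dim_ge_alg_dep N (S : ('I_N -> C) -> Prop) D k :
  alg_dep S D -> dim_ge S k -> (k <= D)%N.
Proof.
move=> dS [P [Pp Pm]]; rewrite leqNgt; apply/negP => ltDk.
have chain j : (j <= k)%N -> exists y : 'I_j -> {mpoly C[N]},
    forall F, P (k - j)%N (mmap (@mpolyC N C) y F) -> F = 0.
  elim: j => [|j IH] jk.
    (* The empty family is independent because a proper ideal contains no nonzero constant. *)
    exists (fun=> 0) => F; rewrite subn0.
    have [[[_ _ PM] P1 _] _] := Pp k (leqnn k).
    move=> PF; apply: mpoly_nonvanish => v; apply/eqP/negPn/negP => Fv.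
    apply: P1; have -> : (1 : {mpoly C[N]}) = (F.@[v]^-1)%:MP * F.@[v]%:MP.
      by rewrite -mpolyCM mulVf.
    apply: PM; move: PF; congr (P _ _); rewrite /mmap mevalE raddf_sum /=.
    by apply: eq_bigr => m _; rewrite /mmap1 !big_ord0 !mulr1.
  have [y yi] := IH (ltnW jk).
  have lt : (k - j.+1 < k)%N by lia.
  have [PS [q [Pq nPq]]] := Pm _ lt.
  rewrite (_ : (k - j.+1).+1 = k - j)%N in PS Pq; last by lia.
  have [PP _] := Pp (k - j.+1)%N (leq_subr _ _).
  have [QP _] := Pp (k - j)%N (leq_subr _ _).
  exact: indep_extend PP QP PS Pq nPq yi.
have [y yi] := chain _ ltDk.
have [F [F0 SF]] := dS y; apply: F0; apply: yi.
have [_] := Pp (k - D.+1)%N (leq_subr _ _); apply => x Sx.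
by rewrite meval_mmapC SF.
Qed.

Lemma alg_dep_sub N (S S' : ('I_N -> C) -> Prop) D :
  (forall x, S x -> S' x) -> alg_dep S' D -> alg_dep S D.
Proof. by move=> SS dS p; have [F [F0 SF]] := dS p; exists F; split=> // x /SS /SF. Qed.

Lemma alg_dep_or N (S S' : ('I_N -> C) -> Prop) D :
  alg_dep S D -> alg_dep S' D -> alg_dep (fun x => S x \/ S' x) D.
Proof.
move=> dS dS' p; have [F [/eqP F0 SF]] := dS p; have [G [/eqP G0 SG]] := dS' p.
exists (F * G); split; first by apply/eqP; rewrite mulf_neq0.
by move=> x [/SF|/SG] E; rewrite mevalM E ?mul0r ?mulr0.
Qed.

(** The chain consists of the ideals of coordinate subspaces, written as kernels of the
    substitutions [y k] that kill the first [k] variables; primality is then integrality of the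
    polynomial ring. *)
Lemma dim_ge_full N (S : ('I_N -> C) -> Prop) :
  (forall p : {mpoly C[N]}, vanishing_ideal S p -> p = 0) -> dim_ge S N.
Proof.
move=> S0; pose y k (i : 'I_N) : {mpoly C[N]} := if (i < k)%N then 0 else 'X_i.
exists (fun k p => mmap (@mpolyC N C) (y k) p = 0); split=> k kN; last split.
- split; last by move=> p /S0 ->; rewrite raddf0.
  split; first split.
  + by rewrite raddf0.
  + by move=> p q p0 q0; rewrite raddfD /= p0 q0 addr0.
  + by move=> p q q0; rewrite rmorphM /= q0 mulr0.
  + by rewrite rmorph1 => /eqP; rewrite oner_eq0.
  by move=> p q; rewrite rmorphM /= => /eqP; rewrite mulf_eq0 => /orP[] /eqP; [left|right].
- move=> p pk; apply: mpoly_nonvanish => v.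
  rewrite meval_mmapC.
  pose w (i : 'I_N) := if (i < k.+1)%N then 0 else v i.
  have := congr1 (fun q => q.@[w]) pk; rewrite meval_mmapC meval0 => <-.
  apply: meval_eq => i; rewrite /y /w; case: ltnP => ik.
    by case: ltnP => ik'; rewrite ?meval0 // mevalXU ik.
  by rewrite (leq_gtF (ltnW ik)) !mevalXU (leq_gtF ik).
exists 'X_(Ordinal kN); rewrite !mmapX !mmap1U /y /= ltnSn ltnn; split=> //.
by move/(congr1 (fun q => q.@[fun=> 1])); rewrite mevalXU meval0 => /eqP; rewrite oner_eq0.
Qed.
End KrullBound.

(** * Growth of polynomial functions *)

(** Data attached to the points of a family are chosen without any regularity; the functions so
    obtained are later adjoined as generators. *)
Lemma choose_on (T Z : Type) (A : T -> Prop) (R : T -> Z -> Prop) (z0 : Z) :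
  (forall t, A t -> exists z, R t z) -> exists f, forall t, A t -> R t (f t).
Proof.
move=> H.
have H' t : {z | A t -> R t z}.
  apply: constructive_indefinite_description.
  by have [/H[z]|nA] := classic (A t); [exists z | exists z0].
by exists (fun t => sval (H' t)) => t; apply: (svalP (H' t)).
Qed.

Lemma fin_bound (I : finType) (P : I -> nat -> Prop) :
  (forall i m n, (m <= n)%N -> P i m -> P i n) -> (forall i, exists m, P i m) ->
  exists m, forall i, P i m.
Proof.
move=> Pm /fin_all_exists[m mP]; exists (\max_i m i)%N => i.
exact/(Pm _ (m i))/mP/leq_bigmax.
Qed.

Lemma leq_expl e m n : (m <= n)%N -> (m ^ e <= n ^ e)%N.
Proof. by case: e => // e mn; rewrite leq_exp2r. Qed.

Section Counting.
Variables (C : closedFieldType) (T : Type).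
Implicit Types (A : T -> Prop) (Y : (T -> C) -> Prop).

(* [polyfun A Y m phi]: on [A], the function [phi] is a polynomial of degree
   at most [m] in functions taken from [Y]. *)
Inductive polyfun A Y : nat -> (T -> C) -> Prop :=
| polyfun_const a m : polyfun A Y m (fun=> a)
| polyfun_gen y m : Y y -> polyfun A Y m.+1 y
| polyfun_add m phi psi : polyfun A Y m phi -> polyfun A Y m psi ->
    polyfun A Y m (fun t => phi t + psi t)
| polyfun_mul m k phi psi : polyfun A Y m phi -> polyfun A Y k psi ->
    polyfun A Y (m + k) (fun t => phi t * psi t)
| polyfun_ext m phi psi : polyfun A Y m phi -> (forall t, A t -> phi t = psi t) ->
    polyfun A Y m psi.

(* Dimension at most [D], measured by the growth of the spaces of polynomials
   of degree [M]; the factor [delta] absorbs denominators. *)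
Definition growth A Y (D : nat) := exists K, forall M,
  exists (I : finType) (G : I -> T -> C) (delta : T -> C),
  [/\ (#|I| <= K * M.+1 ^ D)%N, (forall t, A t -> delta t != 0) &
   forall phi, polyfun A Y M phi -> exists c : I -> C,
     forall t, A t -> delta t * phi t = \sum_i c i * G i t].

Lemma polyfun_leq A Y m m' phi : (m <= m')%N -> polyfun A Y m phi -> polyfun A Y m' phi.
Proof.
move=> mm' P; elim: P m' mm' => {m phi}.
- by move=> *; apply: polyfun_const.
- by move=> y m Yy [|m'] // _; apply: polyfun_gen.
- by move=> m phi psi _ IH1 _ IH2 m' mm'; apply: polyfun_add; [apply: IH1|apply: IH2].
- move=> m k phi psi P1 _ _ IH2 m' mm'.
  have -> : m' = (m + (m' - m))%N by lia.
  by apply: polyfun_mul => //; apply: IH2; lia.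
- by move=> m phi psi _ IH1 E m' mm'; apply: polyfun_ext E; apply: IH1.
Qed.

Lemma polyfun_sub A A' Y Y' m phi : (forall t, A' t -> A t) -> (forall y, Y y -> Y' y) ->
  polyfun A Y m phi -> polyfun A' Y' m phi.
Proof.
move=> AA YY; elim=> {m phi}.
- exact: polyfun_const.
- by move=> y m /YY; apply: polyfun_gen.
- by move=> m phi psi _ P1 _ P2; apply: polyfun_add.
- by move=> m k phi psi _ P1 _ P2; apply: polyfun_mul.
- by move=> m phi psi _ P E; apply: polyfun_ext P _ => t /AA /E.
Qed.

(** A derivation on [A'] may use equalities that hold only there. Rebuilt without those steps, it
    gives a polynomial in [Y] that is legitimate on any set and agrees with [phi] on [A']. *)
Lemma polyfun_shrink A A' Y m phi : polyfun A' Y m phi ->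
  exists psi, polyfun A Y m psi /\ forall t, A' t -> phi t = psi t.
Proof.
elim=> {m phi}.
- by move=> a m; exists (fun=> a); split=> //; apply: polyfun_const.
- by move=> y m Yy; exists y; split=> //; apply: polyfun_gen.
- move=> m phi psi _ [f [Pf Ef]] _ [h [Ph Eh]]; exists (fun t => f t + h t).
  by split; [apply: polyfun_add|move=> t At; rewrite Ef ?Eh].
- move=> m k phi psi _ [f [Pf Ef]] _ [h [Ph Eh]]; exists (fun t => f t * h t).
  by split; [apply: polyfun_mul|move=> t At; rewrite Ef ?Eh].
- move=> m phi psi _ [f [Pf Ef]] E; exists f; split=> // t At.
  by rewrite -E ?Ef.
Qed.

Lemma polyfun_comp A Y Y' k m phi : (forall y, Y' y -> polyfun A Y k y) ->
  polyfun A Y' m phi -> polyfun A Y (k * m) phi.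
Proof.
move=> YY; elim=> {m phi}.
- by move=> *; apply: polyfun_const.
- by move=> y m /YY; apply: polyfun_leq; lia.
- by move=> m phi psi _ P1 _ P2; apply: polyfun_add.
- by move=> m l phi psi _ P1 _ P2; rewrite mulnDr; apply: polyfun_mul.
- by move=> m phi psi _ P E; apply: polyfun_ext P E.
Qed.

Lemma growth_const A : growth A (fun=> False) 0.
Proof.
exists 1%N => M; exists unit, (fun=> fun=> 1), (fun=> 1); split.
- by rewrite card_unit expn0.
- by move=> t _; rewrite oner_eq0.
move=> phi P; suff [c Ec] : exists c, forall t, A t -> phi t = c.
  by exists (fun=> c) => t At; rewrite big_const card_unit /= addr0 mulr1 mul1r Ec.
elim: P => {M phi} [a m|y m []|m phi psi _ [a Ea] _ [b Eb]|m k phi psi _ [a Ea] _ [b Eb]|].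
- by exists a.
- by exists (a + b) => t At; rewrite Ea ?Eb.
- by exists (a * b) => t At; rewrite Ea ?Eb.
- by move=> m phi psi _ [a Ea] E; exists a => t At; rewrite -E ?Ea.
Qed.

Lemma growth_sub A A' Y Y' D : (forall t, A' t -> A t) -> (forall y, Y' y -> Y y) ->
  growth A Y D -> growth A' Y' D.
Proof.
move=> AA YY [K HK]; exists K => M; have [I [G [delta [cI d0 HG]]]] := HK M.
exists I, G, delta; split=> //; first by move=> t /AA /d0.
move=> phi P; have [psi [Ppsi E]] := polyfun_shrink A P.
have [c Hc] : exists c : I -> C, forall t, A t -> delta t * psi t = \sum_i c i * G i t.
  by apply: HG; apply: polyfun_sub Ppsi.
by exists c => t A't; rewrite E // Hc //; apply: AA.
Qed.

Lemma growth_leq A Y D D' : (D <= D')%N -> growth A Y D -> growth A Y D'.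
Proof.
move=> DD [K HK]; exists K => M; have [I [G [delta [cI d0 HG]]]] := HK M.
exists I, G, delta; split=> //; apply: leq_trans cI _.
by rewrite leq_mul2l leq_pexp2l ?orbT.
Qed.

(** Degree [M] in the new functions is degree [k * M] in the old ones, which affects only the
    constant. *)
Lemma growth_comp A Y Y' D k : (forall y, Y' y -> polyfun A Y k y) ->
  growth A Y D -> growth A Y' D.
Proof.
move=> YY [K HK]; exists (K * k.+1 ^ D)%N => M.
have [I [G [delta [cI d0 HG]]]] := HK (k * M)%N.
exists I, G, delta; split=> //; last by move=> phi /(polyfun_comp YY) /HG.
apply: leq_trans cI _; rewrite -mulnA leq_mul2l; apply/orP; right.
rewrite -expnMn; apply: leq_expl; nia.
Qed.

(** The spanning functions of each piece are extended by zero, after choosing one piece for each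
    point, and the denominators are glued. The number of pieces enters only the constant, and the
    pieces can be arbitrary sets. *)
Lemma growth_union (J : finType) A (B : J -> T -> Prop) Y D :
  (forall t, A t -> exists j, B j t) ->
  (forall j, growth (fun t => A t /\ B j t) Y D) -> growth A Y D.
Proof.
move=> AB gB.
have [j0 _|nJ] := pickP (xpredT : pred J); last first.
  exists 0%N => M; exists void, (fun=> fun=> 0), (fun=> 1); split; first by rewrite card_void.
    by move=> t _; rewrite oner_eq0.
  by move=> phi _; exists (fun=> 0) => t /AB[j]; have := nJ j.
have [jj jjB] := choose_on j0 AB.
have {gB} [K HK] := fin_all_exists gB.
exists (\sum_j K j)%N => M.
have [I HI] := fin_all_exists (fun j => HK j M).
have [G HG] := fin_all_exists HI.
have {HK HI HG} [delta Hd] := fin_all_exists HG.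
exists {j & I j}, (fun ji t => if tag ji == jj t then G (tag ji) (tagged ji) t else 0),
  (fun t => delta (jj t) t); split.
- rewrite card_tagged sumnE big_map big_enum big_distrl /=.
  by apply: leq_sum => j _; have [] := Hd j.
- by move=> t At; have [_ d0 _] := Hd (jj t); apply: d0; split=> //; apply: jjB.
move=> phi P.
have /fin_all_exists[c Hc] j : exists c : I j -> C, forall t, A t /\ B j t ->
    delta j t * phi t = \sum_i c i * G j i t.
  by have [_ _] := Hd j; apply; apply: polyfun_sub P => // t [].
exists (fun ji => c (tag ji) (tagged ji)) => t At.
rewrite Hc; last by split=> //; apply: jjB.
have E := @sig_big_dep _ 0 +%R J I xpredT (fun _ => xpredT)
  (fun j i => c j i * (if j == jj t then G j i t else 0)).
rewrite /= in E; rewrite -E (bigD1 (jj t)) //= [X in _ + X]big1 ?addr0.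
  by apply: eq_bigr => i _; rewrite eqxx.
by move=> j /negPf jt; rewrite big1 // => i _; rewrite jt mulr0.
Qed.

Definition polyfunp A Y m (p : T -> {poly C}) :=
  forall k, polyfun A Y m (fun t => (p t)`_k).

Lemma polyfun_opp A Y m phi : polyfun A Y m phi -> polyfun A Y m (fun t => - phi t).
Proof.
move=> P; have := polyfun_mul (polyfun_const A Y (-1) 0) P; rewrite add0n => Q.
by apply: polyfun_ext Q _ => t _; rewrite mulN1r.
Qed.

Lemma polyfun_sum A Y m (I : Type) (r : seq I) (P : pred I) (F : I -> T -> C) :
  (forall i, P i -> polyfun A Y m (F i)) -> polyfun A Y m (fun t => \sum_(i <- r | P i) F i t).
Proof.
move=> HF; elim: r => [|i r IH].
  by apply: polyfun_ext (polyfun_const A Y 0 m) _ => t _; rewrite big_nil.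
case Pi: (P i); last by apply: polyfun_ext IH _ => t _; rewrite big_cons Pi.
apply: polyfun_ext (polyfun_add (HF i Pi) IH) _ => t _.
by rewrite big_cons Pi.
Qed.

Lemma polyfun_exp A Y m phi k : polyfun A Y m phi -> polyfun A Y (k * m) (fun t => phi t ^+ k).
Proof.
move=> P; elim: k => [|k IH].
  by apply: polyfun_ext (polyfun_const A Y 1 0) _ => t _; rewrite expr0.
rewrite mulSn; apply: polyfun_ext (polyfun_mul P IH) _ => t _.
by rewrite exprS.
Qed.

Lemma polyfunp_mul A Y m k p q : polyfunp A Y m p -> polyfunp A Y k q ->
  polyfunp A Y (m + k) (fun t => p t * q t).
Proof.
move=> Pp Pq l; apply: polyfun_ext => [|t _]; last by rewrite coefM.
by apply: polyfun_sum => i _; apply: polyfun_mul.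
Qed.

Lemma polyfun_horner A Y z M phi : polyfun A (fun y => Y y \/ y = z) M phi ->
  exists p : T -> {poly C}, [/\ polyfunp A Y M p, forall t, (size (p t) <= M.+1)%N &
    forall t, A t -> phi t = (p t).[z t]].
Proof.
elim=> {M phi}.
- move=> a m; exists (fun=> a%:P); split.
  + by move=> k; apply: polyfun_const.
  + by move=> t; rewrite (leq_trans (size_polyC_leq1 _)).
  + by move=> t _; rewrite hornerC.
- move=> y m [Yy|->].
    exists (fun t => (y t)%:P); split.
    + move=> [|k].
        by apply: polyfun_ext (polyfun_gen A m Yy) _ => t _; rewrite coefC.
      by apply: polyfun_ext (polyfun_const A Y 0 m.+1) _ => t _; rewrite coefC.
    + by move=> t; rewrite (leq_trans (size_polyC_leq1 _)).
    + by move=> t _; rewrite hornerC.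
  exists (fun=> 'X); split; [|by move=> t; rewrite size_polyX|by move=> t _; rewrite hornerX].
  by move=> k; apply: polyfun_const.
- move=> m phi psi _ [p [Pp sp Ep]] _ [q [Pq sq Eq]].
  exists (fun t => p t + q t); split.
  + move=> k; apply: polyfun_ext (polyfun_add (Pp k) (Pq k)) _ => t _.
    by rewrite coefD.
  + by move=> t; rewrite (leq_trans (size_polyD _ _)) // geq_max sp sq.
  + by move=> t At; rewrite hornerD Ep ?Eq.
- move=> m k phi psi _ [p [Pp sp Ep]] _ [q [Pq sq Eq]].
  exists (fun t => p t * q t); split; first exact: polyfunp_mul.
  + by move=> t; rewrite (leq_trans (size_polyMleq _ _)) //; have := sp t; have := sq t; lia.
  + by move=> t At; rewrite hornerM Ep ?Eq.
- move=> m phi psi _ [p [Pp sp Ep]] E; exists p; split=> // t At.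
  by rewrite -E ?Ep.
Qed.

(** Common part of adjoining a free and an algebraic function: [k M] bounds the number of powers of
    [z] needed in degree [M], and [eps] collects the leading coefficients introduced by
    pseudo-division. *)
Lemma growth_horner A Y D z k (l L : nat) (eps : nat -> T -> C) : growth A Y D ->
  (forall M t, A t -> eps M t != 0) ->
  (forall M phi, polyfun A (fun y => Y y \/ y = z) M phi ->
     exists p : T -> {poly C}, [/\ polyfunp A Y (l * M + L) p,
       forall t, A t -> (size (p t) <= k M)%N & forall t, A t -> eps M t * phi t = (p t).[z t]]) ->
  exists K, forall M,
  exists (I : finType) (G : I -> T -> C) (delta : T -> C),
  [/\ (#|I| <= K * M.+1 ^ D * k M)%N, (forall t, A t -> delta t != 0) &
   forall phi, polyfun A (fun y => Y y \/ y = z) M phi -> exists c : I -> C,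
     forall t, A t -> delta t * phi t = \sum_i c i * G i t].
Proof.
move=> [K HK] e0 He; exists (K * (l + L).+1 ^ D)%N => M.
have [I [G [delta [cI d0 HG]]]] := HK (l * M + L)%N.
exists (I * 'I_(k M))%type, (fun (ij : I * 'I_(k M)) t => G ij.1 t * z t ^+ ij.2), (fun t => delta t * eps M t).
split.
- rewrite card_prod card_ord leq_mul2r; apply/orP; right.
  apply: leq_trans cI _; rewrite -mulnA leq_mul2l -expnMn; apply/orP; right.
  by apply: leq_expl; nia.
- by move=> t At; rewrite mulf_neq0 ?d0 ?e0.
move=> phi /He[p [Pp sp Ep]].
have /fin_all_exists[c Hc] (j : 'I_(k M)) : exists c : I -> C, forall t, A t ->
  delta t * (p t)`_j = \sum_i c i * G i t by apply: HG; apply: Pp.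
exists (fun ij : I * 'I_(k M) => c ij.2 ij.1) => t At; rewrite -mulrA Ep // (horner_coef_wide _ (sp t At)).
rewrite mulr_sumr.
rewrite (eq_bigr (fun j : 'I_(k M) => \sum_i c j i * G i t * z t ^+ j)); last first.
  by move=> j _; rewrite mulrA Hc // mulr_suml.
rewrite exchange_big pair_bigA /=; apply: eq_bigr => -[i j] _ /=.
by rewrite mulrA.
Qed.

Lemma growth_free A Y D z : growth A Y D -> growth A (fun y => Y y \/ y = z) D.+1.
Proof.
move=> gY; have [||K HK] := @growth_horner A Y D z (fun M => M.+1) 1 0 (fun=> fun=> 1) gY.
- by move=> M t _; rewrite oner_eq0.
- move=> M phi /polyfun_horner[p [Pp sp Ep]]; exists p; split=> //.
    by rewrite mul1n addn0.
  by move=> t At; rewrite mul1r Ep.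
by exists K => M; have := HK M; rewrite -mulnA -expnSr.
Qed.

Lemma size_pseudo_step (p P : {poly C}) k j : size P = k.+1 -> (size p <= k + j.+1)%N ->
  (size (P`_k *: p - p`_(k + j)%N *: ('X^j * P))%R <= k + j)%N.
Proof.
move=> sP sp; apply/leq_sizeP => i ki.
rewrite coefB !coefZ coefXnM; case: ltnP => ij; first by lia.
have [->|ik] := eqVneq i (k + j)%N; first by rewrite addnK mulrC subrr.
rewrite [p`_i]nth_default ?[P`_(i - j)]nth_default ?mulr0 ?subr0 // ?sP; first by lia.
by apply: leq_trans sp _; lia.
Qed.

(** Pseudo-division by [P] brings the degree in [z] below [k], whatever [M] is. The price is a power
    of the leading coefficient, absorbed in the denominator, and a degree in [Y] still linear in
    [M]. *)
Lemma growth_root_fixed A Y D z (P : T -> {poly C}) l k : growth A Y D ->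
  polyfunp A Y l P -> (forall t, A t -> size (P t) = k.+1 /\ (P t).[z t] = 0) ->
  growth A (fun y => Y y \/ y = z) D.
Proof.
move=> gY PP HP.
have red m j (p : T -> {poly C}) : polyfunp A Y m p -> (forall t, A t -> size (p t) <= k + j)%N ->
  exists q : T -> {poly C}, [/\ polyfunp A Y (m + l * j) q, forall t, A t -> (size (q t) <= k)%N &
    forall t, A t -> (P t)`_k ^+ j * (p t).[z t] = (q t).[z t]].
  elim: j m p => [|j IH] m p Pp sp.
    exists p; split=> [||t At]; first by rewrite muln0 addn0.
      by move=> t /sp; rewrite addn0.
    by rewrite expr0 mul1r.
  pose q t := (P t)`_k *: p t - (p t)`_(k + j) *: ('X^j * P t).
  have [||r [Pr sr Er]] := IH (l + m)%N q.
  - move=> i; apply: polyfun_ext (polyfun_add (polyfun_mul (PP k) (Pp i)) (polyfun_opp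
      (m := l + m) (phi := fun t => (p t)`_(k + j) * ('X^j * P t)`_i) _)) _ => [|t _].
      rewrite addnC; apply: polyfun_mul => //; case: (ltnP i j) => ij.
        by apply: polyfun_ext (polyfun_const A Y 0 l) _ => t _; rewrite coefXnM ij.
      by apply: polyfun_ext (PP (i - j)%N) _ => t _; rewrite coefXnM ltnNge ij.
    by rewrite /q coefB !coefZ.
  - by move=> t At; apply: size_pseudo_step; [have [] := HP t At | apply: sp].
  exists r; split=> // [|t At]; first by rewrite mulnS addnA [(m + l)%N]addnC.
  rewrite -Er // /q hornerD hornerN !hornerZ hornerM.
  by have [_ ->] := HP t At; rewrite !mulr0 subr0 exprSr mulrA.
have [||K HK] := @growth_horner A Y D z (fun=> k) l.+1 l (fun M t => (P t)`_k ^+ M.+1) gY.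
- move=> M t /HP[sP _]; rewrite expf_neq0 // -[k]/(k.+1.-1) -sP -lead_coefE lead_coef_eq0.
  by rewrite -size_poly_eq0 sP.
- move=> M phi /polyfun_horner[p [Pp sp Ep]].
  have [|q [Pq sq Eq]] := red M M.+1 p Pp; first by move=> t _; rewrite (leq_trans (sp t)) ?leq_addl.
  exists q; split=> // [i|t At]; last by rewrite Ep ?Eq.
  by apply: polyfun_leq (Pq i); nia.
exists (K * k)%N => M; have := HK M; rewrite -mulnA [(_ ^ D * k)%N]mulnC mulnA.
by [].
Qed.

(** Pseudo-division needs a nonvanishing leading coefficient, so the set is cut according to the
    degree of [P t]. *)
Lemma growth_root A Y D z (P : T -> {poly C}) l b : growth A Y D ->
  polyfunp A Y l P -> (forall t, A t -> [/\ (size (P t) <= b)%N, P t != 0 & (P t).[z t] = 0]) ->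
  growth A (fun y => Y y \/ y = z) D.
Proof.
move=> gY PP HP; apply: (@growth_union 'I_b _ (fun k t => size (P t) = k.+1)).
  move=> t /HP[sb P0 _]; have lt : ((size (P t)).-1 < b)%N.
    by rewrite prednK ?size_poly_gt0.
  by exists (Ordinal lt); rewrite /= prednK ?size_poly_gt0.
move=> k; apply: (@growth_root_fixed _ _ _ _ P l k).
- by apply: growth_sub gY => // t [].
- by move=> i; apply: polyfun_sub (PP i) => // t [].
- by move=> t [/HP[]].
Qed.

Lemma growth_quot A Y D z num den l : growth A Y D ->
  polyfun A Y l num -> polyfun A Y l den ->
  (forall t, A t -> den t != 0 /\ den t * z t = num t) ->
  growth A (fun y => Y y \/ y = z) D.
Proof.
move=> gY Pn Pd H; apply: (@growth_root _ _ _ _ (fun t => (den t) *: 'X - (num t)%:P) l 2 gY).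
- case=> [|[|k]].
  + apply: polyfun_ext (polyfun_opp Pn) _ => t _.
    by rewrite coefB coefZ coefX coefC mulr0 sub0r.
  + by apply: polyfun_ext Pd _ => t _; rewrite coefB coefZ coefX coefC mulr1 subr0.
  + apply: polyfun_ext (polyfun_const A Y 0 l) _ => t _.
    by rewrite coefB coefZ coefX coefC mulr0 subr0.
move=> t /H[d0 E]; have s2 : size (den t *: 'X - (num t)%:P) = 2.
  rewrite size_polyDl size_scale // size_polyX // size_polyN.
  by rewrite ltnS size_polyC_leq1.
split; [by rewrite s2|by rewrite -size_poly_eq0 s2|].
by rewrite hornerD hornerN hornerZ hornerX hornerC E subrr.
Qed.

Lemma growth_frees A Y D k (z : 'I_k -> T -> C) : growth A Y D ->
  growth A (fun y => Y y \/ exists i, y = z i) (D + k).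
Proof.
elim: k z => [|k IH] z gY.
  by rewrite addn0; apply: growth_sub gY => // y [//|[[]]].
rewrite addnS; apply: growth_sub (growth_free (z ord0) (IH (fun i => z (lift ord0 i)) gY)) => //.
move=> y [|[i ->]]; first by left; left.
case: (unliftP ord0 i) => [j|] ->; last by right.
by left; right; exists j.
Qed.

Lemma growth_roots A Y D k (z : 'I_k -> T -> C) (P : 'I_k -> T -> {poly C}) l b : growth A Y D ->
  (forall i, polyfunp A Y l (P i)) ->
  (forall i t, A t -> [/\ (size (P i t) <= b)%N, P i t != 0 & (P i t).[z i t] = 0]) ->
  growth A (fun y => Y y \/ exists i, y = z i) D.
Proof.
elim: k z P => [|k IH] z P gY PP HP.
  by apply: growth_sub gY => // y [//|[[]]].
have {}IH := IH (fun i => z (lift ord0 i)) (fun i => P (lift ord0 i)) gY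
   (fun i => PP _) (fun i => HP _).
apply: growth_sub (@growth_root _ _ _ (z ord0) (P ord0) l b IH _ (HP ord0)) => //.
- move=> y [|[i ->]]; first by left; left.
  case: (unliftP ord0 i) => [j|] ->; last by right.
  by left; right; exists j.
- by move=> i; apply: polyfun_sub (PP _ i) => // y; left.
Qed.

(* Counting: the monomials in the [p i] with exponents at most [M] outnumber
   the dimension of the space they live in. *)
Lemma growth_dep A Y D l (p : 'I_D.+1 -> T -> C) : growth A Y D ->
  (forall i, polyfun A Y l (p i)) ->
  exists F : {mpoly C[D.+1]}, F <> 0 /\ forall t, A t -> F.@[fun i => p i t] = 0.
Proof.
move=> [K HK] Pp.
(* With this [M] the dimension is at most [K * (c0 * M.+1) ^ D = M * M.+1 ^ D], less than the number
   [M.+1 ^ D.+1] of exponent vectors. *)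
pose c0 := (l * D.+1).+1; pose M := (K * c0 ^ D)%N.
have [I [G [delta [cI d0 HG]]]] := HK (l * D.+1 * M)%N.
pose E := {ffun 'I_D.+1 -> 'I_M.+1}.
have ltI : (#|I| < #|E|)%N.
  rewrite card_ffun !card_ord; apply: leq_ltn_trans cI _.
  rewrite expnS; apply: leq_ltn_trans (_ : M * M.+1 ^ D < _)%N.
    have -> : (M * M.+1 ^ D = K * (c0 * M.+1) ^ D)%N by rewrite expnMn mulnA.
    rewrite leq_mul2l; apply/orP; right.
    by apply: leq_expl; rewrite /c0; nia.
  by rewrite ltn_mul2r ltnSn expn_gt0.
have Pm (e : E) : polyfun A Y (l * D.+1 * M) (fun t => \prod_i p i t ^+ e i).
  suff H (r : seq 'I_D.+1) : polyfun A Y (l * size r * M) (fun t => \prod_(i <- r) p i t ^+ e i).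
    by have := H (index_enum _); rewrite -[index_enum _]enumT size_enum_ord.
  elim: r => [|i r IH].
    by apply: polyfun_ext (polyfun_const A Y 1 _) _ => t _; rewrite big_nil.
  apply: polyfun_ext => [|t _]; last by rewrite big_cons.
  rewrite /= mulnS mulnDl; apply: polyfun_mul IH.
  by apply: polyfun_leq (polyfun_exp (e i) (Pp i)); rewrite mulnC leq_mul2l -ltnS ltn_ord orbT.
have /fin_all_exists[c Hc] e := HG _ (Pm e).
pose W := \matrix_(i < #|E|, j < #|I|) c (enum_val i) (enum_val j).
have : \rank (kermx W) != 0%N.
  by rewrite mxrank_ker -lt0n subn_gt0 (leq_ltn_trans (rank_leq_col _)).
rewrite mxrank_eq0 => /rowV0Pn[a /sub_kermxP aW /eqP a0].
exists (\sum_i a 0 i *: 'X_[[multinom (enum_val i j : nat) | j < D.+1]]); split.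
  move=> F0; apply: a0; apply/rowP => i; rewrite mxE.
  have := congr1 (mcoeff [multinom (enum_val i j : nat) | j < D.+1]) F0.
  rewrite mcoeff0 raddf_sum /= (bigD1 i) //= mcoeffZ mcoeffX eqxx mulr1.
  rewrite big1 ?addr0 // => k ki; rewrite mcoeffZ mcoeffX; case: eqP => [Ek|_]; last by rewrite mulr0.
  case/eqP: ki; apply: enum_val_inj; apply/ffunP => j; apply/val_inj.
  by move/mnmP/(_ j): Ek; rewrite !mnmE.
move=> t At; apply: (mulfI (d0 t At)); rewrite mulr0 raddf_sum mulr_sumr /=.
transitivity (\sum_(j < #|I|) (a *m W) 0 j * G (enum_val j) t); last first.
  by rewrite aW big1 // => j _; rewrite mxE mul0r.
rewrite (eq_bigr (fun j => \sum_i a 0 i * c (enum_val i) (enum_val j) * G (enum_val j) t));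
  last by move=> j _; rewrite mxE mulr_suml; apply: eq_bigr => i _; rewrite mxE.
rewrite exchange_big; apply: eq_bigr => i _; rewrite mevalZ mevalX mulrCA.
rewrite (eq_bigr (fun j => p j t ^+ (enum_val i j : nat))); last by move=> j _; rewrite mnmE.
rewrite Hc // mulr_sumr [LHS](reindex (@enum_val I xpredT)) /=; last exact/onW_bij/enum_val_bij.
by apply: eq_bigr => j _; rewrite mulrA.
Qed.
End Counting.

(** * Generic auxiliary parameters *)

Section Lifting.
Variable C : closedFieldType.

(** Parameters are chosen one after another, each outside a finite set that may depend on the
    earlier ones; no common Zariski open set is required. *)
Fixpoint ncofinite m (Z : seq C -> Prop) : Prop :=
  if m is m'.+1 then cofinite (fun s => ncofinite m' (fun l => Z (s :: l))) else Z [::].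

(** Each coordinate is a constant or the parameter at a given position, so that an induction can
    freeze the first parameter as a constant. *)
Definition mixed_point r (kap : 'I_r -> C + nat) (l : seq C) (i : 'I_r) : C :=
  match kap i with inl a => a | inr k => nth 0 l k end.

(** With the other parameters fixed, [F] is a polynomial in the first one with cofinitely many
    zeros, hence zero; the induction treats the parameters one at a time. *)
Lemma ncofinite_vanish r (F : {mpoly C[r]}) m kap Z : ncofinite m Z ->
  (forall l, Z l -> size l = m -> F.@[mixed_point kap l] = 0) ->
  forall l, size l = m -> F.@[mixed_point kap l] = 0.
Proof.
elim: m kap Z => [|m IH] kap Z /=.
  by move=> Z0 H l /size0nil ->; apply: H.
move=> cZ H [//|s0 l] [sl].
pose q i : {poly C} := match kap i with inl a => a%:P | inr 0%N => 'X
   | inr k.+1 => (nth 0 l k)%:P end.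
pose p : {poly C} := mmap polyC q F.
have Ep s : p.[s] = F.@[mixed_point kap (s :: l)].
  rewrite /p /mmap mevalE horner_sum; apply: eq_bigr => mm _.
  rewrite hornerM hornerC; congr (_ * _).
  rewrite /mmap1 horner_prod; apply: eq_bigr => i _; rewrite horner_exp; congr (_ ^+ _).
  by rewrite /q /mixed_point; case: (kap i) => [a|[|k]]; rewrite ?hornerC ?hornerX.
rewrite -Ep (cofinite_poly0 (p := p)) ?horner0 //.
apply: cofinite_imp cZ => s Zs; rewrite Ep.
pose kap' i := match kap i with inl a => inl a | inr 0%N => inl s | inr k.+1 => inr k end.
have E l' : mixed_point kap' l' =1 mixed_point kap (s :: l').
  by move=> i; rewrite /mixed_point /kap'; case: (kap i) => [a|[|k]].
rewrite -(meval_eq _ (E l)); apply: (IH _ _ Zs) => // l' Zl' sl'.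
by rewrite (meval_eq _ (E l')); apply: H => //=; rewrite sl'.
Qed.

Definition lift_coord N m : (('I_N -> C) * seq C -> C) -> Prop :=
  fun y => (exists i, y = fun t => t.1 i) \/ (exists k : 'I_m, y = fun t => nth 0 t.2 k).

Lemma polyfun_meval (T : Type) (A : T -> Prop) Y r (p : {mpoly C[r]}) (z : 'I_r -> T -> C) :
  (forall i, Y (z i)) -> exists k, polyfun A Y k (fun t => p.@[fun i => z i t]).
Proof.
move=> Yz; pose Q p := exists k, polyfun A Y k (fun t => p.@[fun i => z i t]).
suff : Q p by [].
elim/mpolyind: p => [|c m p _ _ [k Pk]].
  by exists 0%N; apply: polyfun_ext (polyfun_const A Y 0 0) _ => t _; rewrite meval0.
have [k' Pk'] : Q 'X_[m].
  have [k' Pk'] : exists k, polyfun A Y k (fun t => \prod_(i < r) z i t ^+ m i).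
    elim: (index_enum _) => [|i s [k' IH]].
      by exists 0%N; apply: polyfun_ext (polyfun_const A Y 1 0) _ => t _; rewrite big_nil.
    exists (m i * 1 + k')%N; apply: polyfun_ext => [|t _]; last by rewrite big_cons.
    by apply: polyfun_mul IH; apply: polyfun_exp; apply: polyfun_gen.
  by exists k'; apply: polyfun_ext Pk' _ => t _; rewrite mevalX.
exists (0 + k' + k)%N; apply: polyfun_ext => [|t _]; last by rewrite mevalD mevalZ.
apply: polyfun_add; last by apply: polyfun_leq Pk; lia.
by apply: polyfun_leq (polyfun_mul (polyfun_const A Y c 0) Pk'); lia.
Qed.

(* Auxiliary parameters [l] that may be chosen generically for every point of
   [S] do not contribute to the dimension of [S]. *)
Lemma alg_dep_lift N (S : ('I_N -> C) -> Prop) D m (A : ('I_N -> C) * seq C -> Prop) :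
  growth A (@lift_coord N m) (D + m) ->
  (forall x, S x -> ncofinite m (fun l => A (x, l))) -> alg_dep S D.
Proof.
move=> gA SA p.
pose q (i : 'I_(D.+1 + m)) (t : ('I_N -> C) * seq C) : C :=
  match split i with inl a => (p a).@[t.1] | inr b => nth 0 t.2 b end.
have [l Pq] : exists l, forall i, polyfun A (@lift_coord N m) l (q i).
  apply: fin_bound => [i m1 m2|i]; first exact: polyfun_leq.
  rewrite /q; case: (split i) => [a|b].
    apply: (@polyfun_meval _ _ _ _ _ (fun i t => t.1 i)) => j.
    by left; exists j.
  by exists 1%N; apply: polyfun_gen; right; exists b.
have [F [F0 HF]] := growth_dep gA Pq.
have [v Fv] : exists v, F.@[v] <> 0.
  by apply: not_all_ex_not => H; apply: F0; apply: mpoly_nonvanish.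
(* The relation [F] between the [p a] and the parameters holds for generic parameters, hence for
   all. Freezing the parameters at coordinates of a point [v] where [F] is nonzero leaves a nonzero
   relation between the [p a] alone. *)
pose w (i : 'I_(D.+1 + m)) : {mpoly C[D.+1]} :=
  match split i with inl a => 'X_a | inr b => (v (rshift D.+1 b))%:MP end.
pose F' : {mpoly C[D.+1]} := mmap (@mpolyC _ C) w F.
have EF' u : F'.@[u] =
    F.@[fun i => match split i with inl a => u a | inr b => v (rshift D.+1 b) end].
  rewrite meval_mmapC; apply: meval_eq => i; rewrite /w.
  by case: (split i) => a; rewrite ?mevalXU ?mevalC.
exists F'; split.
  move=> F'0; apply: Fv; have := congr1 (meval (fun a : 'I_D.+1 => v (@lshift D.+1 m a))) F'0.
  rewrite meval0 EF' => <-; apply: meval_eq => i.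
  by case: split_ordP => j ->.
move=> x Sx; rewrite EF'.
pose kap (i : 'I_(D.+1 + m)) : C + nat :=
  match split i with inl a => inl (p a).@[x] | inr b => inr (b : nat) end.
pose l0 := [seq v (rshift D.+1 b) | b <- enum 'I_m].
have := ncofinite_vanish (F := F) (kap := kap) (SA x Sx) _ (l := l0).
rewrite size_map size_enum_ord => H.
transitivity F.@[mixed_point kap l0].
  apply: meval_eq => i; rewrite /mixed_point /kap; case: (split i) => // b.
  by rewrite (nth_map b) ?size_enum_ord // nth_ord_enum.
apply: H => // l' Al' sl'; rewrite -[RHS](HF _ Al'); apply: meval_eq => i.
by rewrite /mixed_point /kap /q; case: (@split D.+1 m i).
Qed.
End Lifting.

(** * Kernels of matrices of polynomial functions *)

Section Kernels.
Variables (C : closedFieldType) (T : Type).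

(* Eliminating one column at a time, the kernel of a matrix of polynomial
   functions is spanned pointwise by finitely many polynomial vectors. *)
Lemma ker_polyfun (A : T -> Prop) Y l a b (col : 'I_b -> T -> 'cV[C]_a) :
  (forall j i, polyfun A Y l (fun t => col j t i 0)) ->
  exists l' (I : finType) (phi : I -> T -> 'rV[C]_a),
  (forall k i, polyfun A Y l' (fun t => phi k t 0 i)) /\
  forall t (v : 'rV[C]_a), (forall j, v *m col j t = 0) ->
    exists z : I -> C, v = \sum_k z k *: phi k t /\
      forall k, z k != 0 -> forall j, phi k t *m col j t = 0.
Proof.
elim: b col => [|b IH] col Pcol.
  exists 0%N, 'I_a, (fun k _ => delta_mx 0 k); split.
    by move=> k i; apply: polyfun_const.
  move=> t v _; exists (fun k => v 0 k); split; last by move=> k _ [].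
  by rewrite [LHS]matrix_sum_delta big_ord1.
have [l' [I [phi [Pphi Hphi]]]] := IH (fun j => col (lift ord0 j)) (fun j => Pcol _).
pose tau k t := (phi k t *m col ord0 t) 0 0.
have Ptau k : polyfun A Y (l' + l) (tau k).
  apply: polyfun_ext => [|t _]; last by rewrite /tau mxE.
  by apply: polyfun_sum => i _; apply: polyfun_mul.
(* No pivot works for every [t], so the old vectors and all the combinations of two of them that
   kill the new column are kept as candidates. *)
exists (l' + l + l')%N, (I + I * I)%type,
  (fun kk t => match kk with inl k => phi k t
     | inr (k, k') => tau k t *: phi k' t - tau k' t *: phi k t end); split.
  move=> [k|[k k']] i; first by apply: polyfun_leq (Pphi k i); lia.
  apply: polyfun_ext => [|t _]; last by rewrite !mxE.
  by apply: polyfun_add; [|apply: polyfun_opp]; apply: polyfun_mul.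
move=> t v Hv; have [|z [Ev Hz]] := Hphi t v; first by move=> j; apply: Hv.
have Hall k : z k != 0 -> forall j, j != ord0 -> phi k t *m col j t = 0.
  by move=> zk j; case: (unliftP ord0 j) => [i|] ->; rewrite ?eqxx // => _; apply: Hz.
have sum0 : \sum_k z k * tau k t = 0.
  have := congr1 (fun M => (M *m col ord0 t) 0 0) Ev; rewrite Hv mxE => E0; rewrite [RHS]E0.
  rewrite mulmx_suml summxE; apply: eq_bigr => k _.
  by rewrite -scalemxAl [RHS]mxE.
have [k0 /andP[z0 t0]|tau0] := pickP (fun k => (z k != 0) && (tau k t != 0)); last first.
  exists (fun kk => if kk is inl k then z k else 0); split.
    rewrite big_sumType /= [X in _ + X]big1 ?addr0 //= => -[k k'] _.
    by rewrite scale0r.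
  move=> [k|kk]; last by rewrite eqxx.
  move=> zk j; have [->|jn] := eqVneq j ord0; last exact: Hall.
  move: (tau0 k); rewrite zk /= => /negbFE/eqP tk.
  by rewrite [LHS]mx11_scalar -/(tau k t) tk scalemx0 || rewrite [LHS]mx11_scalar -/(tau k t) tk raddf0.
(* With pivot [k0], dividing by [tau k0 t] recovers [v]: the correction terms along [phi k0] add up
   to a multiple of [sum0]. *)
exists (fun kk => match kk with inl _ => 0 | inr (k, k') => if k == k0 then z k' / tau k0 t else 0 end).
split; last first.
  move=> [k|[k k']]; rewrite ?eqxx //; case: (eqVneq k k0) => [->|_]; last by rewrite eqxx.
  move=> zk'; have zk : z k' != 0 by apply: contraNneq zk' => ->; rewrite mul0r.
  move=> j; rewrite mulmxBl -!scalemxAl.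
  have [->|jn] := eqVneq j ord0; last by rewrite !Hall ?scaler0 ?subrr.
  rewrite [phi k' t *m _]mx11_scalar [phi k0 t *m _]mx11_scalar -!/(tau _ t).
  by rewrite !scale_scalar_mx mulrC subrr.
rewrite big_sumType /= [X in X + _]big1 ?add0r; last by move=> k _; rewrite scale0r.
transitivity (\sum_k \sum_k' (if k == k0 then z k' / tau k0 t else 0) *:
   (tau k t *: phi k' t - tau k' t *: phi k t)); last first.
  by rewrite pair_bigA; apply: eq_bigr => -[].
rewrite (bigD1 k0) //= [X in _ + X]big1 ?addr0; last first.
  by move=> k /negPf ->; rewrite big1 // => k' _; rewrite scale0r.
rewrite eqxx Ev.
rewrite [RHS](eq_bigr (fun k => z k *: phi k t - (z k * tau k t) *: ((tau k0 t)^-1 *: phi k0 t))).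
  by rewrite sumrB -scaler_suml sum0 scale0r subr0.
move=> k _; rewrite scalerBr !scalerA mulfVK //; congr (_ - _ *: _).
by rewrite mulrAC.
Qed.

Lemma sub_rows_rank (F : fieldType) m a k (Phi : 'M[F]_(m, a)) (v : 'rV[F]_a) :
  (\rank Phi <= k)%N -> (v <= Phi)%MS -> exists (s : 'I_k -> option 'I_m) (z : 'I_k -> F),
  v = \sum_j z j *: (if s j is Some i then row i Phi else 0).
Proof.
move=> rk; rewrite -(eq_maxrowsub Phi) => /submxP[u Eu].
exists (fun j : 'I_k => omap (maxrankfun Phi) (insub (j : nat))).
exists (fun j : 'I_k => if insub (j : nat) is Some j' then u 0 j' else 0).
pose G (j : nat) : 'rV[F]_a := if insub j is Some j' then u 0 j' *: row (maxrankfun Phi j') Phi else 0.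
rewrite Eu mulmx_sum_row (eq_bigr (fun i : 'I_(\rank Phi) => G i)); last first.
  by move=> i _; rewrite /G valK row_rowsub.
rewrite (big_ord_widen _ G rk) big_mkcond; apply: eq_bigr => j _; rewrite /G.
by case: insubP => [j' -> _|/negPf ->] //=; rewrite scale0r.
Qed.

(** Cutting by the choice of at most [k] of the finitely many spanning vectors makes [v] a
    combination of [k] known vectors, and its [k] coefficients are adjoined freely. *)
Lemma growth_ker (A : T -> Prop) Y D l a b (col : 'I_b -> T -> 'cV[C]_a) k (v : T -> 'rV[C]_a) :
  growth A Y D ->
  (forall j i, polyfun A Y l (fun t => col j t i 0)) ->
  (forall t, A t -> forall j, v t *m col j t = 0) ->
  (forall t, A t -> forall r (Phi : 'M[C]_(r, a)), (forall j, Phi *m col j t = 0) ->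
     (\rank Phi <= k)%N) ->
  growth A (fun y => Y y \/ exists i, y = fun t => v t 0 i) (D + k).
Proof.
move=> gY Pcol Hv Hk; have [l' [I [phi [Pphi Hphi]]]] := ker_polyfun Pcol.
pose row_of (s : option I) t := if s is Some i then phi i t else 0.
apply: (@growth_union _ _ {ffun 'I_k -> option I} _
  (fun s t => exists z : 'I_k -> C, v t = \sum_j z j *: row_of (s j) t)).
  move=> t At; have [z [Ez Hz]] := Hphi t (v t) (Hv t At).
  pose ok i := [forall j, phi i t *m col j t == 0].
  pose Phi := \matrix_(i < #|I|) (if ok (enum_val i) then phi (enum_val i) t else 0).
  have rk : (\rank Phi <= k)%N.
    apply: (Hk t At) => j; apply/row_matrixP => i; rewrite row_mul rowK row0.
    by case: ifP => [/forallP/(_ j)/eqP //|_]; rewrite mul0mx.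
  have : (v t <= Phi)%MS.
    rewrite Ez summx_sub // => i _; have [->|zi] := eqVneq (z i) 0; first by rewrite scale0r sub0mx.
    rewrite scalemx_sub //; have -> : phi i t = row (enum_rank i) Phi.
      rewrite rowK enum_rankK ifT //; apply/forallP => j; apply/eqP; exact: Hz.
    exact: row_sub.
  move=> /(sub_rows_rank rk)[s [z' Ez']].
  exists [ffun j => omap enum_val (s j)].
  exists (fun j => if s j is Some i then if ok (enum_val i) then z' j else 0 else 0).
  rewrite Ez'; apply: eq_bigr => j _; rewrite ffunE; case: (s j) => [i|] /=.
    by rewrite rowK; case: ifP => // _; rewrite scaler0 scale0r.
  by rewrite !scaler0.
move=> s; set A' := fun t => A t /\ _.
have [z Hz] : exists z : T -> 'I_k -> C, forall t, A' t -> v t = \sum_j z t j *: row_of (s j) t.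
  by apply: (@choose_on _ _ A' (fun t z => v t = \sum_j z j *: row_of (s j) t) (fun=> 0)) => t [].
have gz : growth A' (fun y => Y y \/ exists j, y = fun t => z t j) (D + k).
  have gY' : growth A' Y D by apply: growth_sub gY => // t [].
  exact: (growth_frees (fun j t => z t j) gY').
apply: (growth_comp (k := (1 + l').+1)) gz => y [Yy|[i ->]].
  by apply: polyfun_gen; left.
apply: polyfun_leq (leqnSn _) _.
apply: (@polyfun_ext _ _ _ _ _ (fun t => \sum_j z t j * row_of (s j) t 0 i)) => [|t At]; last first.
  by rewrite Hz // summxE; apply: eq_bigr => j _; rewrite mxE.
apply: polyfun_sum => j _; apply: polyfun_mul.
  by apply: polyfun_gen; right; exists j.
rewrite /row_of; case: (s j) => [i'|].
  by apply: polyfun_sub (Pphi i' i) => [t []//|y']; left.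
by apply: polyfun_ext (polyfun_const A' _ 0 l') _ => t _; rewrite mxE.
Qed.
End Kernels.

(** * Linear algebra modulo a subspace *)

Lemma ex_max_nat (P : nat -> Prop) B k0 : P k0 -> (forall k, P k -> (k <= B)%N) ->
  exists k, P k /\ ~ P k.+1.
Proof.
move=> P0 PB; apply: NNPP => H.
have PS k : P k -> P k.+1 by move=> Pk; apply: NNPP => nP; apply: H; exists k.
have Pk j : P (j + k0)%N by elim: j => // j IH; rewrite addSn; apply: PS.
by have := PB _ (Pk B.+1); lia.
Qed.

Lemma ex_min_nat (P : nat -> Prop) : (exists k, P k) ->
  exists k, P k /\ forall j, P j -> (k <= j)%N.
Proof.
move=> [k Pk]; apply: NNPP => H.
suff : forall m j, (j <= m)%N -> ~ P j by move/(_ k k (leqnn k)).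
elim=> [|m IH] j jm Pj; apply: H; exists j; split=> // i Pi.
  by move: jm; rewrite leqn0 => /eqP ->.
rewrite leqNgt; apply/negP => ij; apply: IH (Pi); lia.
Qed.

Section LinearPredicates.
Variables (F : fieldType) (E : lmodType F).
Implicit Types (U V : E -> Prop).

Definition linpred U := U 0 /\ forall a p q, U p -> U q -> U (a *: p + q).

Definition indep_mod U k (v : 'I_k -> E) :=
  forall a : 'I_k -> F, U (\sum_i a i *: v i) -> forall i, a i = 0.

Definition span_mod U k (v : 'I_k -> E) p := exists a : 'I_k -> F, U (p - \sum_i a i *: v i).

Lemma linpredD U p q : linpred U -> U p -> U q -> U (p + q).
Proof. by move=> [_ H] Up Uq; rewrite -[p]scale1r; apply: H. Qed.

Lemma linpredZ U a p : linpred U -> U p -> U (a *: p).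
Proof. by move=> [U0 H] Up; rewrite -[_ *: _]addr0; apply: H. Qed.

Lemma linpredB U p q : linpred U -> U p -> U q -> U (p - q).
Proof.
by move=> UU Up Uq; apply: linpredD => //; rewrite -scaleN1r; apply: linpredZ.
Qed.

Lemma linpred_sum U (I : Type) (r : seq I) (P : pred I) (w : I -> E) : linpred U ->
  (forall i, P i -> U (w i)) -> U (\sum_(i <- r | P i) w i).
Proof.
move=> UU Uw; elim/big_ind: _ => [|p q|i]; first by case: UU.
  exact: linpredD.
exact: Uw.
Qed.

Lemma linpred_eq0 : linpred (fun p : E => p = 0).
Proof. by split=> // a p q -> ->; rewrite scaler0 addr0. Qed.

Lemma linpred_span U k (v : 'I_k -> E) : linpred U -> linpred (span_mod U v).
Proof.
move=> UU; split.
  exists (fun=> 0); rewrite big1 ?subr0; first by case: UU.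
  by move=> i _; rewrite scale0r.
move=> a p q [b Hb] [c Hc]; exists (fun i => a * b i + c i).
rewrite (eq_bigr (fun i => a *: (b i *: v i) + c i *: v i)); last first.
  by move=> i _; rewrite scalerDl scalerA.
rewrite big_split /= -scaler_sumr opprD addrACA -scalerBr.
by apply: (proj2 UU).
Qed.

Lemma span_mod_mem U k (v : 'I_k -> E) i : linpred U -> span_mod U v (v i).
Proof.
move=> UU; exists (fun j => (j == i)%:R); rewrite (bigD1 i) //= eqxx scale1r big1 ?addr0 ?subrr.
  by case: UU.
by move=> j /negPf ->; rewrite scale0r.
Qed.

Lemma span_mod_sub U k (v : 'I_k -> E) p : linpred U -> U p -> span_mod U v p.
Proof.
by move=> UU Up; exists (fun=> 0); rewrite big1 ?subr0 // => i _; rewrite scale0r.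
Qed.

Lemma span_mod_min U V k (v : 'I_k -> E) p : linpred V -> (forall q, U q -> V q) ->
  (forall i, V (v i)) -> span_mod U v p -> V p.
Proof.
move=> VV UV Vv [a /UV Ha]; rewrite -[p](subrK (\sum_i a i *: v i)).
by apply: linpredD => //; apply: linpred_sum => // i _; apply: linpredZ.
Qed.

Lemma indep_le_span U k l (v : 'I_k -> E) (w : 'I_l -> E) : linpred U ->
  indep_mod U w -> (forall i, span_mod U v (w i)) -> (l <= k)%N.
Proof.
move=> UU iw /fin_all_exists[a Ha]; rewrite leqNgt; apply/negP => kl.
pose W := \matrix_(i < l, j < k) a i j.
have : \rank (kermx W) != 0%N.
  by rewrite mxrank_ker -lt0n subn_gt0 (leq_ltn_trans (rank_leq_col _)).
rewrite mxrank_eq0 => /rowV0Pn[b /sub_kermxP bW /eqP b0]; apply: b0.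
apply/rowP => i; rewrite mxE; apply: (iw (fun i => b 0 i)).
have -> : \sum_i b 0 i *: w i = \sum_i b 0 i *: (w i - \sum_j a i j *: v j).
  rewrite [RHS](eq_bigr (fun i => b 0 i *: w i - \sum_j (b 0 i * a i j) *: v j)); last first.
    by move=> j _; rewrite scalerBr scaler_sumr; under [in RHS]eq_bigr do rewrite -scalerA.
  rewrite sumrB [X in _ - X]exchange_big [X in _ - X]big1 ?subr0 //= => j _.
  rewrite -scaler_suml; have -> : \sum_i b 0 i * a i j = (b *m W) 0 j.
    by rewrite mxE; apply: eq_bigr => i' _; rewrite mxE.
  by rewrite bW mxE scale0r.
by apply: linpred_sum => // j _; apply: linpredZ.
Qed.

Definition extend_fam k (v : 'I_k -> E) p (i : 'I_k.+1) := if unlift ord0 i is Some j then v j else p.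

Lemma extend_fam0 k (v : 'I_k -> E) p : extend_fam v p ord0 = p.
Proof. by rewrite /extend_fam unlift_none. Qed.

Lemma extend_famS k (v : 'I_k -> E) p i : extend_fam v p (lift ord0 i) = v i.
Proof. by rewrite /extend_fam liftK. Qed.

Lemma indep_extend_fam U k (v : 'I_k -> E) p : linpred U -> indep_mod U v -> ~ span_mod U v p ->
  indep_mod U (extend_fam v p).
Proof.
move=> UU iv nsp a; rewrite big_ord_recl extend_fam0.
rewrite (eq_bigr (fun i => a (lift ord0 i) *: v i)); last by move=> i _; rewrite extend_famS.
move=> Ua; have a0 : a ord0 = 0.
  apply/eqP/negPn/negP => a0; apply: nsp; exists (fun i => - (a ord0)^-1 * a (lift ord0 i)).
  have := linpredZ (a ord0)^-1 UU Ua; rewrite scalerDr scalerA mulVf // scale1r.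
  rewrite scaler_sumr -sumrN; congr (U (_ + _)); apply: eq_bigr => i _.
  by rewrite mulNr scaleNr opprK scalerA.
move: Ua; rewrite a0 scale0r add0r => /iv Ha i.
by case: (unliftP ord0 i) => [j|] ->.
Qed.

Lemma max_indep U V B : linpred U ->
  (forall k (v : 'I_k -> E), (forall i, V (v i)) -> indep_mod U v -> (k <= B)%N) ->
  exists k (v : 'I_k -> E), [/\ forall i, V (v i), indep_mod U v & forall p, V p -> span_mod U v p].
Proof.
move=> UU HB.
pose P k := exists v : 'I_k -> E, (forall i, V (v i)) /\ indep_mod U v.
have P0 : P 0%N by exists (fun=> 0); split=> [[]|a _ []].
have [k [[v [Vv iv]] nP]] := ex_max_nat P0 (B := B) (fun k '(ex_intro v (conj a b)) => HB k v a b).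
exists k, v; split=> // p Vp; apply: NNPP => np; apply: nP.
exists (extend_fam v p); split; last exact: indep_extend_fam.
by move=> i; case: (unliftP ord0 i) => [j|] ->; rewrite ?extend_fam0 ?extend_famS.
Qed.

Lemma sub_basis U m (w : 'I_m -> E) : linpred U -> exists k (s : 'I_k -> 'I_m),
  indep_mod U (fun i => w (s i)) /\ forall i, span_mod U (fun i => w (s i)) (w i).
Proof.
move=> UU; have [|k [v [Vv iv sv]]] := @max_indep U (fun p => exists i, p = w i) m UU.
  move=> k v Vv iv; apply: (indep_le_span (v := w) UU iv) => i.
  by have [j ->] := Vv i; apply: span_mod_mem.
have [s Hs] := fin_all_exists Vv; exists k, s; split.
  move=> a Ha; apply: iv; move: Ha; congr U.
  by apply: eq_bigr => i _; rewrite Hs.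
move=> i; have [|a Ha] := sv (w i); first by exists i.
by exists a; move: Ha; congr (U (_ - _)); apply: eq_bigr => j _; rewrite Hs.
Qed.
End LinearPredicates.

(** * The graded ring of the image curve *)

Section GradedRing.
Variable C : closedFieldType.
Implicit Types p q : {poly C}.

Section Def.
Variables (k : nat) (f : 'I_k -> {poly C}).

(** The degree [m] part of the homogeneous coordinate ring after setting u = 1. Peeling off one
    generator at a time makes products an induction; [graded_span] gives the description by
    monomials. *)
Fixpoint graded m p : Prop :=
  if m is m'.+1 then exists r : 'I_k -> {poly C},
    (forall i, graded m' (r i)) /\ p = \sum_i f i * r i
  else exists a, p = a%:P.

Lemma linpred_graded m : linpred (graded m).
Proof.
elim: m => [|m IH]; split=> /=.
- by exists 0.
- move=> a p q [b ->] [c ->]; exists (a * b + c).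
  by rewrite polyCD polyCM mul_polyC.
- exists (fun=> 0); split; first by move=> i; case: IH.
  by rewrite big1 // => i _; rewrite mulr0.
- move=> a p q [r [Hr ->]] [s [Hs ->]]; exists (fun i => a *: r i + s i); split.
    by move=> i; apply: (proj2 IH).
  rewrite scaler_sumr -big_split; apply: eq_bigr => i _ /=.
  by rewrite mulrDr scalerAr.
Qed.

Lemma gradedM m l p q : graded m p -> graded l q -> graded (m + l) (p * q).
Proof.
elim: m p => [|m IH] p.
  by move=> [a ->] Hq; rewrite mul_polyC; apply: linpredZ => //; apply: linpred_graded.
move=> [r [Hr ->]] Hq; rewrite addSn; exists (fun i => r i * q); split; first by move=> i; apply: IH (Hr i) Hq.
by rewrite mulr_suml; apply: eq_bigr => i _; rewrite mulrA.
Qed.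

Lemma graded_gen i : graded 1 (f i).
Proof.
exists (fun j => (j == i)%:R%:P); split; first by move=> j; exists (j == i)%:R.
by rewrite (bigD1 i) //= eqxx mulr1 big1 ?addr0 // => j /negPf ->; rewrite mulr0.
Qed.

Lemma graded_comb (a : 'I_k -> C) : graded 1 (\sum_i a i *: f i).
Proof.
apply: linpred_sum => [|i _]; first exact: linpred_graded.
by apply: linpredZ; [apply: linpred_graded | apply: graded_gen].
Qed.

Lemma graded1P p : graded 1 p <-> exists a : 'I_k -> C, p = \sum_i a i *: f i.
Proof.
split=> [[r [/fin_all_exists[a Ha] ->]]|[a ->]]; last exact: graded_comb.
by exists a; apply: eq_bigr => i _; rewrite Ha mulrC mul_polyC.
Qed.

Lemma graded_exp p j : graded 1 p -> graded j (p ^+ j).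
Proof.
move=> Hp; elim: j => [|j IH]; first by exists 1.
by rewrite exprS -add1n; apply: gradedM.
Qed.

Lemma size_graded d m p : (forall i, size (f i) <= d.+1)%N -> graded m p ->
  (size p <= (m * d).+1)%N.
Proof.
move=> sf; elim: m p => [|m IH] p; first by move=> [a ->]; rewrite size_polyC_leq1.
move=> [r [Hr ->]]; apply: leq_trans (size_sum _ _ _) _; apply/bigmax_leqP => i _.
apply: leq_trans (size_polyMleq _ _) _.
have := sf i; have := IH _ (Hr i); set u := size _; set v := size _; rewrite mulSn; lia.
Qed.

Lemma graded_span m p : graded m p <-> exists a : {ffun 'I_k -> 'I_m.+1} -> C,
  p = \sum_(e : {ffun 'I_k -> 'I_m.+1} | (\sum_i (e i : nat) == m)%N) a e *: \prod_i f i ^+ e i.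
Proof.
split; last first.
  move=> [a ->]; apply: linpred_sum => [|e /eqP Ee]; first exact: linpred_graded.
  apply: linpredZ; first exact: linpred_graded.
  rewrite -[X in graded X _]Ee; elim: (index_enum _) => [|i r IH]; first by rewrite !big_nil; exists 1.
  by rewrite !big_cons; apply: gradedM IH; apply/graded_exp/graded_gen.
pose P m p := exists a : {ffun 'I_k -> 'I_m.+1} -> C,
  p = \sum_(e : {ffun 'I_k -> 'I_m.+1} | (\sum_i (e i : nat) == m)%N) a e *: \prod_i f i ^+ e i.
rewrite -/(P m p).
have PL m' : linpred (P m').
  split; first by exists (fun=> 0); rewrite big1 // => e _; rewrite scale0r.
  move=> c u v [a ->] [b ->]; exists (fun e => c * a e + b e).
  rewrite scaler_sumr -big_split; apply: eq_bigr => e _ /=.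
  by rewrite scalerDl scalerA.
elim: m p => [|m IH] p /=.
  move=> [a ->]; exists (fun=> a); rewrite (bigD1 [ffun=> ord0]) /=; last first.
    by rewrite big1 // => i _; rewrite ffunE.
  rewrite [X in _ + X]big1 ?addr0 => [|e /andP[_ /negP[]]]; last first.
    by apply/eqP/ffunP => i; rewrite ffunE [e i]ord1.
  rewrite big1 ?alg_polyC // => i _; by rewrite ffunE expr0.
move=> [r [Hr ->]]; apply: linpred_sum => // i _; have [a ->] := IH _ (Hr i).
rewrite mulr_sumr; apply: linpred_sum => // e /eqP Ee; rewrite -scalerAr; apply: linpredZ => //.
pose e' : {ffun 'I_k -> 'I_m.+2} := [ffun j => inord (e j + (j == i))].
have Ee' j : e' j = (e j + (j == i))%N :> nat.
  by rewrite ffunE inordK //; have := ltn_ord (e j); case: (j == i); lia.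
exists (fun e1 => (e1 == e')%:R); rewrite (bigD1 e') /=; last first.
  rewrite (eq_bigr _ (fun j _ => Ee' j)) big_split /= Ee.
  by rewrite (bigD1 i) //= eqxx big1 ?addn1 // => j /negPf ->.
rewrite eqxx scale1r [X in _ + X]big1 ?addr0; last first.
  by move=> e1 /andP[_ /negPf ->]; rewrite scale0r.
rewrite (bigD1 i) //= [in RHS](bigD1 i) //= Ee' eqxx addn1 exprS mulrA; congr (_ * _).
by apply: eq_bigr => j /negPf ji; rewrite Ee' ji addn0.
Qed.
End Def.

Lemma graded_sub k k' (f : 'I_k -> {poly C}) (f' : 'I_k' -> {poly C}) m p :
  (forall i, graded f 1 (f' i)) -> graded f' m p -> graded f m p.
Proof.
move=> ff; elim: m p => // m IH p [r [Hr ->]].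
apply: linpred_sum => [|i _]; first exact: linpred_graded.
by rewrite -[m.+1]add1n; apply: gradedM => //; apply: IH (Hr i).
Qed.

(** The nonzero rows of the matrix in [hilb_fun] are coefficient vectors of the monomials of degree
    [m], so its row space is the graded piece. *)
Lemma hilb_fun_basis n d (x : 'I_(npar n d) -> C) m :
  exists v : 'I_(hilb_fun x m) -> {poly C},
  [/\ forall i, graded (dehom x) m (v i), indep_mod (fun p => p = 0) v &
   forall p, graded (dehom x) m p -> span_mod (fun p => p = 0) v p].
Proof.
have sf i : (size (dehom x i) <= d.+1)%N.
  apply: leq_trans (size_sum _ _ _) _; apply/bigmax_leqP => j _.
  by apply: leq_trans (size_scale_leq _ _) _; rewrite size_polyXn ltnS leq_subr.
rewrite /hilb_fun; set W := (X in \rank X).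
have WP p : (size p <= (m * d).+1)%N -> graded (dehom x) m p <-> (poly_rV p <= W)%MS.
  move=> sp; split.
    move=> /graded_span[a ->]; rewrite linear_sum summx_sub //= => e Ee.
    rewrite linearZ /= scalemx_sub //; have -> : poly_rV (\prod_i dehom x i ^+ e i) = row (enum_rank e) W.
      by apply/rowP => j; rewrite !mxE enum_rankK Ee.
    exact: row_sub.
  move=> /submxP[u Eu]; have -> : p = \sum_r u 0 r *: rVpoly (row r W).
    rewrite -[p](poly_rV_K sp) Eu mulmx_sum_row linear_sum; apply: eq_bigr => r _.
    by rewrite linearZ.
  apply: linpred_sum => [|r _]; first exact: linpred_graded.
  apply: linpredZ; first exact: linpred_graded.
  pose e := enum_val r; case Ee : (\sum_(i < n.+1) (e i : nat) == m)%N.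
    apply/graded_span; exists (fun e' => (e' == e)%:R); rewrite (bigD1 e) //= eqxx scale1r.
    rewrite [X in _ = _ + X]big1 ?addr0; last by move=> e' /andP[_ /negPf ->]; rewrite scale0r.
    have -> : row r W = poly_rV (\prod_i dehom x i ^+ e i).
      by apply/rowP => j; rewrite !mxE -/e Ee.
    rewrite poly_rV_K //; apply: (size_graded sf); apply/graded_span.
    exists (fun e' => (e' == e)%:R); rewrite (bigD1 e) //= eqxx scale1r [X in _ + X]big1 ?addr0 //.
    by move=> e' /andP[_ /negPf ->]; rewrite scale0r.
  have -> : row r W = 0 by apply/rowP => j; rewrite !mxE -/e Ee.
  by rewrite linear0; case: (linpred_graded (dehom x) m).
exists (fun i => rVpoly (row i (row_base W))); split.
- move=> i; apply/WP; first by rewrite size_poly.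
  by rewrite rVpolyK (submx_trans (row_sub _ _)) // eq_row_base.
- move=> a Ha i; have : (\row_i a i) *m row_base W = 0.
    rewrite mulmx_sum_row; apply: (can_inj (@rVpolyK _ _)); rewrite linear0 linear_sum -[RHS]Ha.
    by apply: eq_bigr => j _; rewrite linearZ /= mxE.
  rewrite -[RHS](mul0mx _ (row_base W)) => /(row_free_inj (row_base_free W)).
  by move/rowP/(_ i); rewrite !mxE.
move=> p Ap; have sp := size_graded sf Ap.
have := proj1 (WP p sp) Ap; rewrite -(eq_row_base W) => /submxP[u Eu].
exists (fun i => u 0 i); apply/eqP; rewrite subr_eq0; apply/eqP.
rewrite -[p](poly_rV_K sp) Eu mulmx_sum_row linear_sum; apply: eq_bigr => r _.
by rewrite linearZ.
Qed.
End GradedRing.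

(** * Binary forms and conductors *)

Section Forms.
Variable C : closedFieldType.
Implicit Types p q r : {poly C}.

(* A polynomial of size at most [k.+1] stands for a binary form of degree [k],
   whose value at infinity is the coefficient of index [k]. *)
Definition coprime_form k l p q := coprimep p q && ((size p == k.+1) || (size q == l.+1)).

Lemma coprime_formC k l p q : coprime_form k l p q = coprime_form l k q p.
Proof. by rewrite /coprime_form coprimep_sym orbC. Qed.

(** By symmetry [q] may be assumed of full degree [l]. Reducing the Bezout coefficient of [p] modulo
    [q] makes it small, and comparing sizes bounds the other coefficient. *)
Lemma bezout_form k l p q M r : (size p <= k.+1)%N -> (size q <= l.+1)%N ->
  coprime_form k l p q -> (k + l <= M.+1)%N -> (size r <= M.+1)%N ->
  exists a b, [/\ r = a * p + b * q, (size a <= M.+1 - k)%N & (size b <= M.+1 - l)%N].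
Proof.
wlog sq : k l p q / size q = l.+1 => [H|].
  move=> sp sq /[dup] cpq /andP[_ /orP[/eqP Es|/eqP Es]] klM sr; last exact: H.
  have [||a [b [Er sa sb]]] := H l k q p Es sq sp _ _ sr; rewrite 1?coprime_formC 1?addnC //.
  by exists b, a; split=> //; rewrite addrC.
move=> sp _ /andP[/Bezout_eq1_coprimepP[[u v] /= Euv] _] klM sr.
have q0 : q != 0 by rewrite -size_poly_eq0 sq.
pose a := (r * u) %% q; pose b := (r * u) %/ q * p + r * v.
have Er : r = a * p + b * q.
  rewrite /b mulrDl -mulrA [p * q]mulrC mulrA addrA -mulrDl [a + _]addrC -divp_eq.
  by rewrite -!mulrA -mulrDr Euv mulr1.
have sa : (size a <= l)%N by have := ltn_modp (r * u) q; rewrite q0 sq.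
exists a, b; split=> //; first by apply: leq_trans sa _; lia.
have [->|b0] := eqVneq b 0; first by rewrite size_poly0.
have : (size (b * q)%R <= M.+1)%N.
  have -> : b * q = r - a * p by rewrite {1}Er addrAC subrr add0r.
  rewrite (leq_trans (size_polyD _ _)) // size_polyN geq_max sr /=.
  by rewrite (leq_trans (size_polyMleq _ _)) //; move: sa sp klM; set A := size a; set B := size p; lia.
by rewrite size_mul // sq; set B := size b; lia.
Qed.

Lemma coprimep_no_root p q : p != 0 -> (forall x, root p x -> ~~ root q x) -> coprimep p q.
Proof.
move=> p0 H; rewrite coprimep_def; apply/negPn/negP => /closed_rootP[x].
by rewrite root_gcd => /andP[/H /negP].
Qed.

(** A combination with coefficients on the moment curve: it is as generic as needed, by
    [moment_notin], yet depends on one parameter only. *)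
Definition moment k (f : 'I_k -> {poly C}) (s : C) := \sum_(i < k) s ^+ i *: f i.

Lemma moment_notin k (f : 'I_k -> {poly C}) (U : {poly C} -> Prop) : linpred U ->
  (exists i, ~ U (f i)) -> cofinite (fun s => ~ U (moment f s)).
Proof.
move=> UU [i0 Ui0]; apply: NNPP => ncof.
have step (l : seq C) : exists s, s \notin l /\ U (moment f s).
  apply: NNPP => H; apply: ncof; exists l => s sl Us; apply: H.
  by exists s.
have /(_ k)[us [uus sus Hus]] m : exists us : seq C,
    [/\ uniq us, size us = m & forall s, s \in us -> U (moment f s)].
  elim: m => [|m [us [uus sus Hus]]]; first by exists [::].
  have [s [sl Us]] := step us; exists (s :: us); split; rewrite /= ?sl ?sus //.
  by move=> s'; rewrite inE => /predU1P[->|/Hus].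
pose V := \matrix_(a < k, j < k) (nth 0 us a) ^+ j.
have uV : V \in unitmx.
  rewrite -unitmx_tr -row_free_unit -kermx_eq0; apply/eqP/row_matrixP => i.
  set w := row i _; have : (w <= kermx V^T)%MS by apply: row_sub.
  rewrite row0 => /sub_kermxP wV; apply: (can_inj (@rVpolyK _ _)); rewrite linear0.
  apply/eqP/negPn/negP => w0.
  have := max_poly_roots w0 (rs := us); rewrite uus sus => /(_ _ isT).
  rewrite ltnNge size_poly => H; suff : false by []; apply: H; apply/allP => s sus'.
  have lts : (index s us < k)%N by rewrite -sus index_mem.
  have := congr1 (fun M : 'rV[C]_k => M 0 (Ordinal lts)) wV; rewrite !mxE => E0.
  rewrite /root horner_poly -[X in _ == X]E0; apply/eqP/eq_bigr => j _.
  by rewrite !mxE /= nth_index // valK ?mxE.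
apply: Ui0; have -> : f i0 = \sum_(a < k) (invmx V) i0 a *: moment f (nth 0 us a).
  rewrite (eq_bigr (fun a => \sum_j ((invmx V) i0 a * V a j) *: f j)); last first.
    by move=> a _; rewrite scaler_sumr; apply: eq_bigr => j _; rewrite scalerA mxE.
  rewrite exchange_big (bigD1 i0) //= -scaler_suml [X in _ + X]big1 ?addr0 => [|j /negPf ji].
    have -> : \sum_i invmx V i0 i * V i i0 = (invmx V *m V) i0 i0 by rewrite mxE.
    by rewrite mulVmx // mxE eqxx scale1r.
  rewrite -scaler_suml; have -> : \sum_i invmx V i0 i * V i j = (invmx V *m V) i0 j by rewrite mxE.
  by rewrite mulVmx // mxE eq_sym ji scale0r.
apply: linpred_sum => // a _; apply: linpredZ => //; apply: Hus.
by rewrite mem_nth // sus.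
Qed.

Lemma linpred_horner0 (b : C) : linpred (fun p : {poly C} => p.[b] = 0).
Proof. by split=> [|a p q p0 q0]; rewrite ?horner0 // hornerD hornerZ p0 q0 mulr0 addr0. Qed.

Lemma linpred_coef0 i : linpred (fun p : {poly C} => p`_i = 0).
Proof. by split=> [|a p q p0 q0]; rewrite ?coef0 // coefD coefZ p0 q0 mulr0 addr0. Qed.

Lemma linpred_size i : linpred (fun p : {poly C} => (size p <= i)%N).
Proof.
split=> [|a p q sp sq]; first by rewrite size_poly0.
by rewrite (leq_trans (size_polyD _ _)) // geq_max (leq_trans (size_scale_leq _ _)).
Qed.

Lemma size_moment k (f : 'I_k -> {poly C}) l s :
  (forall i, size (f i) <= l)%N -> (size (moment f s) <= l)%N.
Proof.
move=> sf; apply: leq_trans (size_sum _ _ _) _; apply/bigmax_leqP => i _.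
by rewrite (leq_trans (size_scale_leq _ _)).
Qed.

Definition base_point_free k (f : 'I_k -> {poly C}) l :=
  (forall b, exists i, (f i).[b] != 0) /\ exists i, (f i)`_l != 0.

Lemma moment_coprime k (f : 'I_k -> {poly C}) l p e : base_point_free f l ->
  (forall i, size (f i) <= l.+1)%N -> p != 0 ->
  cofinite (fun s => size (moment f s) = l.+1 /\ coprime_form e l p (moment f s)).
Proof.
move=> [bf [j fj]] sf p0; have [rs Ep] := closed_field_poly_normal p.
have c1 : cofinite (fun s => forall b, b \in rs -> (moment f s).[b] <> 0).
  apply: cofinite_all => b _; apply: (moment_notin (linpred_horner0 b)).
  by have [i /eqP] := bf b; exists i.
have c2 : cofinite (fun s => (moment f s)`_l <> 0).
  by apply: (moment_notin (linpred_coef0 l)); exists j; apply/eqP.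
apply: cofinite_imp (cofinite_and c1 c2) => s [H1 /eqP H2].
have ss : size (moment f s) = l.+1.
  apply/eqP; rewrite eqn_leq size_moment // ltnNge; apply/negP => sm.
  by move: H2; rewrite nth_default ?eqxx.
split=> //; rewrite /coprime_form ss eqxx orbT andbT.
apply: coprimep_no_root => // x; rewrite {1}Ep rootZ ?lead_coef_eq0 // root_prod_XsubC.
by move/H1/eqP; rewrite rootE.
Qed.

Lemma graded1_moment k (f : 'I_k -> {poly C}) s : graded f 1 (moment f s).
Proof. exact: graded_comb. Qed.

Lemma bpf_neq0 k (f : 'I_k -> {poly C}) l : base_point_free f l -> exists i, f i != 0.
Proof. by move=> [_ [i fi]]; exists i; apply: contraNneq fi => ->; rewrite coef0. Qed.

(** Bezout applied to a nonzero [f i] and a generic combination writes every form of degree m + d as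
    a sum of multiples of the [f j], as soon as d <= m + 1. *)
Lemma bpf_generate k (f : 'I_k -> {poly C}) d m (P : {poly C} -> Prop) c r :
  base_point_free f d -> (forall i, size (f i) <= d.+1)%N ->
  (d <= m.+1)%N -> (size r <= (m + d).+1)%N -> linpred P ->
  (forall i r', (size r' <= m.+1)%N -> P (c * (f i * r'))) -> P (c * r).
Proof.
move=> bf sf dm sr PP H; have [i fi] := bpf_neq0 bf.
have [s [ss cs]] := cofinite_ex (moment_coprime d bf sf fi).
have [||||a [b [-> sa sb]]] := @bezout_form d d _ _ (m + d) r _ _ cs; rewrite ?ss //; first by lia.
rewrite mulrDr; apply: linpredD => //; first by rewrite [a * _]mulrC; apply: H; rewrite (leq_trans sa) //; lia.
rewrite [b * _]mulrC /moment mulr_suml mulr_sumr; apply: linpred_sum => // j _.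
rewrite -scalerAl -scalerAr; apply: linpredZ => //; apply: H; rewrite (leq_trans sb) //; lia.
Qed.

(** [c] stands for a form of degree [e], which may vanish at infinity, so [e] is kept apart from the
    size of [c]. Only the degree [m] is tested; [conductorS] carries the property upwards. *)
Definition conductor k (f : 'I_k -> {poly C}) d e c m :=
  forall r, (size r <= (m * d).+1 - e)%N -> graded f m (c * r).

Lemma conductorS k (f : 'I_k -> {poly C}) d e c m : (0 < d)%N -> base_point_free f d ->
  (forall i, size (f i) <= d.+1)%N -> (e + d <= (m * d).+1)%N ->
  conductor f d e c m -> conductor f d e c m.+1.
Proof.
move=> d0 bf sf em Hc r sr.
apply: (@bpf_generate _ f d (m * d - e) _ c r bf sf) (linpred_graded f m.+1) _; first by lia.
  by apply: leq_trans sr _; rewrite mulSn; lia.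
move=> i r' sr'; rewrite mulrCA -add1n; apply: gradedM; first exact: graded_gen.
by apply: Hc; apply: leq_trans sr' _; lia.
Qed.

Lemma conductor_leq k (f : 'I_k -> {poly C}) d e c m m' : (0 < d)%N -> base_point_free f d ->
  (forall i, size (f i) <= d.+1)%N -> (e + d <= (m * d).+1)%N ->
  conductor f d e c m -> (m <= m')%N -> conductor f d e c m'.
Proof.
move=> d0 bf sf em Hc /subnKC <-; elim: (m' - m)%N => [|j IH]; first by rewrite addn0.
by rewrite addnS; apply: conductorS => //; rewrite mulnDl; lia.
Qed.

Lemma graded_det k (f : 'I_k -> {poly C}) j (W : 'M[{poly C}]_j) :
  (forall a b, graded f 1 (W a b)) -> graded f j (\det W).
Proof.
move=> HW; apply: linpred_sum => [|s _]; first exact: linpred_graded.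
suff H : graded f j (\prod_i W i (s i)).
  case: (perm.odd_perm s); rewrite ?mul1r // mulN1r -scaleN1r.
  by apply: linpredZ => //; apply: linpred_graded.
rewrite [X in graded f X](_ : j = \sum_(a <- index_enum 'I_j) 1)%N; last by rewrite sum1_card card_ord.
elim: (index_enum _) => [|a l IH]; first by rewrite !big_nil; exists 1.
by rewrite !big_cons; apply: gradedM.
Qed.

Lemma graded_cofactor k (f : 'I_k -> {poly C}) j (W : 'M[{poly C}]_j.+1) a b :
  (forall a b, graded f 1 (W a b)) -> graded f j (cofactor W a b).
Proof.
move=> HW; have H : graded f j (\det (row' a (col' b W))).
  by apply: graded_det => a' b'; rewrite !mxE.
rewrite /cofactor -signr_odd; case: (odd _); rewrite ?mul1r // mulN1r -scaleN1r.
by apply: linpredZ => //; apply: linpred_graded.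
Qed.

(* The determinant trick: by Bezout, [u * 'X^i] is a multiple of [u ^+ 2] plus a
   combination of the [('X - g%:P) * z1 * 'X^j] and [('X - g%:P) * z2 * 'X^j]
   with [j <= d]. This is a linear system for the ['X^j] with entries in
   [graded f 1], and Cramer's rule gives the denominator [D]. *)
Lemma det_conductor k (f : 'I_k -> {poly C}) d g u z1 z2 : (0 < d)%N ->
  (forall i, size (f i) <= d.+1)%N ->
  graded f 1 u -> u.[g] != 0 ->
  graded f 1 (('X - g%:P) * z1) -> graded f 1 (('X - g%:P) * z2) ->
  (size z1 <= d)%N -> (size z2 <= d)%N -> coprime_form d.-1 d.-1 z1 z2 ->
  exists D, D != 0 /\ conductor f d (d.+1 * d) D d.+2.
Proof.
case: d => // d _ sf Au ug A1 A2 s1 s2 c12.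
have su : (size u <= d.+2)%N by have := size_graded sf Au; rewrite mul1n.
have red (i : 'I_d.+2) : exists kab : C * {poly C} * {poly C},
   [/\ u * 'X^i = kab.1.1 *: u ^+ 2 + (('X - g%:P) * z1) * kab.1.2 + (('X - g%:P) * z2) * kab.2,
     (size kab.1.2 <= d.+2)%N & (size kab.2 <= d.+2)%N].
  (* This multiple of [u ^+ 2] makes the difference vanish at [g]; Bezout is applied to its quotient
     by the linear factor. *)
  pose kk := (u * 'X^i).[g] / u.[g] ^+ 2.
  have : root (u * 'X^i - kk *: u ^+ 2) g.
    by rewrite rootE hornerD hornerN hornerZ horner_exp /kk divfK ?expf_neq0 // subrr.
  rewrite -dvdp_XsubCl dvdp_eq => /eqP; set q := _ %/ _ => Eq.
  have sq : (size q <= (2 * d).+2)%N.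
    rewrite /q size_divp ?polyXsubC_eq0 // size_XsubC leq_subLR add1n.
    rewrite (leq_trans (size_polyD _ _)) // size_polyN geq_max; apply/andP; split.
      rewrite (leq_trans (size_polyMleq _ _)) // size_polyXn.
      by have := ltn_ord i; move: su; set A := size u; lia.
    rewrite (leq_trans (size_scale_leq _ _)) // expr2 (leq_trans (size_polyMleq _ _)) //.
    by move: su; set A := size u; lia.
  have [||a [b [Eab sa sb]]] := @bezout_form d d _ _ (2 * d).+1 q s1 s2 c12; rewrite //; first by lia.
  exists (kk, a, b); split=> /=; last by rewrite (leq_trans sb) //; lia.
    rewrite -addrA -[LHS](subrK (kk *: u ^+ 2)) [LHS]addrC Eq Eab; congr (_ + _).
    by ring.
  by rewrite (leq_trans sa) //; lia.
have {red} [kab Hkab] := fin_all_exists red.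
pose W : 'M[{poly C}]_d.+2 := \matrix_(i, j) ((i == j)%:R *: u - (kab i).1.2`_j *: (('X - g%:P) * z1)
     - (kab i).2`_j *: (('X - g%:P) * z2)).
have AW i j : graded f 1 (W i j).
  rewrite mxE; do 2 (apply: linpredB; [exact: linpred_graded| |
     by apply: linpredZ => //; apply: linpred_graded]).
  by apply: linpredZ => //; apply: linpred_graded.
pose X1 : 'cV[{poly C}]_d.+2 := \col_j 'X^j.
have EW : W *m X1 = \col_i ((kab i).1.1 *: u ^+ 2).
  apply/colP => i; rewrite !mxE.
  have [E sa sb] := Hkab i.
  have exp p : (size p <= d.+2)%N -> \sum_(j < d.+2) p`_j *: 'X^j = p.
    by move=> sp; rewrite -poly_def; apply/polyP => j; rewrite coef_poly; case: ltnP => // jd;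
      rewrite nth_default // (leq_trans sp).
  set Z1 := ('X - g%:P) * z1 in E *; set Z2 := ('X - g%:P) * z2 in E *.
  rewrite (eq_bigr (fun j => (i == j)%:R *: (u * 'X^j) - Z1 * ((kab i).1.2`_j *: 'X^j)
     - Z2 * ((kab i).2`_j *: 'X^j))); last first.
    by move=> j _; rewrite !mxE -/Z1 -/Z2 -!mul_polyC; ring.
  rewrite !sumrB -!mulr_sumr !exp // (bigD1 i) //= eqxx scale1r big1 ?addr0; last first.
    by move=> j /negPf ij; rewrite eq_sym ij scale0r.
  by rewrite E; ring.
exists (\det W); split.
  (* At [g] both multiples of ['X - g%:P] vanish and [W] becomes the scalar matrix [u.[g]], so the
     determinant is not zero. *)
  apply/eqP => /(congr1 (horner_eval g)); rewrite rmorph0 -det_map_mx => /eqP.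
  have -> : map_mx (horner_eval g) W = u.[g]%:M.
    apply/matrixP => i j; rewrite !mxE /horner_eval !(hornerD, hornerN, hornerZ, hornerM, hornerX, hornerC).
    by rewrite subrr !mul0r !mulr0 !subr0 mulr_natl.
  by rewrite det_scalar expf_eq0 (negPf ug) andbF.
(* Cramer's rule: the right-hand side consists of multiples of [u ^+ 2], of degree 2, and a cofactor
   adds [d.+1]. *)
have DX (i : 'I_d.+2) : graded f d.+3 (\det W * 'X^i).
  have -> : \det W * 'X^i = (\adj W *m (W *m X1)) i 0.
    by rewrite mulmxA mul_adj_mx mul_scalar_mx !mxE.
  rewrite EW mxE; apply: linpred_sum => [|j _]; first exact: linpred_graded.
  rewrite !mxE -[d.+3]addn2; apply: gradedM; last first.
    by apply: linpredZ; [apply: linpred_graded | apply: graded_exp].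
  exact: graded_cofactor.
move=> r sr; have {}sr : (size r <= d.+2)%N by apply: leq_trans sr _; rewrite -[d.+3]add1n mulnDl; lia.
have -> : r = \sum_(j < d.+2) r`_j *: 'X^j.
  rewrite -poly_def; apply/polyP => j; rewrite coef_poly; case: ltnP => // jd.
  by rewrite nth_default // (leq_trans sr).
rewrite mulr_sumr; apply: linpred_sum => [|j _]; first exact: linpred_graded.
by rewrite -scalerAr; apply: linpredZ; [apply: linpred_graded|apply: DX].
Qed.

Lemma size_factor d (g : C) (z : {poly C}) : (size (('X - g%:P) * z)%R <= d.+1)%N -> (size z <= d)%N.
Proof.
have [->|z0] := eqVneq z 0; first by rewrite size_poly0.
by rewrite size_mul ?polyXsubC_eq0 // size_XsubC.
Qed.

(* The image curve is smooth at the image of [g], with no other preimage. *)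
Definition good k (f : 'I_k -> {poly C}) d g :=
  (forall b, exists p, graded f 1 (('X - g%:P) * p) /\ p.[b] != 0) /\
  exists p, graded f 1 (('X - g%:P) * p) /\ p`_d.-1 != 0.

(** Hyperplane sections through the image of [g], with the zero at [g] divided out: the system that
    projects the curve from that point. *)
Definition through k (f : 'I_k -> {poly C}) g u i := (u.[g] *: f i - (f i).[g] *: u) %/ ('X - g%:P).

Lemma throughE k (f : 'I_k -> {poly C}) g u i :
  ('X - g%:P) * through f g u i = u.[g] *: f i - (f i).[g] *: u.
Proof.
rewrite mulrC; apply/esym/eqP; rewrite -dvdp_eq dvdp_XsubCl rootE.
by rewrite hornerD hornerN !hornerZ mulrC subrr.
Qed.

(** A section through the image of [g] is a combination of these forms because the multiples of [u]
    cancel at [g]; a condition that fails on all of them would fail on the forms given by [good]. *)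
Lemma good_through k (f : 'I_k -> {poly C}) d g u : good f d g -> u.[g] != 0 ->
  base_point_free (through f g u) d.-1.
Proof.
move=> [gb gi] ug.
have key p (L : {poly C} -> Prop) : linpred L -> graded f 1 (('X - g%:P) * p) -> ~ L p ->
    exists i, ~ L (through f g u i).
  move=> LL /graded1P[a Ea] np; apply: NNPP => H; apply: np.
  have Lt i : L (through f g u i) by apply: NNPP => nL; apply: H; exists i.
  suff -> : p = u.[g]^-1 *: \sum_i a i *: through f g u i.
    by apply: linpredZ => //; apply: linpred_sum => // i _; apply: linpredZ.
  have X0 : 'X - g%:P != 0 :> {poly C} by rewrite polyXsubC_eq0.
  apply: (mulfI X0); rewrite -scalerAr mulr_sumr.
  rewrite (eq_bigr (fun i => u.[g] *: (a i *: f i) - (a i * (f i).[g]) *: u)); last first.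
    move=> i _; rewrite -scalerAr throughE scalerBr !scalerA mulrC; congr (_ - _).
  rewrite sumrB -scaler_sumr -scaler_suml -Ea.
  have -> : \sum_i a i * (f i).[g] = 0.
    have := congr1 (horner^~ g) Ea; rewrite /= hornerM !hornerE subrr mul0r horner_sum => {2}->.
    by apply: eq_bigr => i _; rewrite hornerZ.
  by rewrite scale0r subr0 scalerA mulVf ?scale1r.
split=> [b|].
  have [p [Ap pb]] := gb b; have [|i /eqP] := key p _ (linpred_horner0 b) Ap; first exact/eqP.
  by exists i.
have [p [Ap pb]] := gi; have [|i /eqP] := key p _ (linpred_coef0 d.-1) Ap; first exact/eqP.
by exists i.
Qed.

Lemma through_graded k (f : 'I_k -> {poly C}) g u i : graded f 1 u ->
  graded f 1 (('X - g%:P) * through f g u i).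
Proof.
move=> Au; rewrite throughE; apply: linpredB; first exact: linpred_graded.
  by apply: linpredZ; [apply: linpred_graded | apply: graded_gen].
by apply: linpredZ => //; apply: linpred_graded.
Qed.

Lemma through_moment k (f : 'I_k -> {poly C}) g u s :
  ('X - g%:P) * moment (through f g u) s = u.[g] *: moment f s - (moment f s).[g] *: u.
Proof.
rewrite /moment mulr_sumr horner_sum scaler_sumr scaler_suml -sumrB; apply: eq_bigr => i _.
by rewrite -scalerAr throughE scalerBr hornerZ !scalerA mulrC.
Qed.

(* Projection to a plane from a generic centre keeps [g] good. *)
Lemma plane_conductor k (f : 'I_k -> {poly C}) d g u w : (0 < d)%N ->
  (forall i, size (f i) <= d.+1)%N -> good f d g -> u.[g] != 0 ->
  graded f 1 u -> graded f 1 w -> (forall a, w <> a *: u) ->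
  cofinite (fun s => forall y : 'I_3 -> {poly C}, y ord0 = u -> y (inord 1) = w ->
    y (inord 2) = moment f s -> exists D, D != 0 /\ conductor y d (d.+1 * d) D d.+2).
Proof.
move=> d0 sf gd ug Au Aw uw.
pose z := (u.[g] *: w - w.[g] *: u) %/ ('X - g%:P).
have Ez : ('X - g%:P) * z = u.[g] *: w - w.[g] *: u.
  rewrite mulrC; apply/esym/eqP; rewrite -dvdp_eq dvdp_XsubCl rootE.
  by rewrite hornerD hornerN !hornerZ mulrC subrr.
have su : (size u <= d.+1)%N by have := size_graded sf Au; rewrite mul1n.
have sw : (size w <= d.+1)%N by have := size_graded sf Aw; rewrite mul1n.
have sz : (size z <= d)%N.
  apply: (@size_factor _ g); rewrite Ez.
  have := @linpredB _ _ _ (u.[g] *: w) (w.[g] *: u) (linpred_size d.+1); apply;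
  by rewrite (leq_trans (size_scale_leq _ _)).
have st i : (size (through f g u i) <= d)%N.
  apply: (@size_factor _ g); rewrite throughE.
  have := @linpredB _ _ _ (u.[g] *: f i) ((f i).[g] *: u) (linpred_size d.+1); apply;
  by rewrite (leq_trans (size_scale_leq _ _)).
have z0 : z != 0.
  apply/eqP => z0; apply: (uw (w.[g] / u.[g])).
  have /eqP := Ez; rewrite z0 mulr0 eq_sym subr_eq0 => /eqP E.
  by rewrite mulrC -scalerA -E scalerA mulVf ?scale1r.
have cf := moment_coprime d.-1 (good_through gd ug) _ z0.
apply: cofinite_imp (cf _) => [s [_ cs]|i]; last by rewrite prednK.
move=> y y0 y1 y2.
have L := linpred_graded y 1.
have Ay0 : graded y 1 u by rewrite -y0; apply: graded_gen.
have Ay1 : graded y 1 w by rewrite -y1; apply: graded_gen.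
have Ay2 : graded y 1 (moment f s) by rewrite -y2; apply: graded_gen.
apply: (@det_conductor _ y d g u z (moment (through f g u) s)) => //.
- move=> i; case: i => -[|[|[|//]]] lti.
  + by rewrite (_ : Ordinal _ = ord0) ?y0 //; apply/val_inj.
  + by rewrite (_ : Ordinal _ = inord 1) ?y1 //; apply/val_inj; rewrite /= inordK.
  + rewrite (_ : Ordinal _ = inord 2) ?y2 ?size_moment //; apply/val_inj; by rewrite /= inordK.
- by rewrite Ez; apply: linpredB => //; apply: linpredZ.
- by rewrite through_moment; apply: linpredB => //; apply: linpredZ.
- exact: size_moment.
Qed.

Lemma good_conductor k (f : 'I_k -> {poly C}) d g : (0 < d)%N ->
  (forall i, size (f i) <= d.+1)%N -> base_point_free f d -> good f d g ->
  exists D, D != 0 /\ conductor f d (d.+1 * d) D d.+2.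
Proof.
move=> d0 sf bf gd; have [i0 u0] := proj1 bf g; have Au := graded_gen f i0.
have bt := good_through gd u0; have [j tj] := bpf_neq0 bt.
have su : (size (f i0) <= d.+1)%N by [].
have st i : (size (through f g (f i0) i) <= d)%N.
  apply: (@size_factor _ g); rewrite throughE.
  have := @linpredB _ _ _ ((f i0).[g] *: f i) ((f i).[g] *: f i0) (linpred_size d.+1); apply;
  by rewrite (leq_trans (size_scale_leq _ _)).
have cf := moment_coprime d.-1 bt _ tj.
have [|s [_ cs]] := cofinite_ex (cf _); first by move=> i; rewrite prednK.
have L := linpred_graded f 1.
apply: (@det_conductor _ f d g (f i0) (through f g (f i0) j) (moment (through f g (f i0)) s)) => //.
- exact: through_graded.
- rewrite through_moment; apply: linpredB => //; apply: linpredZ => //; exact: graded1_moment.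
- exact: size_moment.
Qed.
End Forms.

(** * The minimal conductor *)

Section Quotients.
Variables (F : fieldType) (E : lmodType F).
Implicit Types (U V : E -> Prop).

Definition basis_mod U V k (v : 'I_k -> E) :=
  [/\ forall i, V (v i), indep_mod U v & forall p, V p -> span_mod U v p].

Lemma basis_quot U V l (u : 'I_l -> E) k (v : 'I_k -> E) : linpred U -> linpred V ->
  (forall p, U p -> V p) ->
  basis_mod (fun p => p = 0) U u -> basis_mod (fun p => p = 0) V v ->
  exists j (w : 'I_j -> E), (j + l = k)%N /\ basis_mod U V w.
Proof.
move=> UU VV UV [Uu iu su] [Vv iv sv].
have cat j (w : 'I_j -> E) : (forall i, V (w i)) -> indep_mod U w -> (j + l <= k)%N.
  move=> Vw iw.
  apply: (@indep_le_span _ _ (fun p => p = 0) _ _ v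
    (fun i => match split i with inl a => w a | inr b => u b end) (linpred_eq0 _)).
    move=> a; rewrite big_split_ord /=.
    rewrite (eq_bigr (fun i => a (lshift l i) *: w i)); last by move=> i _; rewrite (unsplitK (inl i)).
    rewrite [X in _ + X](eq_bigr (fun i => a (rshift j i) *: u i)); last by move=> i _; rewrite (unsplitK (inr i)).
    move=> E0; have aw : forall i, a (lshift l i) = 0.
      apply: iw; have -> : \sum_i a (lshift l i) *: w i = - \sum_i a (rshift j i) *: u i.
        by apply/eqP; rewrite -addr_eq0 E0.
      rewrite -scaleN1r; apply: linpredZ => //; apply: linpred_sum => // i _; exact: linpredZ.
    move: E0; rewrite big1 ?add0r => [/iu au i|i _]; last by rewrite aw scale0r.
    by case: (split_ordP i) => i' ->.
  by move=> i; apply: sv; case: (split i) => // b; apply: UV.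
have [|j [w [Vw iw sw]]] := @max_indep _ _ U V k UU.
  by move=> j w Vw iw; have := cat j w Vw iw; lia.
exists j, w; split; last by split.
apply/eqP; rewrite eqn_leq (cat j w) //=.
apply: (@indep_le_span _ _ (fun p => p = 0) _ _
    (fun i => match split i with inl a => w a | inr b => u b end) v (linpred_eq0 _) iv) => i.
have [a /su[b /eqP]] := sw _ (Vv i); rewrite subr_eq0 => /eqP E0.
exists (fun i => match split i with inl i' => a i' | inr i' => b i' end).
rewrite big_split_ord /=.
rewrite (eq_bigr (fun i => a i *: w i)); last by move=> i' _; rewrite (unsplitK (inl i')).
rewrite [X in _ - (_ + X)](eq_bigr (fun i => b i *: u i)); last by move=> i' _; rewrite (unsplitK (inr i')).
by rewrite opprD addrA E0 subrr.
Qed.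
End Quotients.

(** * Divisibility and common divisors of binary forms *)

Section DivisibleForms.
Variable C : closedFieldType.
Implicit Types p q r c h : {poly C}.

(* The size bound makes this divisibility of forms, infinity included. *)
Definition fdvd c e N p := exists r, p = c * r /\ (size r <= N.+1 - e)%N.

Lemma linpred_fdvd c e N : linpred (fdvd c e N).
Proof.
split; first by exists 0; rewrite mulr0 size_poly0.
move=> a p q [r [-> sr]] [s [-> ss]]; exists (a *: r + s); split.
  by rewrite mulrDr scalerAr.
by have [_] := linpred_size C (N.+1 - e); apply.
Qed.

Lemma fdvdM c e N k p q : fdvd c e N p -> (size q <= k.+1)%N -> fdvd c e (N + k) (p * q).
Proof.
move=> [r [-> sr]] sq; exists (r * q); split; first by rewrite mulrA.
have [->|r0] := eqVneq r 0; first by rewrite mul0r size_poly0.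
have sr0 : (0 < size r)%N by rewrite size_poly_gt0.
apply: leq_trans (size_polyMleq _ _) _; move: sr sr0 sq; set A := size r; set B := size q; lia.
Qed.

Lemma fdvd_cancel c e N h d p : c != 0 -> (size c <= e.+1)%N -> (size h <= d.+1)%N ->
  coprime_form e d c h -> (size p <= N.+1)%N -> fdvd c e (N + d) (h * p) -> fdvd c e N p.
Proof.
move=> c0 sc sh /andP[ch inf] sp [r [Er sr]].
have [p0|p0] := eqVneq p 0; first by exists 0; rewrite mulr0 size_poly0.
have : c %| p by rewrite -(Gauss_dvdpr _ ch) Er dvdp_mulr.
move=> /dvdpP[q Eq]; exists q; split; first by rewrite mulrC.
have q0 : q != 0 by apply: contraNneq p0 => q0; rewrite Eq q0 mul0r.
have sq : (0 < size q)%N by rewrite size_poly_gt0.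
have scp : (0 < size c)%N by rewrite size_poly_gt0.
have Erq : r = h * q by apply: (mulfI c0); rewrite -Er Eq; ring.
case/orP: inf => /eqP Es.
  by move: sp; rewrite Eq size_mul // Es; move: sq; set A := size q; lia.
have h0 : h != 0 by rewrite -size_poly_eq0 Es.
by move: sr; rewrite Erq size_mul // Es; move: sq; set A := size q; lia.
Qed.

Lemma fdvd_cancel_exp c e N h d p j : c != 0 -> (size c <= e.+1)%N -> (size h <= d.+1)%N ->
  coprime_form e d c h -> (size p <= N.+1)%N -> fdvd c e (N + j * d) (h ^+ j * p) -> fdvd c e N p.
Proof.
move=> c0 sc sh ch; elim: j N p => [|j IH] N p sp; first by rewrite mul0n addn0 mul1r.
rewrite exprSr -mulrA mulSn addnA => /IH H; apply: (fdvd_cancel c0 sc sh ch sp); apply: H.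
apply: leq_trans (size_polyMleq _ _) _; move: sp sh; set A := size p; set B := size h; lia.
Qed.

(** The gap between the nominal degree and the actual one is the order of vanishing at infinity. The
    smaller of the two gaps is a common zero and is given to the common divisor, of degree [i]; one
    cofactor then has full degree. *)
Lemma gcd_degrees (a b c k l : nat) : (0 < a)%N -> (0 < b)%N -> (0 < c)%N ->
  ((a + b).-1 <= k.+1)%N -> ((a + c).-1 <= l.+1)%N ->
  exists i, [/\ (i <= k)%N /\ (i <= l)%N, (a <= i.+1)%N, (b <= (k - i).+1)%N, (c <= (l - i).+1)%N &
    (b == (k - i).+1) || (c == (l - i).+1)].
Proof.
case: a b c => [|a] [|b] [|c] // _ _ _; rewrite !addSn !addnS /= !ltnS => ak al.
have [le|/ltnW le] := leqP (k - (a + b)) (l - (a + c)).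
  by exists (a + (k - (a + b)))%N; split; [split| | | |apply/orP; left; apply/eqP]; lia.
by exists (a + (l - (a + c)))%N; split; [split| | | |apply/orP; right; apply/eqP]; lia.
Qed.

Lemma form_gcd p k q l : p != 0 -> q != 0 -> (size p <= k.+1)%N -> (size q <= l.+1)%N ->
  exists G i p1 q1, [/\ [/\ p = G * p1, q = G * q1 & (i <= k)%N /\ (i <= l)%N],
    (size G <= i.+1)%N,
    (size p1 <= (k - i).+1)%N, (size q1 <= (l - i).+1)%N & coprime_form (k - i) (l - i) p1 q1].
Proof.
move=> p0 q0 sp sq; pose G := gcdp p q.
have G0 : G != 0 by rewrite gcdp_eq0 negb_and p0.
have Ep : p = G * (p %/ G) by rewrite mulrC divpK // dvdp_gcdl.
have Eq : q = G * (q %/ G) by rewrite mulrC divpK // dvdp_gcdr.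
have p10 : p %/ G != 0 by apply: contraNneq p0 => E; rewrite Ep E mulr0.
have q10 : q %/ G != 0 by apply: contraNneq q0 => E; rewrite Eq E mulr0.
have Sp : size p = (size G + size (p %/ G)).-1 by rewrite {1}Ep size_mul.
have Sq : size q = (size G + size (q %/ G)).-1 by rewrite {1}Eq size_mul.
have cop : coprimep (p %/ G) (q %/ G) by apply: coprimep_div_gcd; rewrite p0.
have gG : (0 < size G)%N by rewrite size_poly_gt0.
have gp : (0 < size (p %/ G)%R)%N by rewrite size_poly_gt0.
have gq : (0 < size (q %/ G)%R)%N by rewrite size_poly_gt0.
rewrite Sp in sp; rewrite Sq in sq.
have [i [ikl sG sp1 sq1 e]] := gcd_degrees gG gp gq sp sq.
by exists G, i, (p %/ G), (q %/ G); split=> //; rewrite /coprime_form cop.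
Qed.

Lemma form_gcd_dvd c e p N : c != 0 -> (size c <= e.+1)%N -> (size p <= N.+1)%N -> p != 0 ->
  exists G i c1 p1, [/\ [/\ c = G * c1, p = G * p1 & (i <= e)%N /\ (i <= N)%N],
    (size G <= i.+1)%N, (size c1 <= (e - i).+1)%N, (size p1 <= (N - i).+1)%N &
    coprime_form (e - i) (N - i) c1 p1] /\ (i = e -> fdvd c e N p).
Proof.
move=> c0 sc sp p0; have [G [i [c1 [p1 H]]]] := form_gcd c0 p0 sc sp.
exists G, i, c1, p1; split=> // ie; case: H => [[Ec Ep [ik il]] sG sc1 sp1 _].
have : (size c1 <= 1)%N by rewrite ie subnn in sc1.
move=> /size1_polyC Ec1; have c10 : c1`_0 != 0.
  by apply: contraNneq c0 => E; rewrite Ec Ec1 E mulr0.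
exists ((c1`_0)^-1 *: p1); split.
  set a := c1`_0 in Ec1 c10 *; rewrite Ep Ec Ec1 -mul_polyC.
  have -> : G * a%:P * ((a^-1)%:P * p1) = (a * a^-1)%:P * (G * p1) by rewrite polyCM; ring.
  by rewrite mulfV // mul1r.
by apply: leq_trans (size_scale_leq _ _) _; apply: leq_trans sp1 _; rewrite ie; move: il; lia.
Qed.
End DivisibleForms.

Section MinimalConductor.
Variables (C : closedFieldType) (k d : nat) (f : 'I_k -> {poly C}).
Hypotheses (d0 : (0 < d)%N) (sf : forall i, (size (f i) <= d.+1)%N).
Hypothesis bf : base_point_free f d.
Implicit Types p q r c h : {poly C}.

Definition conductor_deg e := exists c m,
  [/\ c != 0, (size c <= e.+1)%N, (e + d <= (m * d).+1)%N & conductor f d e c m].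

Definition min_conductor e c :=
  [/\ c != 0, (size c <= e.+1)%N, (exists m, (e + d <= (m * d).+1)%N /\ conductor f d e c m) &
   forall e', conductor_deg e' -> (e <= e')%N].

Lemma ex_min_conductor : (exists e, conductor_deg e) -> exists e c, min_conductor e c.
Proof.
move=> /ex_min_nat[e [[c [m [c0 sc em Hc]]] He]]; exists e, c; split=> //.
by exists m.
Qed.

Lemma min_conductor_large e c : min_conductor e c ->
  exists m1, forall m, (m1 <= m)%N -> (e + d <= (m * d).+1)%N /\ conductor f d e c m.
Proof.
move=> [c0 sc [m [em Hc]] _]; exists m => m' mm'; split; last exact: conductor_leq Hc mm'.
by apply: leq_trans em _; rewrite ltnS leq_mul2r mm' orbT.
Qed.

(** By Bezout the common divisor of two conductors is a conductor in large degree; minimality of [e]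
    forces it to have the full degree of [c]. *)
Lemma min_conductor_dvd e c (P : {poly C}) e' m : min_conductor e c -> P != 0 -> (size P <= e'.+1)%N ->
  (e' + d <= (m * d).+1)%N -> conductor f d e' P m -> c %| P.
Proof.
move=> mc P0 sP em HP; have [c0 sc _ min] := mc.
have [G [i [c1 [P1 [[[Ec EP [ie ie']] sG sc1 sP1 cop] Hi]]]]] := form_gcd_dvd c0 sc sP P0.
have [m1 Hm1] := min_conductor_large mc.
suff : conductor_deg i.
  move=> /min ei; have [|r [-> _]] := Hi; first by apply/eqP; rewrite eqn_leq ie.
  exact: dvdp_mulr.
pose M := (m1 + m + e + e' + 1)%N.
have HcM : conductor f d e c M by apply: (proj2 (Hm1 M _)); rewrite /M; lia.
have HPM : conductor f d e' P M by apply: conductor_leq HP _ => //; rewrite /M; lia.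
have MM : (e + e' + d <= M * d)%N by rewrite /M; nia.
exists G, M; split=> //; first by apply: contraNneq c0 => E; rewrite Ec E mul0r.
  by lia.
move=> r sr.
have [||a [b [-> sa sb]]] := @bezout_form C _ _ c1 P1 (M * d - i) r sc1 sP1 cop; first by lia.
  by apply: leq_trans sr _; lia.
rewrite mulrDr; apply: linpredD; first exact: linpred_graded.
  rewrite [a * _]mulrC mulrA -Ec; apply: HcM; apply: leq_trans sa _; lia.
rewrite [b * _]mulrC mulrA -EP; apply: HPM; apply: leq_trans sb _; lia.
Qed.

Lemma basis_forms N : basis_mod (fun p => p = 0) (fun p => size p <= N)%N
  (fun i : 'I_N => 'X^i : {poly C}).
Proof.
split=> [i|a E i|p sp]; first by rewrite size_polyXn.
  have := congr1 (fun p : {poly C} => p`_i) E.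
  rewrite coef0 coef_sum (bigD1 i) //= coefZ coefXn eqxx mulr1 big1 ?addr0 // => j ji.
  by rewrite coefZ coefXn eq_sym (inj_eq val_inj) (negPf ji) mulr0.
exists (fun i => p`_i); apply/eqP; rewrite subr_eq0; apply/eqP; rewrite -poly_def.
by apply/polyP => j; rewrite coef_poly; case: ltnP => // jN; rewrite nth_default // (leq_trans sp).
Qed.

Lemma basis_fdvd c e N : c != 0 -> basis_mod (fun p => p = 0) (fdvd c e N)
  (fun i : 'I_(N.+1 - e) => c * 'X^i).
Proof.
move=> c0; have [_ iX sX] := basis_forms (N.+1 - e); split=> [i|a E|p [r [-> sr]]].
- by exists 'X^i; rewrite size_polyXn.
- apply: iX; apply: (mulfI c0); rewrite mulr0 -[RHS]E mulr_sumr; apply: eq_bigr => i _.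
  by rewrite scalerAr.
have [a /eqP] := sX r sr; rewrite subr_eq0 => /eqP Er; exists a.
rewrite {1}Er mulr_sumr; apply/eqP; rewrite subr_eq0; apply/eqP; apply: eq_bigr => i _.
by rewrite scalerAr.
Qed.

Lemma fdvd_graded c e m p : conductor f d e c m -> fdvd c e (m * d) p -> graded f m p.
Proof. by move=> Hc [r [-> sr]]; apply: Hc. Qed.

Variables (hh : nat -> nat) (g : nat).
Hypothesis hb : forall m, exists v : 'I_(hh m) -> {poly C}, basis_mod (fun p => p = 0) (graded f m) v.
Hypothesis hg : exists a : int, exists m0 : nat, forall m, (m0 <= m)%N ->
  (hh m)%:Z = a * m%:Z + 1 - g%:Z.

(** In large degree [m] the multiples of [c] lie in the graded ring, which lies in all forms; the
    dimensions are md + 1 - e, [hh m] and md + 1. Once [a = d] is known, the two codimensions are e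
    - g and g. *)
Lemma conductor_dims e c : min_conductor e c -> exists b m1, e = (b + g)%N /\
  forall m, (m1 <= m)%N -> [/\ (e + d <= (m * d).+1)%N, conductor f d e c m,
    exists v : 'I_b -> {poly C}, basis_mod (fdvd c e (m * d)) (graded f m) v &
    exists w : 'I_g -> {poly C},
      basis_mod (graded f m) (fun p => size p <= (m * d).+1)%N w].
Proof.
move=> mc; have [c0 _ _ _] := mc; have [m1 Hm1] := min_conductor_large mc.
have [a [m0 Ha]] := hg.
have dims m : (m1 + m0 <= m)%N -> exists b' g' : nat,
  [/\ (b' + ((m * d).+1 - e) = hh m)%N, (g' + hh m = (m * d).+1)%N,
    exists v : 'I_b' -> {poly C}, basis_mod (fdvd c e (m * d)) (graded f m) v &
    exists w : 'I_g' -> {poly C},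
      basis_mod (graded f m) (fun p => size p <= (m * d).+1)%N w].
  move=> mm; have [em Hc] := Hm1 m (leq_trans (leq_addr _ _) mm).
  have [v bv] := hb m.
  have [b' [v' [Eb bv']]] := basis_quot (linpred_fdvd c e (m * d)) (linpred_graded f m)
    (fun p => fdvd_graded Hc) (basis_fdvd _ _ c0) bv.
  have [g' [w' [Eg bw']]] := basis_quot (linpred_graded f m) (linpred_size C (m * d).+1)
    (fun p => size_graded sf) bv (basis_forms _).
  by exists b', g'; split=> //; [exists v'|exists w'].
(* The codimensions equal (a - d)M + e - g and (d - a)M + g. For one [M] beyond [e] and [g],
   nonnegativity of both leaves only [a = d]. *)
have ad : a = d%:Z.
  pose M := (m1 + m0 + e + g + 1)%N.
  have [|b' [g' [E1 E2 _ _]]] := dims M; first by rewrite /M; lia.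
  have [em _] := Hm1 M (ltac:(rewrite /M; lia)).
  have E3 := Ha M (ltac:(rewrite /M; lia)).
  have gM : (g < M)%N by rewrite /M; lia.
  have eM : (e < M)%N by rewrite /M; lia.
  clear -E1 E2 E3 gM eM em.
  have Eq1 : b'%:Z = (a - d%:Z) * M%:Z + (e%:Z - g%:Z) by nia.
  have Eq2 : g'%:Z = (d%:Z - a) * M%:Z + g%:Z by nia.
  by nia.
have eg : (g <= e)%N.
  have [|b' [g' [E1 E2 _ _]]] := dims (m1 + m0)%N; first by lia.
  have [em _] := Hm1 _ (leq_addr m0 m1); have E3 := Ha _ (leq_addl m1 m0).
  by move: E3; rewrite ad; nia.
exists (e - g)%N, (m1 + m0)%N; split; first by rewrite subnK.
move=> m mm; have [em Hc] := Hm1 m (leq_trans (leq_addr _ _) mm).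
have [b' [g' [E1 E2 [v bv] [w bw]]]] := dims m mm.
have E3 := Ha m (leq_trans (leq_addl _ _) mm); rewrite ad in E3.
have Eb : b' = (e - g)%N by clear -E1 E2 E3 em eg; nia.
have Eg : g' = g by clear -E1 E2 E3 em eg; nia.
by split=> //; [rewrite -Eb; exists v|rewrite -Eg; exists w].
Qed.
End MinimalConductor.

(** * Duality between the graded ring and its conductor *)

Section Duality.
Variables (C : closedFieldType).
Implicit Types p q r c : {poly C}.

(** Functionals killing [V] factor through the cokernel [K]. Along the moment curve a functional on
    the cokernel becomes a polynomial in [s] for each [r], nonzero because [r] is outside [V], so a
    generic [s] serves finitely many [r]. *)
Lemma separating_functional (V : {poly C} -> Prop) h (v : 'I_h -> {poly C}) M (rs : seq {poly C}) :
  linpred V -> (forall p, V p -> size p <= M)%N -> basis_mod (fun p => p = 0) V v ->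
  (forall r, r \in rs -> (size r <= M)%N /\ ~ V r) ->
  exists L : {poly C} -> C, [/\ forall a p q, L (a *: p + q) = a * L p + L q,
    forall p, V p -> L p = 0 & forall r, r \in rs -> L r != 0].
Proof.
move=> LV sV [Vv _ sv] Hrs.
pose W := \matrix_(i < h) (poly_rV (v i) : 'rV_M).
pose K := cokermx W.
have VK p : V p -> poly_rV p *m K = 0.
  move=> /sv[a /eqP]; rewrite subr_eq0 => /eqP ->; rewrite linear_sum mulmx_suml big1 // => i _.
  rewrite linearZ /= -scalemxAl; have -> : poly_rV (v i) = row i W by rewrite rowK.
  by rewrite -row_mul mulmx_coker row0 scaler0.
have KV r : (size r <= M)%N -> poly_rV r *m K = 0 -> V r.
  move=> sr /eqP; rewrite -submxE => /submxP[u Eu].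
  rewrite -(poly_rV_K sr) Eu mulmx_sum_row linear_sum; apply: linpred_sum => // i _.
  rewrite linearZ /= rowK; apply: linpredZ => //; rewrite poly_rV_K //; exact: sV.
have [s Hs] : exists s : C, forall r, r \in rs -> (poly_rV r *m K *m (\col_j s ^+ j)) 0 0 != 0.
  apply: cofinite_ex; apply: cofinite_all => r /Hrs[sr nVr].
  have p0 : rVpoly (poly_rV r *m K) != 0.
    apply/eqP => E; apply: nVr; apply: KV => //; apply: (can_inj (@rVpolyK _ _)).
    by rewrite E linear0.
  apply: cofinite_imp (cofinite_poly p0) => s; congr (_ != _); rewrite horner_poly mxE.
  by apply: eq_bigr => j _; rewrite !mxE valK !mxE.
exists (fun p => (poly_rV p *m K *m (\col_j s ^+ j)) 0 0); split=> //.
  by move=> a p q; rewrite linearP /= !mulmxDl -!scalemxAl mxE [X in X + _]mxE.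
by move=> p /VK ->; rewrite mul0mx mxE.
Qed.

Variables (k d : nat) (f : 'I_k -> {poly C}).
Hypotheses (d0 : (0 < d)%N) (sf : forall i, (size (f i) <= d.+1)%N).
Hypothesis bf : base_point_free f d.

(* The trace form defined by a functional killing the graded ring but none of
   the forms [c / l], [l] a linear factor of the conductor [c], is nondegenerate
   modulo [c]; hence the graded ring, modulo [c], has dimension at most [g]. *)
Lemma conductor_duality e c b g m : min_conductor d f e c ->
  (e + d <= (m * d).+1)%N -> conductor f d e c m -> conductor f d e c (2 * m) ->
  (exists h (u : 'I_h -> {poly C}), basis_mod (fun p => p = 0) (graded f (2 * m)) u) ->
  (exists v : 'I_b -> {poly C}, basis_mod (fdvd c e (m * d)) (graded f m) v) ->
  (exists w : 'I_g -> {poly C}, basis_mod (graded f m) (fun p => size p <= (m * d).+1)%N w) ->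
  (b <= g)%N.
Proof.
move=> mc em Hc1 Hc2 [h [u bu]] [v [Av iv sv]] [w [_ _ sw]].
have [c0 sc _ min] := mc.
pose N := (m * d)%N; have EN : (2 * m * d = 2 * N)%N by rewrite /N mulnA.
have eN : (e <= N)%N by rewrite /N; lia.
have [roots Ec] := closed_field_poly_normal c.
have key c' e' : c' != 0 -> (size c' <= e'.+1)%N -> (e' < e)%N ->
    exists t : {poly C}, (size t <= (2 * N).+1 - e')%N /\ ~ graded f (2 * m) (c' * t).
  move=> c'0 sc' ee; apply: NNPP => H; suff : (e <= e')%N by rewrite leqNgt ee.
  apply: min; exists c', (2 * m)%N; split=> //; first by rewrite EN; lia.
  move=> r sr; apply: NNPP => nA; apply: H; exists r; split=> //.
  by rewrite -EN.
(* For each root [rho] of [c], minimality of [e] gives a multiple of [c] divided by its factor at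
   [rho] that is outside the graded ring. *)
pose Q rho r := exists c' t : {poly C}, [/\ c = ('X - rho%:P) * c', r = c' * t, (size t <= (2 * N).+1 - e.-1)%N & ~ graded f (2 * m) r].
have [R HR] : exists R : C -> {poly C}, forall rho, root c rho -> Q rho (R rho).
  apply: (choose_on 0) => rho; rewrite -dvdp_XsubCl => /dvdpP[c' Ec'].
  have c'0 : c' != 0 by apply: contraNneq c0 => E; rewrite Ec' E mul0r.
  have Sc : size c = (size c').+1 by rewrite Ec' size_mul ?polyXsubC_eq0 // size_XsubC addn2.
  have gc' : (0 < size c')%N by rewrite size_poly_gt0.
  have [|||t [st nt]] := key c' e.-1 => //; first by move: sc gc'; rewrite Sc; set A := size c'; lia.
    by move: sc gc'; rewrite Sc; set A := size c'; lia.
  by exists (c' * t), c', t; split=> //; rewrite mulrC.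
(* The linear factor at infinity, present when [size c <= e]: dividing by it leaves the polynomial
   [c] and lowers its nominal degree to [e.-1]. *)
pose Qi r := exists t : {poly C}, [/\ r = c * t, (size t <= (2 * N).+1 - e.-1)%N & ~ graded f (2 * m) r].
have [ri Hri] : exists ri, (size c <= e)%N -> Qi ri.
  have [sce|nsce] := classic (size c <= e)%N; last by exists 0 => /nsce.
  have ce : (0 < size c)%N by rewrite size_poly_gt0.
  have [|||t [st nt]] := key c e.-1 => //; [by move: sce ce; set A := size c; lia|by move: sce ce; set A := size c; lia|].
  by exists (c * t) => _; exists t.
pose rs := [seq R rho | rho <- roots] ++ (if (size c <= e)%N then [:: ri] else [::]).
have rootsP rho : rho \in roots -> root c rho.
  by move=> H; rewrite Ec rootZ ?lead_coef_eq0 // root_prod_XsubC.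
have Hrs r : r \in rs -> (size r <= (2 * m * d).+1)%N /\ ~ graded f (2 * m) r.
  have gc : (0 < size c)%N by rewrite size_poly_gt0.
  rewrite mem_cat EN => /orP[/mapP[rho /rootsP /HR[c' [t [Ec' -> st nt]]] ->]|].
    split=> //; apply: leq_trans (size_polyMleq _ _) _.
    have c'0 : c' != 0 by apply: contraNneq c0 => E; rewrite Ec' E mulr0.
    move: sc gc st; rewrite {1 2}Ec' size_mul ?polyXsubC_eq0 // size_XsubC.
    set A := size c'; set B := size t; lia.
  case: ifP => // sce; rewrite inE => /eqP ->; have [t [-> st nt]] := Hri sce.
  split=> //; apply: leq_trans (size_polyMleq _ _) _.
  by move: sce gc st; set A := size c; set B := size t; lia.
have [L [Llin LV Lrs]] := separating_functional (linpred_graded f (2 * m))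
   (fun p => size_graded sf) bu Hrs.
have LL : linpred (fun p => L p = 0).
  have L0 : L 0 = 0 by have := LV 0 (proj1 (linpred_graded f (2 * m))).
  by split=> // a p q Lp Lq; rewrite Llin Lp Lq mulr0 addr0.
(* Let [G] be the common divisor of [c] and [p]. By Bezout [L] kills the multiples of [G]. If [G]
   had degree below [e], some linear factor of [c], finite or infinite, would divide the cofactor
   [c1], and [L] would kill the element chosen for that factor. *)
have nondeg p : (size p <= N.+1)%N -> (forall q : {poly C}, (size q <= N.+1)%N -> L (p * q) = 0) -> fdvd c e N p.
  move=> sp Lp; have [->|p0] := eqVneq p 0; first by case: (linpred_fdvd c e N).
  have [G [i [c1 [p1 [[[EcG Ep [ie iN]] sG sc1 sp1 cop] Hi]]]]] := form_gcd_dvd c0 sc sp p0.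
  have [/Hi //|ne] := classic (i = e).
  have {ie ne Hi} ie : (i < e)%N by lia.
  have G0 : G != 0 by apply: contraNneq c0 => E; rewrite EcG E mul0r.
  have LG (t : {poly C}) : (size t <= (2 * N - i).+1)%N -> L (G * t) = 0.
    move=> st; have [||a [b' [-> sa sb]]] := @bezout_form C _ _ c1 p1 (2 * N - i) t sc1 sp1 cop => //.
      by lia.
    rewrite mulrDr; apply: (linpredD LL).
      rewrite [a * _]mulrC mulrA -EcG; apply: LV; apply: Hc2; rewrite EN; apply: leq_trans sa _; lia.
    rewrite [b' * _]mulrC mulrA -Ep; apply: Lp; apply: leq_trans sb _; lia.
  exfalso; have c10 : c1 != 0 by apply: contraNneq c0 => E; rewrite EcG E mulr0.
  have [Es|/closed_rootP[rho rc1]] := eqVneq (size c1) 1%N.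
    have sce : (size c <= e)%N by rewrite EcG size_mul // Es addn1 /=; apply: leq_trans sG _.
    have [t [Er st _]] := Hri sce.
    have : L ri != 0 by apply: Lrs; rewrite mem_cat sce inE eqxx orbT.
    rewrite Er EcG -mulrA LG ?eqxx //; apply: leq_trans (size_polyMleq _ _) _.
    by rewrite Es; move: st; set A := size t; lia.
  have rc : root c rho by rewrite EcG rootM rc1 orbT.
  have [c' [t [Ec' Er st _]]] := HR rho rc.
  have : L (R rho) != 0.
    apply: Lrs; rewrite mem_cat map_f //.
    by move: rc; rewrite {1}Ec rootZ ?lead_coef_eq0 // root_prod_XsubC.
  move: rc1; rewrite -dvdp_XsubCl => /dvdpP[c2 Ec2].
  have X0 : 'X - rho%:P != 0 :> {poly C} by rewrite polyXsubC_eq0.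
  have Ec'2 : c' = G * c2 by apply: (mulfI X0); rewrite -Ec' EcG Ec2; ring.
  have c20 : c2 != 0 by apply: contraNneq c10 => E; rewrite Ec2 E mul0r.
  rewrite Er Ec'2 -mulrA LG ?eqxx //; apply: leq_trans (size_polyMleq _ _) _.
  move: sc1 st; rewrite Ec2 size_mul // size_XsubC; set A := size t; set B := size c2; lia.
(* If [g < b], some nontrivial combination of the [v i] pairs to zero with all [w j], and with the
   graded ring as well, hence with all forms; by [nondeg] it is a multiple of [c]. *)
rewrite leqNgt; apply/negP => gb.
pose Mx := \matrix_(i < b, j < g) L (v i * w j).
have : \rank (kermx Mx) != 0%N.
  by rewrite mxrank_ker -lt0n subn_gt0 (leq_ltn_trans (rank_leq_col _)).
rewrite mxrank_eq0 => /rowV0Pn[x /sub_kermxP xM /eqP x0]; apply: x0.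
apply/rowP => i; rewrite mxE; apply: (iv (fun i => x 0 i)); rewrite -/N.
have Ap : graded f m (\sum_i x 0 i *: v i).
  by apply: linpred_sum (linpred_graded f m) _ => j _; apply: linpredZ (linpred_graded f m) (Av j).
apply: nondeg; first exact: (size_graded sf Ap).
move=> q /sw sq.
apply: (@span_mod_min _ _ (graded f m) (fun q => L ((\sum_i x 0 i *: v i) * q) = 0) _ w _ _ _ _ sq).
- split=> [|a q1 q2 L1 L2]; first by rewrite mulr0; case: LL.
  by rewrite mulrDr -scalerAr Llin L1 L2 mulr0 addr0.
- by move=> q' Aq'; apply: LV; rewrite mul2n -addnn; apply: gradedM.
move=> j; have := congr1 (fun M : 'rV[C]_g => M 0 j) xM; rewrite !mxE => <-.
rewrite mulr_suml.
have Lsum (I : finType) (F : I -> {poly C}) : L (\sum_i F i) = \sum_i L (F i).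
  elim/big_rec2: _ => [|i' y1 y2 _ <-]; first by case: LL.
  by rewrite -[F i' in LHS]scale1r Llin mul1r.
rewrite Lsum; apply: eq_bigr => i' _; rewrite mxE -scalerAl -[LHS]/(L _) -[_ *: _]addr0 Llin.
by case: LL => -> _; rewrite addr0.
Qed.
End Duality.

(** * Counting parameters *)

Section FinKernels.
Variables (C : closedFieldType) (T : Type).
Implicit Types (A : T -> Prop) (Y : (T -> C) -> Prop).

Definition in_ker (U : finType) b (col : 'I_b -> T -> U -> C) t (v : U -> C) :=
  forall j, \sum_u v u * col j t u = 0.

Lemma sum_enum (U : finType) (F : U -> C) : \sum_u F u = \sum_(i < #|U|) F (enum_val i).
Proof. by rewrite (reindex (@enum_val U xpredT)) //=; apply/onW_bij/enum_val_bij. Qed.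

Let colmx (U : finType) b (col : 'I_b -> T -> U -> C) j t : 'cV[C]_#|U| :=
  \col_i col j t (enum_val i).

Let colmxE (U : finType) b (col : 'I_b -> T -> U -> C) j t (v : 'rV[C]_#|U|) :
  (v *m colmx col j t) 0 0 = \sum_u v 0 (enum_rank u) * col j t u.
Proof. by rewrite mxE [RHS]sum_enum; apply: eq_bigr => i _; rewrite mxE enum_valK. Qed.

Lemma ker_fin A Y l (U : finType) b (col : 'I_b -> T -> U -> C) :
  (forall j u, polyfun A Y l (fun t => col j t u)) ->
  exists l' (I : finType) (phi : I -> T -> U -> C),
  (forall k u, polyfun A Y l' (fun t => phi k t u)) /\
  forall t v, in_ker col t v -> exists z : I -> C, (forall u, v u = \sum_k z k * phi k t u) /\
      forall k, z k != 0 -> in_ker col t (phi k t).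
Proof.
move=> Pcol.
have [|l' [I [phi [Pphi Hphi]]]] := @ker_polyfun C T A Y l _ _ (colmx col).
  by move=> j i; apply: polyfun_ext (Pcol j (enum_val i)) _ => t _; rewrite mxE.
exists l', I, (fun k t u => phi k t 0 (enum_rank u)); split; first by move=> k u; apply: Pphi.
move=> t v Hv; have [|z [Ez Hz]] := Hphi t (\row_i v (enum_val i)).
  move=> j; apply/matrixP => i1 i2; rewrite !ord1 colmxE mxE -[RHS](Hv j).
  by apply: eq_bigr => u _; rewrite mxE enum_rankK.
exists z; split.
  move=> u; have := congr1 (fun M : 'rV[C]_#|U| => M 0 (enum_rank u)) Ez.
  by rewrite mxE enum_rankK => ->; rewrite summxE; apply: eq_bigr => k _; rewrite mxE.
move=> k zk j; have := congr1 (fun M : 'M[C]_1 => M 0 0) (Hz k zk j).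
by rewrite colmxE mxE.
Qed.

(** The bound on the kernel is supplied by [k] functionals without common nonzero kernel vector.
    They may depend on [t] in any way, since only the dimension is used. *)
Lemma growth_ker_fin A Y D l (U : finType) b (col : 'I_b -> T -> U -> C) k (v : T -> U -> C) :
  growth A Y D ->
  (forall j u, polyfun A Y l (fun t => col j t u)) ->
  (forall t, A t -> in_ker col t (v t)) ->
  (forall t, A t -> exists L : 'I_k -> U -> C, forall v, in_ker col t v ->
     (forall i, \sum_u v u * L i u = 0) -> forall u, v u = 0) ->
  growth A (fun y => Y y \/ exists u, y = fun t => v t u) (D + k).
Proof.
move=> gY Pcol Hv Hk.
have gk := @growth_ker C T A Y D l _ _ (colmx col) k (fun t => \row_i v t (enum_val i)) gY _ _ _.
apply: (growth_comp (k := 1)) (gk _ _ _) => {gk}.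
- move=> y [Yy|[u ->]]; first by apply: polyfun_gen; left.
  apply: (@polyfun_ext _ _ _ _ _ (fun t => (\row_i v t (enum_val i)) 0 (enum_rank u))) => [|t _].
    by apply: polyfun_gen; right; exists (enum_rank u).
  by rewrite mxE enum_rankK.
- by move=> j i; apply: polyfun_ext (Pcol j (enum_val i)) _ => t _; rewrite mxE.
- move=> t At j; apply/matrixP => i1 i2; rewrite !ord1 colmxE mxE -[RHS](Hv t At j).
  by apply: eq_bigr => u _; rewrite mxE enum_rankK.
move=> t At r Phi HPhi; have [L HL] := Hk t At.
pose B : 'M[C]_(#|U|, k) := \matrix_(i, j) L j (enum_val i).
have := mxrank_mul_ker Phi B; suff -> : (Phi :&: kermx B)%MS = 0.
  by rewrite mxrank0 addn0 => <-; apply: rank_leq_col.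
apply/eqP/rowV0P => u; rewrite sub_capmx => /andP[/submxP[w Ew] /sub_kermxP uB].
apply/rowP => i; rewrite mxE; have := HL (fun a => u 0 (enum_rank a)) _ _ (enum_val i).
rewrite enum_valK; apply=> [j|j].
  by rewrite -colmxE Ew -mulmxA HPhi mulmx0 mxE.
have := congr1 (fun M : 'rV[C]_k => M 0 j) uB; rewrite !mxE => E0; rewrite -[RHS]E0 sum_enum.
by apply: eq_bigr => a _; rewrite mxE enum_valK.
Qed.

Definition coefs_of (p : T -> {poly C}) (k : nat) (y : T -> C) := exists i : 'I_k, y = fun t => (p t)`_i.

Lemma growth_coefs A Y D p k : growth A Y D ->
  growth A (fun y => Y y \/ coefs_of p k y) (D + k).
Proof. by move=> /(growth_frees (fun (i : 'I_k) t => (p t)`_i)). Qed.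

Lemma polyfunp_coefs A Y (p : T -> {poly C}) k : (forall t, A t -> size (p t) <= k)%N ->
  (forall y, coefs_of p k y -> Y y) -> polyfunp A Y 1 p.
Proof.
move=> sp HY i; have [ik|ik] := ltnP i k.
  by apply: polyfun_gen; apply: HY; exists (Ordinal ik).
apply: polyfun_ext (polyfun_const A Y 0 1) _ => t At.
by rewrite nth_default // (leq_trans (sp t At)).
Qed.

Lemma polyfunp_sub A Y Y' m p : (forall y, Y y -> Y' y) -> polyfunp A Y m p -> polyfunp A Y' m p.
Proof. by move=> YY P i; apply: polyfun_sub (P i). Qed.

Lemma polyfunp_leq A Y m m' p : (m <= m')%N -> polyfunp A Y m p -> polyfunp A Y m' p.
Proof. by move=> mm P i; apply: polyfun_leq (P i). Qed.

Lemma polyfunp_add A Y m p q : polyfunp A Y m p -> polyfunp A Y m q ->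
  polyfunp A Y m (fun t => p t + q t).
Proof. by move=> P Q i; apply: polyfun_ext (polyfun_add (P i) (Q i)) _ => t _; rewrite coefD. Qed.

Lemma polyfunp_scale A Y m k a p : polyfun A Y k a -> polyfunp A Y m p ->
  polyfunp A Y (k + m) (fun t => a t *: p t).
Proof. by move=> P Q i; apply: polyfun_ext (polyfun_mul P (Q i)) _ => t _; rewrite coefZ. Qed.

Lemma polyfunp_opp A Y m p : polyfunp A Y m p -> polyfunp A Y m (fun t => - p t).
Proof. by move=> P i; apply: polyfun_ext (polyfun_opp (P i)) _ => t _; rewrite coefN. Qed.

Lemma polyfunp_const A Y m (p : {poly C}) : polyfunp A Y m (fun=> p).
Proof. by move=> i; apply: polyfun_const. Qed.

Lemma polyfunp_ext A Y m p q : polyfunp A Y m p -> (forall t, A t -> p t = q t) -> polyfunp A Y m q.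
Proof. by move=> P E i; apply: polyfun_ext (P i) _ => t /E ->. Qed.

Lemma polyfunp_sum A Y m (I : Type) (r : seq I) (P : pred I) (F : I -> T -> {poly C}) :
  (forall i, P i -> polyfunp A Y m (F i)) -> polyfunp A Y m (fun t => \sum_(i <- r | P i) F i t).
Proof.
move=> HF k; apply: polyfun_ext => [|t _]; last by rewrite coef_sum.
by apply: polyfun_sum => i Pi; apply: HF.
Qed.

Lemma polyfunp_prod A Y m (I : Type) (r : seq I) (F : I -> T -> {poly C}) :
  (forall i, polyfunp A Y m (F i)) -> polyfunp A Y (m * size r) (fun t => \prod_(i <- r) F i t).
Proof.
move=> HF; elim: r => [|i r IH].
  by apply: polyfunp_ext (polyfunp_const A Y _ 1) _ => t _; rewrite big_nil.
rewrite /= mulnS; apply: polyfunp_ext (polyfunp_mul (HF i) IH) _ => t _.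
by rewrite big_cons.
Qed.

Lemma polyfunp_exp A Y m p k : polyfunp A Y m p -> polyfunp A Y (m * k) (fun t => p t ^+ k).
Proof.
move=> P; elim: k => [|k IH].
  by apply: polyfunp_ext (polyfunp_const A Y _ 1) _ => t _; rewrite expr0.
by rewrite mulnS; apply: polyfunp_ext (polyfunp_mul P IH) _ => t _; rewrite exprS.
Qed.

Lemma polyfunp_XsubC A Y a : Y a -> polyfunp A Y 1 (fun t => 'X - (a t)%:P).
Proof.
move=> Ya; apply: polyfunp_add; first exact: polyfunp_const.
apply: polyfunp_opp; case=> [|i].
  by apply: polyfun_ext (polyfun_gen A 0 Ya) _ => t _; rewrite coefC.
by apply: polyfun_ext (polyfun_const A Y 0 1) _ => t _; rewrite coefC.
Qed.

Lemma growth_quots A Y D k (z num : 'I_k -> T -> C) den l : growth A Y D ->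
  (forall i, polyfun A Y l (num i)) -> polyfun A Y l den ->
  (forall i t, A t -> den t != 0 /\ den t * z i t = num i t) ->
  growth A (fun y => Y y \/ exists i, y = z i) D.
Proof.
elim: k z num => [|k IH] z num gY Pn Pd H.
  by apply: growth_sub gY => // y [//|[[]]].
have {}IH := IH (fun i => z (lift ord0 i)) (fun i => num (lift ord0 i)) gY
   (fun i => Pn _) Pd (fun i => H _).
apply: growth_sub (@growth_quot _ _ _ _ _ (z ord0) (num ord0) den l IH _ _ (H ord0)) => //.
- move=> y [|[i ->]]; first by left; left.
  case: (unliftP ord0 i) => [j|] ->; last by right.
  by left; right; exists j.
- by apply: polyfun_sub (Pn ord0) => // y; left.
- by apply: polyfun_sub Pd => // y; left.
Qed.

End FinKernels.

(** * Conductors of plane curves *)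

Section PlaneRoots.
Variables (C : closedFieldType) (T : Type) (d : nat).
Implicit Types (A : T -> Prop) (Y : (T -> C) -> Prop).

Lemma conductor_size k (f : 'I_k -> {poly C}) e (D : {poly C}) m : (forall i, size (f i) <= d.+1)%N ->
  (e <= m * d)%N -> D != 0 -> conductor f d e D m -> (size D <= e.+1)%N.
Proof.
move=> sf em D0 HD; have /(size_graded sf) : graded f m (D * 'X^(m * d - e)).
  by apply: HD; rewrite size_polyXn; lia.
by rewrite size_mul // -?size_poly_eq0 size_polyXn //; set B := size D; lia.
Qed.

Lemma coef_sum_poly N (v : 'I_N -> C) i k : ((\sum_(a < N) v a *: 'X^a) * 'X^i)`_k =
  \sum_(a < N) v a * (k == a + i)%N%:R.
Proof.
rewrite mulr_suml coef_sum; apply: eq_bigr => a _.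
by rewrite -scalerAl -exprD coefZ coefXn.
Qed.

(* The conductor of the plane curve [y] solves a linear system with
   coefficients polynomial in [y], so its roots are algebraic over [y]. *)
Lemma growth_plane_roots A Y D (y : T -> 'I_3 -> {poly C}) e0 (alpha : 'I_e0 -> T -> C) :
  (0 < d)%N -> growth A Y D ->
  (forall k, polyfunp A Y 1 (fun t => y t k)) -> (forall t k, A t -> size (y t k) <= d.+1)%N ->
  (forall t, A t -> exists D, D != 0 /\ conductor (y t) d (d.+1 * d) D d.+2) ->
  (forall t, A t -> forall P : {poly C}, P != 0 -> (size P <= (d.+1 * d).+1)%N ->
     conductor (y t) d (d.+1 * d) P d.+2 -> forall l, root P (alpha l t)) ->
  growth A (fun z => Y z \/ exists l, z = alpha l) D.
Proof.
move=> d0 gY Py sy HD Halpha.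
pose E := {ffun 'I_3 -> 'I_d.+3}.
pose mon t (e : E) : {poly C} := if (\sum_i (e i : nat) == d.+2)%N then \prod_i y t i ^+ e i else 0.
(* Unknowns: the coefficients of a candidate conductor and, for each i <= d, those of an expression
   of its product with ['X^i] by monomials of degree d + 2 in [y]. The equations, indexed by [J],
   compare coefficients. *)
pose U : finType := ('I_(d.+1 * d).+1 + 'I_d.+1 * E)%type.
pose J : finType := ('I_d.+1 * 'I_(d.+2 * d).+1)%type.
pose colJ (j : J) t (u : U) : C := match u with inl a => (j.2 == a + j.1 :> nat)%N%:R
  | inr (i, e) => if i == j.1 then - (mon t e)`_(j.2) else 0 end.
pose col (j : 'I_#|J|) := colJ (enum_val j).
pose PU (v : U -> C) : {poly C} := \sum_(a < (d.+1 * d).+1) v (inl a) *: 'X^a.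
have sPU v : (size (PU v) <= (d.+1 * d).+1)%N.
  apply: leq_trans (size_sum _ _ _) _; apply/bigmax_leqP => a _.
  by rewrite (leq_trans (size_scale_leq _ _)) // size_polyXn.
have Pmon e : polyfunp A Y (d.+3 * 3) (fun t => mon t e).
  rewrite /mon; case: (_ == _); last exact: polyfunp_const.
  have := @polyfunp_prod C T A Y d.+3 _ (index_enum 'I_3) (fun i t => y t i ^+ e i).
  rewrite -[index_enum _]enumT size_enum_ord; apply=> i.
  by apply: polyfunp_leq (polyfunp_exp (e i) (Py i)); rewrite mul1n ltnW.
have smon t e : A t -> (size (mon t e) <= (d.+2 * d).+1)%N.
  move=> At; rewrite /mon; case: ifP => Ee; last by rewrite size_poly0.
  apply: (@size_graded _ _ (y t)) => [i|]; first exact: sy.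
  apply/graded_span; exists (fun e' => (e' == e)%:R).
  rewrite (bigD1 e) //= eqxx scale1r [X in _ + X]big1 ?addr0 // => e' /andP[_ /negPf ->].
  by rewrite scale0r.
have kerP t v : A t -> in_ker col t v <-> forall i : 'I_d.+1, PU v * 'X^i = \sum_e v (inr (i, e)) *: mon t e.
  move=> At.
  have Esum (j : J) : \sum_u v u * colJ j t u =
     (PU v * 'X^(j.1))`_(j.2) - (\sum_e v (inr (j.1, e)) *: mon t e)`_(j.2).
    rewrite big_sumType /= coef_sum_poly; congr (_ + _).
    transitivity (\sum_i \sum_e v (inr (i, e)) * (if i == j.1 then - (mon t e)`_(j.2) else 0)).
      by rewrite pair_bigA; apply: eq_bigr => -[].
    rewrite (bigD1 j.1) //= eqxx [X in _ + X]big1 ?addr0; last first.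
      by move=> i /negPf ->; rewrite big1 // => e' _; rewrite mulr0.
    by rewrite coef_sum -sumrN; apply: eq_bigr => e' _; rewrite coefZ mulrN.
  split=> [H i|H j].
    apply/polyP => k; have [kd|kd] := ltnP k (d.+2 * d).+1.
      have := H (enum_rank ((i, Ordinal kd) : J)); rewrite /col enum_rankK Esum /= => /eqP.
      by rewrite subr_eq0 => /eqP.
    rewrite !nth_default //; last first.
      apply: leq_trans (size_polyMleq _ _) _; rewrite size_polyXn.
      move: (sPU v) (ltn_ord i) kd; set B := size (PU v); rewrite !mulSn; lia.
    apply: leq_trans (size_sum _ _ _) _; apply/bigmax_leqP => e' _.
    by rewrite (leq_trans (size_scale_leq _ _)) // (leq_trans (smon _ _ At)).
  by rewrite /col Esum H subrr.
have condP t v : A t -> in_ker col t v -> conductor (y t) d (d.+1 * d) (PU v) d.+2.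
  move=> At /(kerP t v At) H r sr.
  have {}sr : (size r <= d.+1)%N by apply: leq_trans sr _; rewrite !mulSn; lia.
  have -> : r = \sum_(j < d.+1) r`_j *: 'X^j.
    rewrite -poly_def; apply/polyP => j; rewrite coef_poly; case: ltnP => // jd.
    by rewrite nth_default // (leq_trans sr).
  have LG := linpred_graded (y t) d.+2.
  rewrite mulr_sumr; apply: linpred_sum => // j _; rewrite -scalerAr; apply: linpredZ => //.
  rewrite H; apply: linpred_sum => // e' _; apply: linpredZ => //; rewrite /mon.
  case: ifP => Ee; last by case: LG.
  apply/graded_span; exists (fun e1 => (e1 == e')%:R).
  rewrite (bigD1 e') //= eqxx scale1r [X in _ + X]big1 ?addr0 // => e1 /andP[_ /negPf ->].
  by rewrite scale0r.
have [|l' [I [phi [Pphi Hphi]]]] := @ker_fin C T A Y (d.+3 * 3) U _ col.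
  move=> j [a|[i e']] /=; first exact: polyfun_const.
  rewrite /col /=; case: eqP => _; last exact: polyfun_const.
  by apply: polyfun_opp; apply: Pmon.
(* The pieces record which spanning vector of the kernel has a nonzero polynomial part; one exists
   because an actual conductor is a combination of them. This part is a conductor, so it vanishes at
   every [alpha l t]. *)
apply: (@growth_union _ _ I _ (fun k t => in_ker col t (phi k t) /\ PU (phi k t) != 0)).
  move=> t At; have [DD [DD0 HDD]] := HD t At.
  have sDD : (size DD <= (d.+1 * d).+1)%N.
    by apply: (conductor_size (f := y t)) HDD => // [i|]; [apply: sy|rewrite leq_mul2r leqnSn orbT].
  have /fin_all_exists[a Ha] (i : 'I_d.+1) : exists a : E -> C,
     DD * 'X^i = \sum_e a e *: mon t e.
    have /graded_span[a Ea] : graded (y t) d.+2 (DD * 'X^i).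
      by apply: HDD; rewrite size_polyXn; have := ltn_ord i; rewrite !mulSn; lia.
    exists a; rewrite Ea big_mkcond; apply: eq_bigr => e' _; rewrite /mon.
    by case: ifP => // _; rewrite scaler0.
  pose v (u : U) : C := match u with inl b => DD`_b | inr (i, e) => a i e end.
  have Ev : PU v = DD.
    rewrite /PU /= -poly_def; apply/polyP => j; rewrite coef_poly; case: ltnP => // jd.
    by rewrite nth_default // (leq_trans sDD).
  have [|z [Ez Hz]] := Hphi t v; first by apply/kerP => // i; rewrite Ev Ha.
  apply: NNPP => H; case/eqP: DD0; rewrite -Ev /PU.
  apply: big1 => b _; rewrite Ez; apply/eqP; rewrite scaler_eq0; apply/orP; left; apply/eqP.
  apply: big1 => k _; have [->|zk] := eqVneq (z k) 0; first by rewrite mul0r.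
  have PU0 : PU (phi k t) = 0.
    by apply/eqP/negPn/negP => P0; apply: H; exists k; split=> //; apply: Hz.
  have := congr1 (fun p : {poly C} => (p * 'X^0)`_b) PU0; rewrite mul0r coef0 /PU coef_sum_poly => E0.
  rewrite (_ : phi k t (inl b) = 0) ?mulr0 // -[RHS]E0 (bigD1 b) //= addn0 eqxx mulr1.
  by rewrite big1 ?addr0 // => a' ab; rewrite addn0 eq_sym (inj_eq val_inj) (negPf ab) mulr0.
move=> k; set A' := fun t => A t /\ _.
apply: (@growth_roots _ _ A' Y D e0 alpha (fun _ t => PU (phi k t)) l' (d.+1 * d).+1).
- by apply: growth_sub gY => // t [].
- move=> _ i; have [id|id] := ltnP i (d.+1 * d).+1; last first.
    apply: polyfun_ext (polyfun_const _ _ 0 _) _ => t _.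
    by rewrite nth_default // (leq_trans (sPU _)).
  apply: (@polyfun_ext _ _ _ _ _ (fun t => phi k t (inl (Ordinal id)))) => [|t _].
    by apply: polyfun_sub (Pphi k (inl (Ordinal id))) => // t [].
  have := coef_sum_poly (fun a => phi k t (inl a)) 0 i; rewrite expr0 mulr1 => ->.
  rewrite (bigD1 (Ordinal id)) //= addn0 eqxx mulr1 big1 ?addr0 // => a' ab.
  have : a' != i :> nat by apply: contraNneq ab => E1; apply/eqP/val_inj.
  by rewrite addn0 eq_sym => /negPf ->; rewrite mulr0.
move=> l t [At [kt P0]]; split=> //; apply/rootP.
exact: (Halpha t At _ P0 (sPU _) (condP t _ At kt) l).
Qed.
End PlaneRoots.

(** * Curves counted through a plane projection *)

Section Planar.
Variables (C : closedFieldType) (T : Type) (d : nat).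
Implicit Types (A : T -> Prop) (Y : (T -> C) -> Prop).

Lemma coef_poly_sum N (v : 'I_N -> C) k : (\sum_(a < N) v a *: 'X^a)`_k =
  if insub k is Some a then v a else 0.
Proof.
have := coef_sum_poly v 0 k; rewrite expr0 mulr1 => ->.
case: insubP => [a kN Ek|nk].
  rewrite (bigD1 a) //= addn0 -Ek eqxx mulr1 big1 ?addr0 // => b ba.
  by rewrite addn0 eq_sym (inj_eq val_inj) (negPf ba) mulr0.
rewrite big1 // => b _; rewrite addn0; case: eqP => [E|_]; last by rewrite mulr0.
by move: nk; rewrite E ltn_ord.
Qed.

Lemma size_poly_sum N (v : 'I_N -> C) : (size (\sum_(a < N) v a *: 'X^a)%R <= N)%N.
Proof.
apply: leq_trans (size_sum _ _ _) _; apply/bigmax_leqP => a _.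
by rewrite (leq_trans (size_scale_leq _ _)) // size_polyXn.
Qed.

Lemma poly_sum_coef N (p : {poly C}) : (size p <= N)%N -> \sum_(a < N) p`_a *: 'X^a = p.
Proof.
move=> sp; rewrite -poly_def; apply/polyP => j; rewrite coef_poly; case: ltnP => // jd.
by rewrite nth_default // (leq_trans sp).
Qed.

(** The relation [h * p = \sum_i z i *: mu i + c * q] is linear in (p, z, q). Once z is fixed, p is
    determined up to multiples of [c], because [h] cancels modulo [c]; these multiples form a space
    of dimension d + 1 - e. *)
Lemma growth_mod_form A Y D l e e' b (p h c : T -> {poly C}) (mu : 'I_b -> T -> {poly C}) :
  growth A Y D -> polyfunp A Y l h -> polyfunp A Y l c -> (forall i, polyfunp A Y l (mu i)) ->
  (e' <= e)%N -> (e <= d.+1)%N ->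
  (forall t, A t -> [/\ c t \is monic, size (c t) = e'.+1, (size (p t) <= d.+1)%N,
      (size (h t) <= d.+1)%N & coprime_form e d (c t) (h t)]) ->
  (forall t, A t -> [/\ forall i, (size (mu i t) <= (d + d).+1)%N,
      indep_mod (fdvd (c t) e (d + d)) (fun i => mu i t) &
      span_mod (fdvd (c t) e (d + d)) (fun i => mu i t) (h t * p t)]) ->
  growth A (fun y => Y y \/ coefs_of p d.+1 y) (D + (b + (d.+1 - e))).
Proof.
move=> gY Ph Pc Pmu ee ed H1 H2.
have [zq Hzq] : exists zq : T -> ('I_b -> C) * {poly C}, forall t, A t ->
   h t * p t - \sum_i (zq t).1 i *: mu i t = c t * (zq t).2 /\ (size (zq t).2 <= (d + d).+1 - e)%N.
  apply: (@choose_on _ _ A (fun t (zq : ('I_b -> C) * {poly C}) =>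
     h t * p t - \sum_i zq.1 i *: mu i t = c t * zq.2 /\ (size zq.2 <= (d + d).+1 - e)%N) (fun=> 0, 0)).
  by move=> t At; have [_ _ [a [r [E sr]]]] := H2 t At; exists (a, r).
pose U : finType := ('I_d.+1 + ('I_b + 'I_((d + d).+1 - e)))%type.
pose col (j : 'I_(d + d).+1) t (u : U) : C := match u with inl a => ('X^a * h t)`_j
  | inr (inl i) => - (mu i t)`_j | inr (inr a) => - ('X^a * c t)`_j end.
pose v t (u : U) : C := match u with inl a => (p t)`_a | inr (inl i) => (zq t).1 i
  | inr (inr a) => (zq t).2`_a end.
pose PP (w : U -> C) : {poly C} := \sum_(a < d.+1) w (inl a) *: 'X^a.
pose QQ (w : U -> C) : {poly C} := \sum_(a < (d + d).+1 - e) w (inr (inr a)) *: 'X^a.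
have kerE t w j : \sum_u w u * col j t u =
    (PP w * h t - (\sum_i w (inr (inl i)) *: mu i t) - QQ w * c t)`_j.
  rewrite !big_sumType /= !coefB -addrA; congr (_ + _).
    by rewrite mulr_suml coef_sum; apply: eq_bigr => a _; rewrite -scalerAl coefZ.
  congr (_ + _).
    by rewrite coef_sum -sumrN; apply: eq_bigr => a _; rewrite coefZ mulrN.
  by rewrite mulr_suml coef_sum -sumrN; apply: eq_bigr => a _; rewrite -scalerAl coefZ mulrN.
have Eall t w : A t -> in_ker col t w ->
    PP w * h t - (\sum_i w (inr (inl i)) *: mu i t) - QQ w * c t = 0.
  move=> At kw; have [_ sc _ sh _] := H1 t At; have [smu _ _] := H2 t At.
  apply/polyP => j; rewrite coef0; have [jd|jd] := ltnP j (d + d).+1.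
    by have := kw (Ordinal jd); rewrite kerE.
  rewrite nth_default //; apply: leq_trans jd.
  have [_ LS] := linpred_size C (d + d).+1.
  apply: (@linpredB _ _ (fun p : {poly C} => size p <= (d + d).+1)%N) (linpred_size C _) _ _.
    apply: (@linpredB _ _ (fun p : {poly C} => size p <= (d + d).+1)%N) (linpred_size C _) _ _.
      apply: leq_trans (size_polyMleq _ _) _; have := size_poly_sum (fun a => w (inl a)).
      rewrite -/(PP w); move: sh; set B := size (h t); set B' := size (PP w); lia.
    apply: leq_trans (size_sum _ _ _) _; apply/bigmax_leqP => i _.
    by rewrite (leq_trans (size_scale_leq _ _)).
  apply: leq_trans (size_polyMleq _ _) _; have := size_poly_sum (fun a => w (inr (inr a))).
  by rewrite -/(QQ w) sc; set B' := size (QQ w); lia.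
have gk := @growth_ker_fin C T A Y D l U _ col (b + (d.+1 - e)) v gY _ _ _.
apply: growth_sub (gk _ _ _) => // {gk}.
- by move=> y [Yy|[i ->]]; [left|right; exists (inl i)].
- move=> j [a|[i|a]].
  + by have := polyfunp_mul (polyfunp_const A Y 0 'X^a) Ph; apply.
  + by apply: polyfun_opp; apply: Pmu.
  + by apply: polyfun_opp; have := polyfunp_mul (polyfunp_const A Y 0 'X^a) Pc; apply.
- move=> t At j; rewrite kerE; have [_ _ sp _ _] := H1 t At; have [E sq] := Hzq t At.
  by rewrite /PP /QQ /= !poly_sum_coef // [p t * _]mulrC E [(zq t).2 * _]mulrC subrr coef0.
move=> t At; have [mc sc sp sh ch] := H1 t At; have [smu imu _] := H2 t At.
(* When z vanishes, p is a multiple r of the monic [c] of degree [e'], and the leading coefficient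
   of r appears in p at an index [e' + a] with [a < d.+1 - e]. *)
exists (fun (i : 'I_(b + (d.+1 - e))) (u : U) => match split i with
   | inl l0 => (u == inr (inl l0))%:R | inr a => (u == inl (inord (e' + a)))%:R end).
move=> w kw Lw.
have pick u0 : \sum_u w u * (u == u0)%:R = w u0.
  by rewrite (bigD1 u0) //= eqxx mulr1 big1 ?addr0 // => u /negPf ->; rewrite mulr0.
have wz i : w (inr (inl i)) = 0.
  have := Lw (lshift _ i); under eq_bigr do rewrite (unsplitK (inl i)).
  by rewrite pick.
have wp (a : 'I_(d.+1 - e)) : w (inl (inord (e' + a))) = 0.
  have := Lw (rshift _ a); under eq_bigr do rewrite (unsplitK (inr a)).
  by rewrite pick.
have := Eall t w At kw; rewrite [X in _ - X - _]big1 ?subr0; last by move=> i _; rewrite wz scale0r.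
move/eqP; rewrite subr_eq0 => /eqP E.
have c0 : c t != 0 by rewrite monic_neq0.
have sP := size_poly_sum (fun a => w (inl a)).
have /(fdvd_cancel c0 _ sh ch sP) : fdvd (c t) e (d + d) (h t * PP w).
  exists (QQ w); split; first by rewrite mulrC E mulrC.
  exact: size_poly_sum.
rewrite sc => /(_ ee)[r []]; rewrite -/(PP w) => Er sr.
have r0 : r = 0.
  apply/eqP/negPn/negP => r0; have gr : (0 < size r)%N by rewrite size_poly_gt0.
  have lt : ((size r).-1 < d.+1 - e)%N by move: sr gr; set B := size r; lia.
  have := wp (Ordinal lt); set ii := inord _.
  have Eii : ii = (e' + (size r).-1)%N :> nat by rewrite /ii inordK //=; have := lt; set B := size r; lia.
  have <- : (PP w)`_ii = w (inl ii).
    by rewrite coef_poly_sum valK.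
  rewrite Er Eii; have -> : (e' + (size r).-1 = (size (c t * r)%R).-1)%N.
    by rewrite size_monicM // sc; move: gr; set B := size r; lia.
  rewrite -[_`_ _]/(lead_coef _) lead_coef_monicM // => /eqP.
  by rewrite lead_coef_eq0 (negPf r0).
have PP0 : PP w = 0 by rewrite Er r0 mulr0.
have QQ0 : QQ w = 0.
  by apply/eqP; move/esym/eqP: E; rewrite PP0 mul0r mulf_eq0 (negPf c0) orbF.
case=> [a|[i|a]] //.
  by have := congr1 (fun p : {poly C} => p`_a) PP0; rewrite coef_poly_sum valK coef0.
by have := congr1 (fun p : {poly C} => p`_a) QQ0; rewrite coef_poly_sum valK coef0.
Qed.

Definition triple (u w v : {poly C}) (k : 'I_3) : {poly C} := nth 0 [:: u; w; v] k.

(** Since [c] divides every conductor of the plane curve [y], its roots are algebraic over [y]; the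
    spanning condition bounds the cost of each coordinate. Here [e'] is the degree of the polynomial
    [c], and [e - e'] its order at infinity. *)
Definition planar_at n (f : 'I_n.+1 -> {poly C}) (s0 s2 : C) (w : {poly C}) e e' b
    (sel : 'I_b -> 'I_3 * 'I_3) : Prop :=
  let y := triple (moment f s0) w (moment f s2) in exists c : {poly C},
  [/\ [/\ c \is monic, size c = e'.+1 & coprime_form e d c (moment f s0)],
      (exists D, D != 0 /\ conductor y d (d.+1 * d) D d.+2),
      (forall P : {poly C}, P != 0 -> (size P <= (d.+1 * d).+1)%N ->
         conductor y d (d.+1 * d) P d.+2 -> c %| P),
      indep_mod (fdvd c e (d + d)) (fun i => y (sel i).1 * y (sel i).2) &
      forall k, span_mod (fdvd c e (d + d)) (fun i => y (sel i).1 * y (sel i).2) (moment f s0 * f k)].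

Lemma monic_roots (c : {poly C}) e : c \is monic -> size c = e.+1 ->
  exists rs : 'I_e -> C, c = \prod_(l < e) ('X - (rs l)%:P).
Proof.
move=> /monicP lc sc; have [rs] := closed_field_poly_normal c; rewrite lc scale1r => Ec.
have srs : size rs = e by have := sc; rewrite Ec size_prod_XsubC => -[].
exists (fun l => nth 0 rs l); rewrite Ec (big_nth 0) srs big_mkord.
by [].
Qed.

Lemma growth_polys A Y D c n (f : T -> 'I_n -> {poly C}) (ks : seq 'I_n) :
  growth A Y D ->
  (forall k Y' D', (forall y, Y y -> Y' y) -> growth A Y' D' ->
     growth A (fun y => Y' y \/ coefs_of (fun t => f t k) d.+1 y) (D' + c)) ->
  growth A (fun y => Y y \/ exists k, k \in ks /\ coefs_of (fun t => f t k) d.+1 y) (D + size ks * c).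
Proof.
move=> gY H; elim: ks => [|k ks IH].
  by rewrite addn0; apply: growth_sub gY => // y [//|[k []]].
rewrite /= mulSn addnCA addnC; apply: growth_sub (H k _ _ _ IH) => //; last by move=> y; left.
move=> y [Yy|[k' []]]; first by left; left.
by rewrite inE => /predU1P[->|k'ks] Hy; [right|left; right; exists k'].
Qed.

(** The three forms cost 3(d + 1) and the roots of [c] nothing. Coordinates other than i, p, q cost
    at most d + 1 - g each, as b + g <= e. Then f_i is recovered from [w] and f_j, and f_p, f_q from
    the two moments by Cramer's rule; the final 2 pays for [s0] and [s2]. *)
Lemma growth_planar A n (f : T -> 'I_n.+1 -> {poly C}) (s0 s2 : T -> C) (i j p q : 'I_n.+1)
    (kap : C) e e' b g (sel : 'I_b -> 'I_3 * 'I_3) :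
  (0 < d)%N -> uniq [:: i; j; p; q] -> (e' <= e)%N -> (e <= d.+1)%N -> (b + g <= e)%N ->
  (forall t, A t -> [/\ forall k, (size (f t k) <= d.+1)%N,
     s0 t ^+ p * s2 t ^+ q - s0 t ^+ q * s2 t ^+ p != 0 &
     planar_at (f t) (s0 t) (s2 t) (f t i + kap *: f t j) e e' sel]) ->
  growth A (fun y => (exists k, coefs_of (fun t => f t k) d.+1 y) \/ (y = s0 \/ y = s2))
    (3 * d.+1 + (n - 2) * (d.+1 - g) + 2).
Proof.
move=> d0 uijpq ee ed bg HA.
pose y0 t := moment (f t) (s0 t); pose y2 t := moment (f t) (s2 t).
pose w t := f t i + kap *: f t j.
pose y t := triple (y0 t) (w t) (y2 t).
have sy0 t : A t -> (size (y0 t) <= d.+1)%N by move=> /HA[sf _ _]; apply: size_moment.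
have sy2 t : A t -> (size (y2 t) <= d.+1)%N by move=> /HA[sf _ _]; apply: size_moment.
have sw t : A t -> (size (w t) <= d.+1)%N.
  move=> /HA[sf _ _]; rewrite /w (leq_trans (size_polyD _ _)) // geq_max sf.
  by rewrite (leq_trans (size_scale_leq _ _)).
have sy t k : A t -> (size (y t k) <= d.+1)%N.
  by move=> At; case: k => -[|[|[|//]]] lt; rewrite /y /triple /=; [apply: sy0|apply: sw|apply: sy2].
pose Y0 := fun z : T -> C => (((False \/ coefs_of y0 d.+1 z) \/ coefs_of w d.+1 z) \/ coefs_of y2 d.+1 z).
have gY0 : growth A Y0 (3 * d.+1).
  have := growth_coefs y2 d.+1 (growth_coefs w d.+1 (growth_coefs y0 d.+1 (growth_const C A))).
  by apply: growth_leq; lia.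
have Py0 : polyfunp A Y0 1 y0.
  by apply: (polyfunp_coefs (k := d.+1)) => // z Hz; left; left; right.
have Pw : polyfunp A Y0 1 w by apply: (polyfunp_coefs (k := d.+1)) => // z Hz; left; right.
have Py2 : polyfunp A Y0 1 y2 by apply: (polyfunp_coefs (k := d.+1)) => // z Hz; right.
have Py k : polyfunp A Y0 1 (fun t => y t k).
  by case: k => -[|[|[|//]]] lt; rewrite /y /triple.
have [c Hc] := choose_on 0 (fun t At => let: And3 _ _ h := HA t At in h).
have [al Hal] : exists al : T -> 'I_e' -> C, forall t, A t -> c t = \prod_(l < e') ('X - (al t l)%:P).
  apply: (@choose_on _ _ A (fun t al => c t = \prod_(l < e') ('X - (al l)%:P)) (fun=> 0)) => t At.
  by have [[mc sc _] _ _ _ _] := Hc t At; apply: monic_roots.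
pose Y1 := fun z => Y0 z \/ exists l, z = fun t => al t l.
have gY1 : growth A Y1 (3 * d.+1).
  apply: (@growth_plane_roots C T d A Y0 _ y e' (fun l t => al t l)) => //.
    by move=> t /Hc[].
  move=> t At P P0 sP HP l; have [_ _ H _ _] := Hc t At.
  have /dvdpP[r ->] := H P P0 sP HP; rewrite rootM; apply/orP; right.
  by rewrite Hal // (bigD1 l) //= rootM root_XsubC eqxx.
have Pc : polyfunp A Y1 e' c.
  apply: (@polyfunp_ext _ _ _ _ _ (fun t => \prod_(l < e') ('X - (al t l)%:P))) => [|t /Hal //].
  have := @polyfunp_prod C T A Y1 1 _ (index_enum 'I_e') (fun l t => 'X - (al t l)%:P).
  rewrite -[index_enum _]enumT size_enum_ord mul1n; apply=> l.
  by apply: polyfunp_XsubC; right; exists l.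
pose ks := [seq k <- enum 'I_n.+1 | k \notin [:: i; p; q]].
have sks : size ks = (n - 2)%N.
  move: uijpq; rewrite /= !inE !negb_or => /and4P[/and3P[_ ip iq] _ pq _].
  have u3 : uniq [:: i; p; q] by rewrite /= !inE negb_or ip iq pq.
  rewrite /ks size_filter -[LHS]/(count (predC (mem [:: i; p; q])) (enum 'I_n.+1)).
  have := count_predC (mem [:: i; p; q]) (enum 'I_n.+1); rewrite size_enum_ord.
  have -> : count (mem [:: i; p; q]) (enum 'I_n.+1) = 3.
    rewrite -size_filter; apply/eqP; rewrite eqn_leq; apply/andP; split.
      apply: (@uniq_leq_size _ _ [:: i; p; q]); first exact: filter_uniq (enum_uniq _).
      by move=> k; rewrite mem_filter => /andP[].
    by apply: (uniq_leq_size u3) => k ki; rewrite mem_filter mem_enum andbT.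
  by lia.
have gY2 : growth A (fun z => Y1 z \/ exists k, k \in ks /\ coefs_of (fun t => f t k) d.+1 z)
    (3 * d.+1 + (n - 2) * (d.+1 - g)).
  rewrite -sks; apply: growth_polys gY1 _ => k Y' D' YY' gY'.
  have PY' l m P : polyfunp A Y0 l P -> (l <= m)%N -> polyfunp A Y' m P.
    by move=> HP lm; apply: polyfunp_leq lm _; apply: polyfunp_sub HP => z Hz; apply: YY'; left.
  apply: (@growth_leq _ _ _ _ (D' + (b + (d.+1 - e)))); first by lia.
  apply: (@growth_mod_form A Y' D' (e' + 2)%N e e' b (fun t => f t k) y0 c
     (fun i t => y t (sel i).1 * y t (sel i).2)) => //.
  - by apply: (PY' 1%N) => //; lia.
  - by apply: polyfunp_leq (polyfunp_sub YY' Pc); lia.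
  - by move=> l; apply: (PY' (1 + 1)%N); [apply: polyfunp_mul|lia].
  - move=> t At; have [sf _ _] := HA t At; have [[mc sc cc] _ _ _ _] := Hc t At.
    by split=> //; apply: sy0.
  - move=> t At; have [_ _ _ ic sc] := Hc t At; split=> // l.
    apply: leq_trans (size_polyMleq _ _) _; have := sy t (sel l).1 At; have := sy t (sel l).2 At.
    by set B1 := size _; set B2 := size _; lia.
set Y2 := (X in growth A X _) in gY2.
have gY3 := growth_free s2 (growth_free s0 gY2).
set Y3 := (X in growth A X _) in gY3.
have Pk k : k \in ks -> polyfunp A Y3 1 (fun t => f t k).
  move=> kks; apply: (polyfunp_coefs (k := d.+1)) => [t At|z Hz]; first by have [] := HA t At.
  by left; left; right; exists k.
have ksP k : k != i -> k != p -> k != q -> k \in ks.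
  by move=> ki kp kq; rewrite mem_filter mem_enum !inE !negb_or ki kp kq.
move: (uijpq); rewrite /= !inE !negb_or => /and4P[/and3P[ij ip iq] /andP[jp jq] pq _].
have Pj : polyfunp A Y3 1 (fun t => f t j) by apply/Pk/ksP; rewrite // eq_sym.
have PY3 P : polyfunp A Y0 1 P -> polyfunp A Y3 1 P.
  by apply: polyfunp_sub => z Hz; left; left; left; left.
have Pi : polyfunp A Y3 1 (fun t => f t i).
  apply: (@polyfunp_ext _ _ _ _ _ (fun t => w t - kap *: f t j)); last by move=> t _; rewrite /w addrK.
  apply: polyfunp_add; first exact: PY3.
  by apply: polyfunp_opp; have := polyfunp_scale (polyfun_const A Y3 kap 0) Pj.
have Ps0 : polyfun A Y3 1 s0 by apply: polyfun_gen; left; right.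
have Ps2 : polyfun A Y3 1 s2 by apply: polyfun_gen; right.
have Pk' k : k != p -> k != q -> polyfunp A Y3 1 (fun t => f t k).
  by move=> kp kq; have [->//|ki] := eqVneq k i; apply/Pk/ksP.
pose R s t := moment (f t) (s t) - \sum_(k < n.+1 | (k != p) && (k != q)) s t ^+ k *: f t k.
have PR s : polyfun A Y3 1 s -> polyfunp A Y3 1 (fun t => moment (f t) (s t)) ->
    polyfunp A Y3 (n.+1 + 1) (R s).
  move=> Ps Pm; apply: polyfunp_add; first by apply: polyfunp_leq Pm; lia.
  apply: polyfunp_opp; apply: polyfunp_sum => k /andP[kp kq].
  apply: polyfunp_scale; last exact: Pk'.
  by apply: polyfun_leq (polyfun_exp k Ps); rewrite muln1 ltnW.
have RE s t : R s t = s t ^+ p *: f t p + s t ^+ q *: f t q.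
  rewrite /R /moment (bigD1 p) //= (bigD1 q) 1?eq_sym //= addrA addrK.
  by [].
have PR0 := PR s0 Ps0 (PY3 _ Py0); have PR2 := PR s2 Ps2 (PY3 _ Py2).
pose den t := s0 t ^+ p * s2 t ^+ q - s0 t ^+ q * s2 t ^+ p.
pose L := (n.+1 + n.+1 + 1)%N.
have Pexp (s : T -> C) (k : 'I_n.+1) : polyfun A Y3 1 s -> polyfun A Y3 n.+1 (fun t => s t ^+ k).
  by move=> Ps; apply: polyfun_leq (polyfun_exp k Ps); rewrite muln1 ltnW.
have Pden : polyfun A Y3 L den.
  apply: polyfun_leq (leq_addr _ _) _; apply: polyfun_add; last apply: polyfun_opp.
    by apply: polyfun_mul; apply: Pexp.
  by apply: polyfun_mul; apply: Pexp.
pose num (l : 'I_(d.+1 + d.+1)) t : C := match split l with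
  | inl a => s2 t ^+ q * (R s0 t)`_a - s0 t ^+ q * (R s2 t)`_a
  | inr a => s0 t ^+ p * (R s2 t)`_a - s2 t ^+ p * (R s0 t)`_a end.
pose z (l : 'I_(d.+1 + d.+1)) t : C := match split l with
  | inl a => (f t p)`_a | inr a => (f t q)`_a end.
have gY4 := @growth_quots C T A Y3 _ _ z num den L gY3 _ Pden _.
apply: (growth_comp (k := 1)) (growth_leq _ (gY4 _ _)); last 1 first.
- move=> l t At; have [_ nz _] := HA t At; split=> //; rewrite /num /z /den.
  by case: (split l) => a; rewrite !RE !coefD !coefZ; ring.
- move=> x [[k [l ->]]|[->|->]]; last 2 first.
  + by apply: polyfun_gen; left; left; right.
  + by apply: polyfun_gen; left; right.
  have [Ek|kp] := eqVneq k p.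
    apply: polyfun_gen; right; exists (lshift _ l); rewrite /z Ek.
    by have := unsplitK (inl l : 'I_d.+1 + 'I_d.+1) => /= ->.
  have [Ek|kq] := eqVneq k q.
    apply: polyfun_gen; right; exists (rshift _ l); rewrite /z Ek.
    by have := unsplitK (inr l : 'I_d.+1 + 'I_d.+1) => /= ->.
  by apply: polyfun_sub (Pk' k kp kq l) => // z' Hz'; left.
- by lia.
move=> l; rewrite /num /L -addnA; case: (split l) => a.
  apply: polyfun_add; last apply: polyfun_opp; apply: polyfun_mul; rewrite ?PR0 ?PR2 //; exact: Pexp.
apply: polyfun_add; last apply: polyfun_opp; apply: polyfun_mul; rewrite ?PR0 ?PR2 //; exact: Pexp.
Qed.
End Planar.

(** * Curves with three coordinates congruent to multiples of [h] *)

Section Quadruple.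
Variables (C : closedFieldType) (T : Type) (d : nat).
Implicit Types (A : T -> Prop) (Y : (T -> C) -> Prop).

Lemma growth_span A Y D l e b (p c : T -> {poly C}) (mu : 'I_b -> T -> {poly C}) :
  growth A Y D -> polyfunp A Y l c -> (forall i, polyfunp A Y l (mu i)) ->
  (forall t, A t -> span_mod (fdvd (c t) e d) (fun i => mu i t) (p t)) ->
  growth A (fun y => Y y \/ coefs_of p d.+1 y) (D + (b + (d.+1 - e))).
Proof.
move=> gY Pc Pmu H.
have [zq Hzq] : exists zq : T -> ('I_b -> C) * {poly C}, forall t, A t ->
   p t - \sum_i (zq t).1 i *: mu i t = c t * (zq t).2 /\ (size (zq t).2 <= d.+1 - e)%N.
  apply: (@choose_on _ _ A (fun t (zq : ('I_b -> C) * {poly C}) =>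
     p t - \sum_i zq.1 i *: mu i t = c t * zq.2 /\ (size zq.2 <= d.+1 - e)%N) (fun=> 0, 0)).
  by move=> t At; have [a [r [E sr]]] := H t At; exists (a, r).
have gz := growth_coefs (fun t => (zq t).2) (d.+1 - e)
   (growth_frees (fun (i : 'I_b) t => (zq t).1 i) gY).
rewrite addnA; apply: (growth_comp (k := (1 + l).+1)) gz => y [Yy|[j ->]].
  by apply: polyfun_gen; left; left.
apply: polyfun_leq (leqnSn _) _; move: (j : nat) => {}j; set Y' := (X in polyfun A X).
have PY' P m : polyfunp A Y m P -> polyfunp A Y' m P.
  by apply: polyfunp_sub => z Hz; left; left.
suff HP : polyfunp A Y' (1 + l) p by exact: HP.
apply: (@polyfunp_ext _ _ _ _ _ (fun t => \sum_i (zq t).1 i *: mu i t + (zq t).2 * c t)) => [|t At]; last first.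
  by have [E _] := Hzq t At; rewrite [_ * c t]mulrC -E addrC subrK.
apply: polyfunp_add.
  apply: polyfunp_sum => i _; apply: polyfunp_scale; last exact: PY'.
  by apply: polyfun_gen; left; right; exists i.
apply: polyfunp_mul; last exact: PY'.
apply: (polyfunp_coefs (k := (d.+1 - e)%N)) => [t At|z Hz]; last by right.
by have [_] := Hzq t At.
Qed.

(** The product over all [al l] is the polynomial s, of degree [sg'], and [sg] is its degree as a
    form. The conductor, of form degree 8, is the product over the roots selected by [phi], so it is
    determined by the roots of s. *)
Definition quad_at n (f : 'I_n.+1 -> {poly C}) (h : {poly C}) (ii : 'I_3 -> 'I_n.+1) sg sg' e'
    (phi : 'I_e' -> 'I_sg') : Prop :=
  exists (al : 'I_sg' -> C) (lam : 'I_3 -> C) (q : 'I_3 -> {poly C}),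
  [/\ forall a, f (ii a) = lam a *: h + (\prod_l ('X - (al l)%:P)) * q a,
      forall a, (size (q a) <= d.+1 - sg)%N &
      forall k, span_mod (fdvd (\prod_l ('X - (al (phi l))%:P)) 8 d)
        (fun b : 'I_4 => if unlift ord0 b is Some a then f (ii a) else h) (f k)].

(** The terms count [h], the roots of s, the three scalars [lam], the three quotients [q], then n -
    3 coordinates, each a combination of four known forms plus a multiple of the conductor. The
    coordinate of index [is0] is recovered from [h]; the final 2 pays for [s0] and [s2]. *)
Lemma growth_quad A n (f : T -> 'I_n.+1 -> {poly C}) (s0 s2 : T -> C) (ii : 'I_3 -> 'I_n.+1)
    (is0 : 'I_n.+1) sg sg' e' (phi : 'I_e' -> 'I_sg') :
  injective ii -> (forall a, ii a != is0) ->
  (forall t, A t -> [/\ forall k, (size (f t k) <= d.+1)%N, s0 t != 0 &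
     quad_at (f t) (moment (f t) (s0 t)) ii sg phi]) ->
  growth A (fun y => (exists k, coefs_of (fun t => f t k) d.+1 y) \/ (y = s0 \/ y = s2))
    (d.+1 + sg' + 3 + 3 * (d.+1 - sg) + (n - 3) * (4 + (d.+1 - 8)) + 2).
Proof.
move=> ii_inj iis HA.
pose h t := moment (f t) (s0 t).
have sh t : A t -> (size (h t) <= d.+1)%N by move=> /HA[sf _ _]; apply: size_moment.
pose dat := (('I_sg' -> C) * ('I_3 -> C) * ('I_3 -> {poly C}))%type.
pose Q t (x : dat) := let: (al, lam, q) := x in
  [/\ forall a, f t (ii a) = lam a *: h t + (\prod_l ('X - (al l)%:P)) * q a,
      forall a, (size (q a) <= d.+1 - sg)%N &
      forall k, span_mod (fdvd (\prod_l ('X - (al (phi l))%:P)) 8 d)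
        (fun b : 'I_4 => if unlift ord0 b is Some a then f t (ii a) else h t) (f t k)].
have [D HD] : exists D : T -> dat, forall t, A t -> Q t (D t).
  apply: (choose_on (fun=> 0, fun=> 0, fun=> 0)) => t /HA[_ _ [al [lam [q H]]]].
  by exists (al, lam, q).
pose al t := (D t).1.1; pose lam t := (D t).1.2; pose q t := (D t).2.
have {}HD t : A t -> Q t (al t, lam t, q t) by move=> /HD; rewrite /al /lam /q; case: (D t) => -[].
pose gq := growth_coefs (fun t => q t (inord 2)) (d.+1 - sg) (growth_coefs (fun t => q t (inord 1)) (d.+1 - sg)
  (growth_coefs (fun t => q t ord0) (d.+1 - sg)
  (growth_frees (fun (i : 'I_3) t => lam t i) (growth_frees (fun (i : 'I_sg') t => al t i)
   (growth_coefs h d.+1 (growth_const C A)))))).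
have {gq} gY0 := gq.
set Y0 := (X in growth A X _) in gY0.
have Ph : polyfunp A Y0 1 h.
  by apply: (polyfunp_coefs (k := d.+1)) => // z Hz; do 5 left; right.
have Pq a : polyfunp A Y0 1 (fun t => q t a).
  apply: (polyfunp_coefs (k := (d.+1 - sg)%N)) => [t At|z Hz]; first by have [_] := HD t At.
  case: a Hz => -[|[|[|//]]] lt; rewrite /coefs_of.
  - by rewrite (_ : Ordinal lt = ord0) => [Hz|]; [left; left; right|apply/val_inj].
  - by rewrite (_ : Ordinal lt = inord 1) => [Hz|]; [left; right|apply/val_inj; rewrite /= inordK].
  - by rewrite (_ : Ordinal lt = inord 2) => [Hz|]; [right|apply/val_inj; rewrite /= inordK].
have Pprod m (psi : 'I_m -> 'I_sg') : polyfunp A Y0 m (fun t => \prod_l ('X - (al t (psi l))%:P)).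
  have := @polyfunp_prod C T A Y0 1 _ (index_enum 'I_m) (fun l t => 'X - (al t (psi l))%:P).
  rewrite -[index_enum _]enumT size_enum_ord mul1n; apply=> l.
  by apply: polyfunp_XsubC; do 4 left; right; exists (psi l).
pose L := (sg' + e' + 2)%N.
have Pii a : polyfunp A Y0 L (fun t => f t (ii a)).
  apply: (@polyfunp_ext _ _ _ _ _ (fun t => lam t a *: h t + (\prod_l ('X - (al t l)%:P)) * q t a)) => [|t At].
    apply: polyfunp_add; last by apply: polyfunp_leq (polyfunp_mul (Pprod _ id) (Pq a)); rewrite /L; lia.
    apply: (@polyfunp_leq _ _ _ _ (1 + 1)); first by rewrite /L; lia.
    apply: polyfunp_scale => //; apply: polyfun_gen; do 3 left; right; by exists a.
  by have [-> _ _] := HD t At.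
pose excl := is0 :: [seq ii a | a <- enum 'I_3].
pose ks := [seq k <- enum 'I_n.+1 | k \notin excl].
have sks : size ks = (n - 3)%N.
  have ue : uniq excl.
    rewrite /= map_inj_uniq ?enum_uniq // andbT; apply/negP => /mapP[a _ Ea].
    by have := iis a; rewrite Ea eqxx.
  rewrite /ks size_filter -[LHS]/(count (predC (mem excl)) (enum 'I_n.+1)).
  have := count_predC (mem excl) (enum 'I_n.+1); rewrite size_enum_ord.
  have -> : count (mem excl) (enum 'I_n.+1) = 4.
    have se : size excl = 4 by rewrite /= size_map size_enum_ord.
    rewrite -size_filter -se; apply/eqP; rewrite eqn_leq; apply/andP; split.
      apply: uniq_leq_size; first exact: filter_uniq (enum_uniq _).
      by move=> k; rewrite mem_filter => /andP[].
    by apply: (uniq_leq_size ue) => k ki; rewrite mem_filter mem_enum andbT.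
  by lia.
have gY1 := @growth_polys C T d A Y0 _ (4 + (d.+1 - 8)) _ f ks gY0 _.
have {}gY1 : growth A (fun y => Y0 y \/ exists k, k \in ks /\ coefs_of (fun t => f t k) d.+1 y)
   (d.+1 + sg' + 3 + 3 * (d.+1 - sg) + (n - 3) * (4 + (d.+1 - 8))).
  apply: growth_leq (gY1 _); first by rewrite sks; set B := (_ * _)%N; lia.
  move=> k Y' D' YY gY'.
  apply: (@growth_span A Y' D' L 8 4 (fun t => f t k) (fun t => \prod_l ('X - (al t (phi l))%:P))
     (fun b t => if unlift ord0 b is Some a then f t (ii a) else h t)) => //.
  - by apply: polyfunp_sub YY _; apply: polyfunp_leq (Pprod _ phi); rewrite /L; lia.
  - move=> b; apply: polyfunp_sub YY _; case: (unlift ord0 b) => [a|]; first exact: Pii.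
    by apply: polyfunp_leq Ph; rewrite /L; lia.
  - by move=> t At; have [_ _] := HD t At.
have gY2 := growth_free s2 (growth_free s0 gY1).
set Y2 := (X in growth A X _) in gY2.
have Y02 z : Y0 z -> Y2 z by move=> Hz; do 3 left.
have Pk k : k != is0 -> polyfunp A Y2 L (fun t => f t k).
  move=> ki; have [kks|] := boolP (k \in ks).
    apply: polyfunp_leq (_ : 1 <= L)%N _; first by rewrite /L; lia.
    apply: (polyfunp_coefs (k := d.+1)) => [t At|z Hz]; first by have [] := HA t At.
    by left; left; right; exists k.
  rewrite mem_filter mem_enum andbT negbK inE (negPf ki) /= => /mapP[a _ ->].
  exact: polyfunp_sub Y02 (Pii a).
have Ps0 : polyfun A Y2 1 s0 by apply: polyfun_gen; left; right.
pose R t := h t - \sum_(k < n.+1 | k != is0) s0 t ^+ k *: f t k.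
have PR : polyfunp A Y2 (n.+1 + L) R.
  apply: polyfunp_add; first by apply: polyfunp_leq (polyfunp_sub Y02 Ph); rewrite /L; lia.
  apply: polyfunp_opp; apply: polyfunp_sum => k ki; apply: polyfunp_scale; last exact: Pk.
  by apply: polyfun_leq (polyfun_exp k Ps0); rewrite muln1 ltnW.
have RE t : R t = s0 t ^+ is0 *: f t is0.
  by rewrite /R /h /moment (bigD1 is0) //= addrK.
have gY3 := @growth_quots C T A Y2 _ _ (fun (l : 'I_d.+1) t => (f t is0)`_l) (fun l t => (R t)`_l)
   (fun t => s0 t ^+ is0) (n.+1 + L) gY2 _ _ _.
apply: (growth_comp (k := L)) (growth_leq _ (gY3 _ _ _)).
- move=> x [[k [l ->]]|[->|->]]; last 2 first.
  + by apply: polyfun_leq (_ : 1 <= L)%N _; [rewrite /L; lia|apply: polyfun_gen; left; left; right].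
  + by apply: polyfun_leq (_ : 1 <= L)%N _; [rewrite /L; lia|apply: polyfun_gen; left; right].
  have [->|ki] := eqVneq k is0.
    by apply: polyfun_leq (_ : 1 <= L)%N _; [rewrite /L; lia|apply: polyfun_gen; right; exists l].
  by apply: polyfun_sub (Pk k ki l) => // z Hz; left.
- by lia.
- by move=> l; apply: PR.
- by apply: polyfun_leq (polyfun_exp is0 Ps0); rewrite muln1 ltnW // ltn_addr.
move=> l t At; have [_ s00 _] := HA t At; split; first exact: expf_neq0.
by rewrite RE coefZ.
Qed.
End Quadruple.

(** * Quadrics in four variables *)

Section Quadrics.
Variable C : closedFieldType.
Hypothesis two0 : (2%:R : C) != 0.

Lemma closed_sqrt (a : C) : exists b, b * b = a.
Proof.
have [b] := @solve_monicpoly C 2 (fun i => if i == 0%N then a else 0) isT.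
rewrite !big_ord_recr big_ord0 /= mul0r !addr0 add0r mulr1 expr2 => E.
by exists b.
Qed.

Lemma complete_row k (v : 'rV[C]_k.+1) : v != 0 -> exists P, P \in unitmx /\ row 0 P = v.
Proof.
move=> v0; have rv : \rank v = 1%N by apply/eqP; rewrite eqn_leq rank_leq_row lt0n mxrank_eq0.
pose a := col_ebase v 0 0.
have Ea : col_ebase v = a%:M by rewrite [LHS]mx11_scalar.
have a0 : a != 0.
  by have := col_ebase_unit v; rewrite Ea unitmxE det_scalar1 unitfE.
exists (a *: row_ebase v); split.
  by rewrite unitmxZ ?unitfE // row_ebase_unit.
rewrite -[RHS](mulmx_ebase v) Ea mul_scalar_mx -scalemxAl linearZ /= rowE; congr (_ *: (_ *m _)).
by rewrite rv; apply/matrixP => i j; rewrite !mxE !ord1 /= andbT eq_sym.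
Qed.

(** Diagonalisation by completing squares: a vector of norm 1 becomes the first basis vector, [P2]
    clears its row and column, and the induction continues on the complement [D]. *)
Lemma sym_pid k (Q : 'M[C]_k) : Q^T = Q ->
  exists P r, [/\ P \in unitmx, (r <= k)%N & P *m Q *m P^T = pid_mx r].
Proof.
elim: k Q => [|k IH] Q sQ.
  by exists 1%:M, 0%N; split; rewrite ?unitmx1 //; apply/matrixP => -[].
have [->|Q0] := eqVneq Q 0.
  by exists 1%:M, 0%N; split; rewrite ?unitmx1 // mulmx0 mul0mx; apply/matrixP => i j; rewrite !mxE ltn0 andbF.
pose q (v : 'rV[C]_k.+1) := (v *m Q *m v^T) 0 0.
have qij i j : ((delta_mx 0 i : 'rV[C]_k.+1) *m Q *m (delta_mx 0 j : 'rV[C]_k.+1)^T) 0 0 = Q i j.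
  by rewrite trmx_delta -rowE -colE !mxE.
(* Polarisation: a form that vanishes on all vectors has zero matrix since 2 is invertible. *)
have [v qv] : exists v, q v != 0.
  apply: NNPP => H; have {}H v : q v = 0 by apply/eqP/negPn/negP => qv; apply: H; exists v.
  case/eqP: Q0; apply/matrixP => i j; rewrite mxE.
  have := H (delta_mx 0 i + delta_mx 0 j); rewrite /q linearD /= !mulmxDl !mulmxDr.
  rewrite mxE [X in X + _]mxE [X in _ + X]mxE !qij.
  have := H (delta_mx 0 i); rewrite /q qij => ->; have := H (delta_mx 0 j); rewrite /q qij => ->.
  have -> : Q j i = Q i j by rewrite -{1}sQ mxE.
  rewrite add0r addr0 -mulr2n -mulr_natl => /eqP.
  by rewrite mulf_eq0 (negPf two0) => /eqP.
have [b Eb] := closed_sqrt (q v).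
have b0 : b != 0 by apply: contraNneq qv => b0; rewrite -Eb b0 mul0r.
have {Eb b0 qv v b} [v qv] : exists v, q v = 1.
  exists (b^-1 *: v); rewrite /q linearZ /= -!scalemxAl -scalemxAr scalerA mxE -/(q v) -Eb.
  by field.
have v0 : v != 0 by apply: contraPneq qv => ->; rewrite /q !mul0mx mxE => /esym/eqP; rewrite oner_eq0.
have [P1 [uP1 rP1]] := complete_row v0.
pose Q1 : 'M[C]_(1 + k) := P1 *m Q *m P1^T.
have sQ1 : Q1^T = Q1 by rewrite /Q1 !trmx_mul trmxK sQ mulmxA.
have Q100 : ulsubmx Q1 = 1%:M.
  apply/matrixP => i j; rewrite !ord1 mxE mxE [RHS]mxE eqxx -[RHS]qv /q -rP1 tr_row.
  rewrite colE mulmxA -row_mul -row_mul -colE [RHS]mxE [RHS]mxE.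
  by congr (_ _ _); apply/val_inj.
pose b := ursubmx Q1; have Eb : dlsubmx Q1 = b^T by rewrite trmx_ursub sQ1.
pose P2 : 'M[C]_(1 + k) := block_mx 1%:M 0 (- b^T) 1%:M.
pose D := drsubmx Q1 - b^T *m b.
have sD : D^T = D by rewrite /D linearB /= trmx_mul trmxK trmx_drsub sQ1.
have EP2 : P2 *m Q1 *m P2^T = block_mx 1%:M 0 0 D.
  rewrite -[Q1]submxK Q100 Eb -/b /P2 tr_block_mx !linearN /= !trmx1 trmx0 trmxK.
  rewrite !mulmx_block !(mulmx1, mul1mx, mul0mx, mulmx0, mulmxN, mulNmx, addr0, add0r, addNr, oppr0).
  by rewrite addrC.
have [P3 [r [uP3 rk EP3]]] := IH D sD.
pose P4 : 'M[C]_(1 + k) := block_mx 1%:M 0 0 P3.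
have uP4 : P4 \in unitmx by rewrite unitmxE det_ublock det1 mul1r -unitmxE.
have uP2 : P2 \in unitmx by rewrite unitmxE det_lblock !det1 mulr1 unitr1.
have EP4 : P4 *m block_mx 1%:M 0 0 D *m P4^T = pid_mx (1 + r).
  rewrite /P4 tr_block_mx !trmx1 !trmx0 !mulmx_block.
  rewrite !(mulmx1, mul1mx, mul0mx, mulmx0, addr0, add0r) EP3.
  rewrite -[RHS]submxK; congr block_mx; apply/matrixP => i j; rewrite !mxE /= ?ord1 //.
exists (P4 *m P2 *m P1), (1 + r)%N; split=> //.
  by rewrite !unitmx_mul uP1 andbT; apply/andP; split.
rewrite -EP4 -EP2 /Q1 !trmx_mul !mulmxA.
by [].
Qed.

Definition fam4 (u v w z : {poly C}) (k : 'I_4) := nth 0 [:: u; v; w; z] k.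

Notation is0 := (fun p : {poly C} => p = 0).

Lemma span_fam4 u v w z p : span_mod is0 (fam4 u v w z) p <->
  exists a b c d : C, p = a *: u + b *: v + c *: w + d *: z.
Proof.
split=> [[m /eqP]|[a [b [c [d E]]]]].
  rewrite subr_eq0 !big_ord_recr big_ord0 /= add0r => /eqP ->.
  by do 4 eexists.
exists (fun k => nth 0 [:: a; b; c; d] k); apply/eqP.
by rewrite subr_eq0 !big_ord_recr big_ord0 /= add0r E.
Qed.

Lemma indep4_span3 (f : 'I_4 -> {poly C}) (e : 'I_3 -> {poly C}) :
  indep_mod is0 f -> ~ (forall i, span_mod is0 e (f i)).
Proof. by move=> fi H; have := indep_le_span (linpred_eq0 _) fi H. Qed.

(** After diagonalisation the relation is a sum of [r] squares. Rank 1 or 2 would make a linear form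
    vanish and contradict independence. Rank 3 gives the cone and rank 4 the smooth quadric, by
    factoring sums of two squares with a square root of -1. *)
Lemma quadric_split (f : 'I_4 -> {poly C}) (Q : 'M[C]_4) : Q^T = Q -> Q != 0 ->
  indep_mod is0 f -> \sum_i \sum_j Q i j *: (f i * f j) = 0 ->
  exists u v w z, (u * v = w * z \/ u * v = w * w) /\ forall i, span_mod is0 (fam4 u v w z) (f i).
Proof.
move=> sQ Q0 fi Qf; have [P [r [uP r4 EP]]] := sym_pid sQ.
pose G : 'cV[{poly C}]_4 := (map_mx polyC (invmx P))^T *m \col_i f i.
have FG : \col_i f i = (map_mx polyC P)^T *m G.
  rewrite /G mulmxA -trmx_mul -map_mxM mulVmx // map_mx1 trmx1 mul1mx.
  by [].
clearbody G.
have fG i : f i = \sum_k P k i *: G k 0.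
  have := congr1 (fun M : 'cV[{poly C}]_4 => M i 0) FG; rewrite !mxE => ->.
  by apply: eq_bigr => k _; rewrite !mxE mul_polyC.
have rel : \sum_(k < 4 | (k < r)%N) G k 0 * G k 0 = 0.
  have E1 : ((\col_i f i)^T *m map_mx polyC Q *m \col_i f i) 0 0 = 0.
    rewrite -[RHS]Qf mxE exchange_big; apply: eq_bigr => j _; rewrite !mxE mulr_suml; apply: eq_bigr => i _.
    by rewrite !mxE -mul_polyC; ring.
  have E2 : map_mx polyC P *m map_mx polyC Q *m (map_mx polyC P)^T = map_mx polyC (pid_mx r).
    rewrite -EP !map_mxM; congr (_ *m _); by apply/matrixP => a b; rewrite !mxE.
  have E3 : (\col_i f i)^T *m map_mx polyC Q *m \col_i f i = G^T *m map_mx polyC (pid_mx r) *m G.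
    by rewrite FG trmx_mul trmxK -E2 !mulmxA.
  rewrite E3 mxE in E1; rewrite -[RHS]E1.
  rewrite big_mkcond; apply: eq_bigr => k _; rewrite !mxE (bigD1 k) //= !mxE ?eqxx /=.
  rewrite big1 ?addr0 => [|j jk]; last by rewrite !mxE (inj_eq val_inj) (negPf jk) /= polyC0 mulr0.
  by case: ifP; rewrite ?polyC1 ?polyC0 ?mulr1 ?mulr0 ?mul0r.
pose g k := G (inord k) 0.
have Eg (k : 'I_4) : G k 0 = g k by rewrite /g inord_val.
have [io Eio] := closed_sqrt (-1).
pose i := io%:P : {poly C}; have Ei : i * i = -1 by rewrite /i -polyCM Eio polyCN.
have io0 : io != 0 by apply: contra_eq_neq Eio => ->; rewrite mul0r eq_sym oppr_eq0 oner_eq0.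
have {}rel : \sum_(k < 4 | (k < r)%N) g k * g k = 0.
  by rewrite -[RHS]rel; apply: eq_bigr => k _; rewrite Eg.
have {}fG j : exists a b c d : C, f j = a *: g 0%N + b *: g 1%N + c *: g 2%N + d *: g 3%N.
  exists (P (inord 0) j), (P (inord 1) j), (P (inord 2) j), (P (inord 3) j).
  rewrite fG !big_ord_recr big_ord0 /= add0r.
  by congr (_ + _ + _ + _); rewrite Eg /=; congr (P _ _ *: _); apply/val_inj; rewrite /= inordK.
have E4 : \sum_(k < 4 | (k < r)%N) g k * g k = (if (0 < r)%N then g 0%N * g 0%N else 0) +
  (if (1 < r)%N then g 1%N * g 1%N else 0) + (if (2 < r)%N then g 2%N * g 2%N else 0) +
  (if (3 < r)%N then g 3%N * g 3%N else 0).
  by rewrite big_mkcond !big_ord_recr big_ord0 /= add0r.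
rewrite E4 in rel; clear E4.
pose H : {poly C} := (2%:R^-1)%:P.
have EH : H + H = 1 by rewrite -polyCD -[RHS]polyC1; congr (_%:P); field.
have no3 (e1 e2 e3 : {poly C}) : ~ (forall j, exists a b c : C, f j = a *: e1 + b *: e2 + c *: e3).
  move=> He; apply: (@indep4_span3 f (fun k => nth 0 [:: e1; e2; e3] k) fi) => j.
  have [a [b [c E]]] := He j; exists (fun k => nth 0 [:: a; b; c] k); apply/eqP.
  by rewrite subr_eq0 !big_ord_recr big_ord0 /= add0r E.
case: r r4 EP rel => [|[|[|[|[|//]]]]] _ EP /=; rewrite ?addr0.
- case/eqP: Q0; apply/eqP; have := congr1 (fun M => invmx P *m M *m invmx P^T) EP.
  rewrite !mulmxA mulVmx // mul1mx mulmxK ?unitmx_tr // => ->.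
  by rewrite (_ : pid_mx 0 = 0) ?mulmx0 ?mul0mx //; apply/matrixP => a b; rewrite !mxE ltn0 andbF.
- move=> /eqP; rewrite mulf_eq0 orbb => /eqP g0; case: (no3 (g 1%N) (g 2%N) (g 3%N)) => j.
  by have [a [b [c [d ->]]]] := fG j; exists b, c, d; rewrite g0 scaler0 add0r.
- move=> E; have /eqP : (g 0%N - i * g 1%N) * (g 0%N + i * g 1%N) = 0.
    by rewrite -[RHS]E mulrBl !mulrDr; rewrite (_ : i * g 1%N * (i * g 1%N) = - (g 1%N * g 1%N)); [ring|rewrite mulrACA Ei mulN1r].
  rewrite mulf_eq0 => /orP[/eqP E0|/eqP E0]; case: (no3 (g 1%N) (g 2%N) (g 3%N)) => j;
  have [a [b [c [d ->]]]] := fG j.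
    exists (a * io + b), c, d; move/eqP: E0; rewrite subr_eq0 => /eqP ->.
    by rewrite -!mul_polyC !(polyCD, polyCN, polyCM) -/i; ring.
  exists (- (a * io) + b), c, d; move/eqP: E0; rewrite addr_eq0 => /eqP ->.
  by rewrite -!mul_polyC !(polyCD, polyCN, polyCM) -/i; ring.
- move=> E; exists (g 0%N + i * g 1%N), (g 0%N - i * g 1%N), (i * g 2%N), (g 3%N); split.
    right; rewrite mulrACA Ei mulN1r; apply/eqP; rewrite -addr_eq0 -[X in _ == X]E; apply/eqP.
    rewrite mulrDl !mulrBr (_ : i * g 1%N * (i * g 1%N) = - (g 1%N * g 1%N)); [ring|by rewrite mulrACA Ei mulN1r].
  move=> j; apply/span_fam4; have [a [b [c [d ->]]]] := fG j.
  exists (a / 2%:R - b * io / 2%:R), (a / 2%:R + b * io / 2%:R), (- (c * io)), d.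
  rewrite -!mul_polyC !(polyCD, polyCN, polyCM) -/H -/i.
  set a' := a%:P; set b' := b%:P; set c' := c%:P; set d' := d%:P.
  transitivity ((H + H) * (a' * g 0%N) - (i * i) * (H + H) * (b' * g 1%N)
     - (i * i) * (c' * g 2%N) + d' * g 3%N); last by ring.
  by rewrite EH Ei; ring.
- move=> E; exists (g 0%N + i * g 1%N), (g 0%N - i * g 1%N), (i * g 2%N + g 3%N), (i * g 2%N - g 3%N); split.
    left; apply/eqP; rewrite -subr_eq0; apply/eqP.
    transitivity (g 0%N * g 0%N - (i * i) * (g 1%N * g 1%N) - (i * i) * (g 2%N * g 2%N) + g 3%N * g 3%N); first by ring.
    by rewrite Ei -[RHS]E; ring.
  move=> j; apply/span_fam4; have [a [b [c [d ->]]]] := fG j.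
  exists (a / 2%:R - b * io / 2%:R), (a / 2%:R + b * io / 2%:R),
    (- (c * io) / 2%:R + d / 2%:R), (- (c * io) / 2%:R - d / 2%:R).
  rewrite -!mul_polyC !(polyCD, polyCN, polyCM) -/H -/i.
  set a' := a%:P; set b' := b%:P; set c' := c%:P; set d' := d%:P.
  transitivity ((H + H) * (a' * g 0%N) - (i * i) * (H + H) * (b' * g 1%N)
     - (i * i) * (H + H) * (c' * g 2%N) + (H + H) * (d' * g 3%N)); last by ring.
  by rewrite EH Ei; ring.
Qed.
End Quadrics.

(** * Curves on quadrics and normalised pencils *)

Section Special.
Variable C : closedFieldType.
Notation is0 := (fun p : {poly C} => p = 0).

(** Reduced echelon form of a basis of a pencil, with pivots [i] and [j]: it fixes the choice of
    basis and saves two coefficients in each generator. *)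
Definition normal_pencil k (i j : 'I_k) (a b : {poly C}) :=
  [/\ [/\ (size a <= k)%N, (size b <= k)%N & i != j],
      a`_i = 1, a`_j = 0, b`_i = 0 & b`_j = 1].

Lemma pencil_normal k (a b : {poly C}) : (size a <= k)%N -> (size b <= k)%N ->
  (forall x y : C, x *: a + y *: b = 0 -> x = 0 /\ y = 0) ->
  exists (i j : 'I_k) a' b' (x : 'I_2 -> 'I_2 -> C), [/\ normal_pencil i j a' b',
    a = x 0 0 *: a' + x 0 1 *: b' & b = x 1 0 *: a' + x 1 1 *: b'].
Proof.
move=> sa sb ab.
have [i [j D0]] : exists i j : 'I_k, a`_i * b`_j - a`_j * b`_i != 0.
  apply: NNPP => H; have {}H i j : (i < k)%N -> (j < k)%N -> a`_i * b`_j = a`_j * b`_i.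
    move=> ik jk; apply/eqP; rewrite -subr_eq0; apply/negPn/negP => H1.
    by apply: H; exists (Ordinal ik), (Ordinal jk).
  have a0 : a != 0.
    by apply/eqP => a0; have [|/eqP] := ab 1 0; rewrite ?a0 ?scaler0 ?scale0r ?addr0 // oner_eq0.
  have li : ((size a).-1 < k)%N by rewrite prednK ?size_poly_gt0.
  have [|_ /eqP] := ab (- b`_(size a).-1) (a`_(size a).-1); last by rewrite -lead_coefE lead_coef_eq0 (negPf a0).
  apply/polyP => l; rewrite coefD !coefZ coef0; have [lk|kl] := ltnP l k.
    by rewrite (H _ _ li lk); ring.
  by rewrite (nth_default _ (leq_trans sa kl)) (nth_default _ (leq_trans sb kl)) !mulr0 addr0.
set D := _ - _ in D0.
have nij : i != j by apply: contraNneq D0 => E; rewrite /D E subrr.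
pose a' := D^-1 *: (b`_j *: a - a`_j *: b); pose b' := D^-1 *: (a`_i *: b - b`_i *: a).
have LS := linpred_size C k.
have sZ (c : C) (p : {poly C}) : (size p <= k)%N -> (size (c *: p) <= k)%N.
  by move=> sp; rewrite (leq_trans (size_scale_leq _ _)).
exists i, j, a', b', (fun u v => if u == 0 then if v == 0 then a`_i else a`_j else if v == 0 then b`_i else b`_j).
split=> /=.
- split; first split=> //.
  + by apply: (sZ); apply: (linpredB LS); apply: (sZ).
  + by apply: (sZ); apply: (linpredB LS); apply: (sZ).
  + by rewrite coefZ coefB !coefZ; apply: (mulfI D0); rewrite mulrA mulfV // mul1r mulr1 /D; ring.
  + by rewrite coefZ coefB !coefZ mulrC; apply/eqP; rewrite mulf_eq0; apply/orP; left; apply/eqP; ring.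
  + by rewrite coefZ coefB !coefZ mulrC; apply/eqP; rewrite mulf_eq0; apply/orP; left; apply/eqP; ring.
  + by rewrite coefZ coefB !coefZ; apply: (mulfI D0); rewrite mulrA mulfV // mul1r mulr1 /D; ring.
- rewrite /a' /b' -!mul_polyC.
  set Di := (D^-1)%:P; have EDi : Di * D%:P = 1 by rewrite -polyCM mulVf.
  transitivity (Di * D%:P * a); first by rewrite EDi mul1r.
  by rewrite /D polyCB !polyCM; ring.
- rewrite /a' /b' -!mul_polyC.
  set Di := (D^-1)%:P; have EDi : Di * D%:P = 1 by rewrite -polyCM mulVf.
  transitivity (Di * D%:P * b); first by rewrite EDi mul1r.
  by rewrite /D polyCB !polyCM; ring.
Qed.

Lemma factor4 (u v w z : {poly C}) : u != 0 -> w != 0 -> u * v = w * z ->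
  exists a b c d, [/\ [/\ u = a * c, w = a * d, z = b * c & v = b * d], c != 0 & d != 0].
Proof.
move=> u0 w0 E; pose a := gcdp u w.
have a0 : a != 0 by rewrite gcdp_eq0 negb_and u0.
have Eu : u = a * (u %/ a) by rewrite mulrC divpK // dvdp_gcdl.
have Ew : w = a * (w %/ a) by rewrite mulrC divpK // dvdp_gcdr.
have cop : coprimep (u %/ a) (w %/ a) by apply: coprimep_div_gcd; rewrite u0.
have c0 : u %/ a != 0 by apply: contraNneq u0 => H; rewrite Eu H mulr0.
have d0 : w %/ a != 0 by apply: contraNneq w0 => H; rewrite Ew H mulr0.
have E1 : u %/ a * v = w %/ a * z by apply: (mulfI a0); rewrite !mulrA -Eu -Ew.
have /dvdpP[b Eb] : u %/ a %| z by rewrite -(Gauss_dvdpr _ cop) -E1 dvdp_mulr.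
exists a, b, (u %/ a), (w %/ a); split=> //; split=> //.
by apply: (mulfI c0); rewrite E1 Eb; ring.
Qed.

Lemma factor3 (u v w : {poly C}) : u != 0 -> w != 0 -> u * v = w * w ->
  exists m c d, [/\ [/\ u = m * (c * c), w = m * (c * d) & v = m * (d * d)], m != 0, c != 0 & d != 0].
Proof.
move=> u0 w0 E; pose a := gcdp u w.
have a0 : a != 0 by rewrite gcdp_eq0 negb_and u0.
have Eu : u = a * (u %/ a) by rewrite mulrC divpK // dvdp_gcdl.
have Ew : w = a * (w %/ a) by rewrite mulrC divpK // dvdp_gcdr.
have cop : coprimep (u %/ a) (w %/ a) by apply: coprimep_div_gcd; rewrite u0.
set c := u %/ a in Eu cop; set d := w %/ a in Ew cop.
have c0 : c != 0 by apply: contraNneq u0 => H; rewrite Eu H mulr0.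
have d0 : d != 0 by apply: contraNneq w0 => H; rewrite Ew H mulr0.
have E1 : c * v = d ^+ 2 * a by apply: (mulfI a0); rewrite mulrA -Eu E Ew; ring.
have /dvdpP[m Em] : c %| a.
  by rewrite -(Gauss_dvdpr _ (coprimep_expr 2 cop)) -E1 dvdp_mulr.
exists m, c, d; split=> //; last by apply: contraNneq a0 => H; rewrite Em H mul0r.
split; first by rewrite Eu Em; ring.
  by rewrite Ew Em; ring.
by apply: (mulfI c0); rewrite E1 Em; ring.
Qed.

Lemma span_indep n (f e : 'I_n.+1 -> {poly C}) : indep_mod is0 f ->
  (forall i, span_mod is0 e (f i)) -> indep_mod is0 e.
Proof.
move=> fi fs a Ea k; apply: NNPP => /eqP ak.
suff : (n.+1 <= n)%N by rewrite ltnn.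
have L0 := linpred_eq0 {poly C}.
apply: (@indep_le_span _ _ _ _ _ (fun j => e (lift k j)) f L0 fi) => i.
apply: (span_mod_min (linpred_span _ L0) _ _ (fs i)) => [q ->|j]; first exact: (proj1 (linpred_span _ L0)).
case: (unliftP k j) => [j'|] ->; first exact: span_mod_mem.
exists (fun j' => - (a k)^-1 * a (lift k j')); apply: (scalerI ak); rewrite scaler0 scalerBr.
rewrite scaler_sumr -[RHS]Ea (bigD1_ord k) //=; congr (_ + _); rewrite -sumrN; apply: eq_bigr => j' _.
by rewrite scalerA mulNr mulrN mulrA mulfV // mul1r scaleNr opprK.
Qed.

Lemma span_swap n (f e : 'I_n -> {poly C}) p : indep_mod is0 f ->
  (forall i, span_mod is0 e (f i)) -> span_mod is0 e p -> span_mod is0 f p.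
Proof.
move=> fi fs ps; apply: NNPP => np; suff : (n.+1 <= n)%N by rewrite ltnn.
have L0 := linpred_eq0 {poly C}.
apply: (@indep_le_span _ _ _ _ _ e (extend_fam f p) L0); first exact: indep_extend_fam.
by move=> i; case: (unliftP ord0 i) => [j|] ->; rewrite ?extend_fam0 ?extend_famS.
Qed.

Section Count.
Variable T : Type.
Implicit Types (A : T -> Prop) (Y : (T -> C) -> Prop).

Lemma growth_fin A Y D (I : finType) (S : pred I) (z : I -> T -> C) : growth A Y D ->
  growth A (fun y => Y y \/ exists i, S i /\ y = z i) (D + #|S|).
Proof.
move=> /(growth_frees (fun i : 'I_#|S| => z (enum_val i))); apply: growth_sub => // y [Yy|[i [Si ->]]].
  by left.
by right; exists (enum_rank_in Si i); rewrite enum_rankK_in.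
Qed.

Lemma growth_coefs2 A Y D k (i j : 'I_k) (p : T -> {poly C}) a b : growth A Y D -> i != j ->
  (forall t, A t -> (p t)`_i = a /\ (p t)`_j = b) ->
  growth A (fun y => Y y \/ coefs_of p k y) (D + (k - 2)).
Proof.
move=> gY ij H.
have := growth_fin (predC (pred2 i j)) (fun (l : 'I_k) t => (p t)`_l) gY.
have -> : #|predC (pred2 i j)| = (k - 2)%N.
  by have := cardC (pred2 i j); rewrite card2 ij card_ord; set B := #|_|; lia.
apply: (growth_comp (k := 1)) => y [Yy|[l ->]]; first by apply: polyfun_gen; left.
have [->|li] := eqVneq l i.
  by apply: polyfun_ext (polyfun_const _ _ a _) _ => t /H[].
have [->|lj] := eqVneq l j.
  by apply: polyfun_ext (polyfun_const _ _ b _) _ => t /H[].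
by apply: polyfun_gen; right; exists l; rewrite /= negb_or li lj.
Qed.

Lemma growth_pencil A Y D k (i j : 'I_k) (a b : T -> {poly C}) : growth A Y D ->
  (forall t, A t -> normal_pencil i j (a t) (b t)) -> i != j ->
  growth A (fun y => (Y y \/ coefs_of a k y) \/ coefs_of b k y) (D + (k - 2) + (k - 2)).
Proof.
move=> gY H ij; apply: (@growth_coefs2 _ _ _ k i j b 0 1) => // [|t /H[]//].
by apply: (@growth_coefs2 _ _ _ k i j a 1 0) => // t /H[].
Qed.

(** A map to a product of two lines, given by pencils of degrees at most k - 1 and k' - 1, followed
    by the Segre embedding and a linear change of coordinates. *)
Definition quad4_at (f : 'I_4 -> {poly C}) k k' (i1 j1 : 'I_k) (i2 j2 : 'I_k') :=
  exists a b c d, [/\ normal_pencil i1 j1 a b, normal_pencil i2 j2 c d &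
    forall i, span_mod is0 (fam4 (a * c) (b * d) (a * d) (b * c)) (f i)].

Lemma growth_empty A Y D : ~ (exists t, A t) -> growth A Y D.
Proof.
move=> nA; apply: growth_leq (leq0n D) _.
apply: (growth_comp (k := 0)) (growth_const C A) => y _.
by apply: polyfun_ext (polyfun_const _ _ 0 _) _ => t At; case: nA; exists t.
Qed.

Lemma polyfunp_comb A Y m b (mu : 'I_b -> T -> {poly C}) (z : T -> 'I_b -> C) p :
  (forall i, polyfunp A Y m (mu i)) -> (forall i, Y (fun t => z t i)) ->
  (forall t, A t -> p t - \sum_i z t i *: mu i t = 0) -> polyfunp A Y (1 + m) p.
Proof.
move=> Pmu Yz E; apply: (@polyfunp_ext _ _ _ _ _ (fun t => \sum_i z t i *: mu i t)) => [|t /E/eqP].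
  by apply: polyfunp_sum => i _; apply: polyfunp_scale => //; apply: polyfun_gen.
by rewrite subr_eq0 => /eqP ->.
Qed.

Lemma polyfunp_fam4 A Y m (u v w z : T -> {poly C}) k : polyfunp A Y m u -> polyfunp A Y m v ->
  polyfunp A Y m w -> polyfunp A Y m z -> polyfunp A Y m (fun t => fam4 (u t) (v t) (w t) (z t) k).
Proof. by move=> *; case: k => -[|[|[|[|//]]]] lt; rewrite /fam4. Qed.

(** 16 counts the coefficients of the four coordinates over the four Segre products; each generator
    of a pencil costs its size minus the two pivot coefficients. *)
Lemma growth_quad4 A (f : T -> 'I_4 -> {poly C}) k k' (i1 j1 : 'I_k) (i2 j2 : 'I_k') :
  (forall t, A t -> quad4_at (f t) i1 j1 i2 j2) ->
  growth A (fun y => exists i, coefs_of (fun t => f t i) 7 y)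
    (16 + ((k - 2) + (k - 2)) + ((k' - 2) + (k' - 2))).
Proof.
move=> HA.
have [[t0 At0]|nA] := classic (exists t, A t); last exact: growth_empty.
have [n1 n2] : i1 != j1 /\ i2 != j2.
  by have [a [b [c [d [[[_ _ ?] _ _ _ _] [[_ _ ?] _ _ _ _] _]]]]] := HA t0 At0.
pose dat := ({poly C} * {poly C} * {poly C} * {poly C} * ('I_4 -> 'I_4 -> C))%type.
pose Q t (x : dat) := let: (a, b, c, d, z) := x in [/\ normal_pencil i1 j1 a b, normal_pencil i2 j2 c d &
    forall i, f t i - \sum_l z i l *: fam4 (a * c) (b * d) (a * d) (b * c) l = 0].
have [D HD] : exists D : T -> dat, forall t, A t -> Q t (D t).
  apply: (choose_on (0, 0, 0, 0, fun=> fun=> 0)) => t /HA[a [b [c [d [H1 H2 /fin_all_exists[z Hz]]]]]].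
  by exists (a, b, c, d, z).
pose a t := (D t).1.1.1.1; pose b t := (D t).1.1.1.2; pose c t := (D t).1.1.2; pose d t := (D t).1.2.
pose z t := (D t).2.
have {}HD t : A t -> Q t (a t, b t, c t, d t, z t).
  by move=> /HD; rewrite /a /b /c /d /z; case: (D t) => -[[[]]].
have g1 := growth_fin (xpredT : pred ('I_4 * 'I_4)) (fun ij t => z t ij.1 ij.2) (growth_const C A).
have g2 := @growth_pencil A _ _ k i1 j1 a b g1 (fun t At => let: And3 h _ _ := HD t At in h) n1.
have g3 := @growth_pencil A _ _ k' i2 j2 c d g2 (fun t At => let: And3 _ h _ := HD t At in h) n2.
set Y := (X in growth A X _) in g3.
have Pa : polyfunp A Y 1 a.
  apply: (polyfunp_coefs (k := k)) => [t /HD[[[]]]//|y Hy]; by do 3 left; right.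
have Pb : polyfunp A Y 1 b.
  apply: (polyfunp_coefs (k := k)) => [t /HD[[[]]]//|y Hy]; by do 2 left; right.
have Pc : polyfunp A Y 1 c.
  apply: (polyfunp_coefs (k := k')) => [t /HD[_ [[]]]//|y Hy]; by left; right.
have Pd : polyfunp A Y 1 d.
  by apply: (polyfunp_coefs (k := k')) => [t /HD[_ [[]]]//|y Hy]; right.
apply: (growth_comp (k := (1 + (1 + 1))%N)) (growth_leq _ g3) => [y [i [l ->]]|]; last first.
  by rewrite card_prod !card_ord; lia.
have := @polyfunp_comb A Y (1 + 1) 4 (fun l t => fam4 (a t * c t) (b t * d t) (a t * d t) (b t * c t) l)
  (fun t => z t i) (fun t => f t i); apply.
- by move=> l'; apply: polyfunp_fam4; apply: polyfunp_mul.
- by move=> l'; do 4 left; right; exists (i, l').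
- by move=> t /HD[].
Qed.

(** The pencil [c], [d] is the projection of the cone to its base conic, [m] a common factor. The
    fourth form of the basis is a coordinate of the curve itself, so that coordinate needs no
    coefficients over the basis. *)
Definition cone_at (f : 'I_4 -> {poly C}) k k' (i1 j1 : 'I_k) (i0 : 'I_4) :=
  exists m c d : {poly C}, [/\ normal_pencil i1 j1 c d, (size m <= k')%N, (size (f i0) <= 7)%N &
    forall i, span_mod is0 (fam4 (m * (c * c)) (m * (d * d)) (m * (c * d)) (f i0)) (f i)].

(** 7 counts the coordinate [f i0], 12 the coefficients of the three other coordinates over four
    forms, then come the pencil and the factor [m]. *)
Lemma growth_cone A (f : T -> 'I_4 -> {poly C}) k k' (i1 j1 : 'I_k) (i0 : 'I_4) :
  (forall t, A t -> cone_at (f t) k' i1 j1 i0) ->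
  growth A (fun y => exists i, coefs_of (fun t => f t i) 7 y)
    (7 + 12 + ((k - 2) + (k - 2)) + k').
Proof.
move=> HA.
have [[t0 At0]|nA] := classic (exists t, A t); last exact: growth_empty.
have n1 : i1 != j1 by have [m [c [d [[[_ _ ?] _ _ _ _] _ _ _]]]] := HA t0 At0.
pose dat := ({poly C} * {poly C} * {poly C} * ('I_4 -> 'I_4 -> C))%type.
pose Q t (x : dat) := let: (m, c, d, z) := x in [/\ normal_pencil i1 j1 c d, (size m <= k')%N,
    (size (f t i0) <= 7)%N &
    forall i, f t i - \sum_l z i l *: fam4 (m * (c * c)) (m * (d * d)) (m * (c * d)) (f t i0) l = 0].
have [D HD] : exists D : T -> dat, forall t, A t -> Q t (D t).
  apply: (choose_on (0, 0, 0, fun=> fun=> 0)) => t /HA[m [c [d [H1 H2 H3 /fin_all_exists[z Hz]]]]].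
  by exists (m, c, d, z).
pose m t := (D t).1.1.1; pose c t := (D t).1.1.2; pose d t := (D t).1.2.
pose z t := (D t).2.
have {}HD t : A t -> Q t (m t, c t, d t, z t).
  by move=> /HD; rewrite /m /c /d /z; case: (D t) => -[[]].
have g1 := growth_fin (fun ij : 'I_4 * 'I_4 => ij.1 != i0) (fun ij t => z t ij.1 ij.2)
   (growth_coefs (fun t => f t i0) 7 (growth_const C A)).
have g2 := @growth_pencil A _ _ k i1 j1 c d g1 (fun t At => let: And4 h _ _ _ := HD t At in h) n1.
have g3 := growth_coefs m k' g2.
set Y := (X in growth A X _) in g3.
have Pf : polyfunp A Y 1 (fun t => f t i0).
  apply: (polyfunp_coefs (k := 7)) => [t /HD[]//|y Hy]; by do 4 left; right.
have Pc : polyfunp A Y 1 c.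
  apply: (polyfunp_coefs (k := k)) => [t /HD[[[]]]//|y Hy]; by do 2 left; right.
have Pd : polyfunp A Y 1 d.
  apply: (polyfunp_coefs (k := k)) => [t /HD[[[]]]//|y Hy]; by left; right.
have Pm : polyfunp A Y 1 m.
  by apply: (polyfunp_coefs (k := k')) => [t /HD[_]//|y Hy]; right.
have card12 : #|(fun ij : 'I_4 * 'I_4 => ij.1 != i0)| = 12%N.
  have -> : #|(fun ij : 'I_4 * 'I_4 => ij.1 != i0)| = #|[predX predC1 i0 & ('I_4 : finType)]|.
    by apply: eq_card => -[u v]; rewrite !inE andbT.
  rewrite cardX card_ord; have := cardC1 i0; rewrite card_ord => E1.
  by rewrite (_ : #|_| = 3).
apply: (growth_comp (k := (1 + (1 + (1 + 1)))%N)) (growth_leq _ g3) => [y [i [l ->]]|]; last first.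
  by rewrite card12; lia.
have [->|ii0] := eqVneq i i0; first by apply: polyfun_leq (Pf l).
have := @polyfunp_comb A Y (1 + (1 + 1)) 4
  (fun l t => fam4 (m t * (c t * c t)) (m t * (d t * d t)) (m t * (c t * d t)) (f t i0) l)
  (fun t => z t i) (fun t => f t i); apply.
- move=> l'; apply: polyfunp_fam4; try by apply: polyfunp_mul => //; apply: polyfunp_mul.
  exact: polyfunp_leq Pf.
- by move=> l'; do 3 left; right; exists (i, l').
- by move=> t /HD[].
Qed.
End Count.

(* A smooth quadric is [u v = w z] and a cone is [u v = w w]; factoring these
   equations writes the curve in terms of one or two pencils of forms. *)
Lemma sextic_quadric (f : 'I_4 -> {poly C}) (Q : 'M[C]_4) : (2%:R : C) != 0 ->
  (forall i, size (f i) <= 7)%N -> Q^T = Q -> Q != 0 ->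
  indep_mod is0 f -> \sum_i \sum_j Q i j *: (f i * f j) = 0 ->
  (exists (k k' : 'I_8) (i1 j1 : 'I_k) (i2 j2 : 'I_k'), (k + k' = 8)%N /\ quad4_at f i1 j1 i2 j2) \/
  (exists (k k' : 'I_8) (i1 j1 : 'I_k) (i0 : 'I_4), (k' + 2 * k = 9)%N /\ cone_at f k' i1 j1 i0).
Proof.
move=> two0 sf sQ Q0 fi Qf.
have [u [v [w [z [E fs]]]]] := quadric_split two0 sQ Q0 fi Qf.
have L0 := linpred_eq0 {poly C}.
have ie := span_indep fi fs.
have se k : (size (fam4 u v w z k) <= 7)%N.
  have := span_swap fi fs (span_mod_mem (fam4 u v w z) k L0).
  by apply: (span_mod_min (V := fun p : {poly C} => (size p <= 7)%N) (linpred_size C 7)) => // q ->; rewrite size_poly0.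
have su : (size u <= 7)%N by exact: (se 0).
have sv : (size v <= 7)%N by exact: (se 1).
have sw : (size w <= 7)%N by exact: (se 2%:R).
have sz : (size z <= 7)%N by exact: (se 3%:R).
have rel a b c d : a *: u + b *: v + c *: w + d *: z = 0 -> [/\ a = 0, b = 0, c = 0 & d = 0].
  move=> H; have K := ie (fun k => nth 0 [:: a; b; c; d] k).
  have {}K : forall i : 'I_4, nth 0 [:: a; b; c; d] i = 0.
    by apply: K; rewrite !big_ord_recr big_ord0 /= add0r.
  by split; [exact: (K 0)|exact: (K 1)|exact: (K 2%:R)|exact: (K 3%:R)].
have u0 : u != 0.
  apply/eqP => u0; have [|/eqP] := rel 1 0 0 0; last by rewrite oner_eq0.
  by rewrite u0 !scale0r scaler0 !addr0.
have w0 : w != 0.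
  apply/eqP => w0; have [|_ _ /eqP] := rel 0 0 1 0; last by rewrite oner_eq0.
  by rewrite w0 !scale0r scaler0 !addr0.
case: E => E; [left|right].
  have [a [b [c [d [[Eu Ew Ez Ev] c0 d0]]]]] := factor4 u0 w0 E.
  have a0 : a != 0 by apply: contraNneq u0 => H; rewrite Eu H mul0r.
  (* The products a c, a d, b c, b d have size at most 7, so a and b have size at most 8 minus the
     larger of the sizes of c and d. *)
  pose k' := maxn (size c) (size d); pose k := (8 - k')%N.
  have z0 : z != 0.
    apply/eqP => z0; have [|_ _ _ /eqP] := rel 0 0 0 1; last by rewrite oner_eq0.
    by rewrite z0 !scale0r scaler0 !addr0.
  have b0 : b != 0 by apply: contraNneq z0 => H; rewrite Ez H mul0r.
  have ga : (0 < size a)%N by rewrite size_poly_gt0.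
  have gb : (0 < size b)%N by rewrite size_poly_gt0.
  have gc : (0 < size c)%N by rewrite size_poly_gt0.
  have gd : (0 < size d)%N by rewrite size_poly_gt0.
  move: su sv sw sz; rewrite Eu Ew Ez Ev !size_mul // => su sv sw sz.
  have [k1 k8] : (1 <= k')%N /\ (k' < 8)%N.
    by rewrite /k'; move: ga gc gd su sw; set A := size a; set B := size c; set B' := size d; lia.
  have sak : (size a <= k)%N.
    by rewrite /k /k'; move: ga gc gd su sw; set A := size a; set B := size c; set B' := size d; lia.
  have sbk : (size b <= k)%N.
    by rewrite /k /k'; move: gb gc gd sv sz; set A := size b; set B := size c; set B' := size d; lia.
  have k78 : (k < 8)%N by rewrite /k; lia.
  have [x y|i1 [j1 [a' [b' [x [nab Ea Eb]]]]]] := pencil_normal sak sbk.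
    move=> H; have [|-> _ _ -> //] := rel x 0 0 y; rewrite !scale0r !addr0 Eu Ez.
    by rewrite !scalerAl -mulrDl H mul0r.
  have [||x1 y1|i2 [j2 [c' [d' [x' [ncd Ec Ed]]]]]] := @pencil_normal k' c d; rewrite ?leq_maxl ?leq_maxr //.
    move=> H; have [|-> _ -> //] := rel x1 0 y1 0; rewrite !scale0r !addr0 Eu Ew.
    by rewrite !scalerAr -mulrDr H mulr0.
  exists (Ordinal k78), (Ordinal k8), i1, j1, i2, j2; split; first by rewrite /= /k; lia.
  exists a', b', c', d'; split=> // i.
  have LS := linpred_span (fam4 (a' * c') (b' * d') (a' * d') (b' * c')) L0.
  have key X1 X2 X3 X4 : span_mod is0 (fam4 (a' * c') (b' * d') (a' * d') (b' * c'))
      ((X1 *: a' + X2 *: b') * (X3 *: c' + X4 *: d')).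
    apply/span_fam4; exists (X1 * X3), (X2 * X4), (X1 * X4), (X2 * X3).
    by rewrite -!mul_polyC !polyCM; ring.
  apply: (span_mod_min LS _ _ (fs i)) => [q ->|l]; first by case: LS.
  by case: l => -[|[|[|[|//]]]] lt; rewrite /fam4 /= ?Eu ?Ev ?Ew ?Ez ?Ea ?Eb ?Ec ?Ed; apply: key.
have [m [c [d [[Eu Ew Ev] m0 c0 d0]]]] := factor3 u0 w0 E.
(* m c c and m d d have size at most 7, which bounds the size of m by 9 - 2k. *)
pose k := maxn (size c) (size d); pose k' := (9 - 2 * k)%N.
have gm : (0 < size m)%N by rewrite size_poly_gt0.
have gc : (0 < size c)%N by rewrite size_poly_gt0.
have gd : (0 < size d)%N by rewrite size_poly_gt0.
move: su sv; rewrite Eu Ev !size_mul ?mulf_neq0 // => su sv.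
have k4 : (0 < k <= 4)%N.
  by rewrite /k; move: gm gc gd su sv; set A := size m; set B := size c; set B' := size d; lia.
have k8 : (k < 8)%N by lia.
have k'8 : (k' < 8)%N by rewrite /k'; lia.
have smk : (size m <= k')%N.
  by rewrite /k' /k; move: gm gc gd su sv; set A := size m; set B := size c; set B' := size d; lia.
have [||x y|i1 [j1 [c' [d' [x [ncd Ec Ed]]]]]] := @pencil_normal k c d; rewrite ?leq_maxl ?leq_maxr //.
  move=> H; have [|-> _ -> //] := rel x 0 y 0; rewrite !scale0r !addr0 Eu Ew.
  by rewrite !scalerAr -mulrDr -mulrDr H !mulr0.
pose e' := fam4 (m * (c' * c')) (m * (d' * d')) (m * (c' * d')) z.
have LS := linpred_span e' L0.
have fs' i : span_mod is0 e' (f i).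
  apply: (span_mod_min LS _ _ (fs i)) => [q ->|l]; first by case: LS.
  have key X1 X2 X3 X4 : span_mod is0 e' (m * ((X1 *: c' + X2 *: d') * (X3 *: c' + X4 *: d'))).
    apply/span_fam4; exists (X1 * X3), (X2 * X4), (X1 * X4 + X2 * X3), 0.
    by rewrite scale0r addr0 -!mul_polyC polyCD !polyCM; ring.
  case: l => -[|[|[|[|//]]]] lt; rewrite /fam4 /= ?Eu ?Ev ?Ew ?Ec ?Ed //.
  exact: (span_mod_mem e' 3%:R L0).
have /fin_all_exists[M HM] i : exists M : 'I_4 -> C, f i = M 0 *: e' 0 + M 1 *: e' 1 + M 2%:R *: e' 2%:R + M 3%:R *: z.
  have /span_fam4[a1 [a2 [a3 [a4 Ei]]]] := fs' i.
  by exists (fun j => nth 0 [:: a1; a2; a3; a4] j).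
(* Some coordinate involves [z], as four independent coordinates do not fit in the span of three
   forms; that coordinate can replace [z]. *)
have [i0 Mi0] : exists i0, M i0 3%:R != 0.
  apply: NNPP => H; apply: (@indep4_span3 _ f (fun j => nth 0 [:: e' 0; e' 1; e' 2%:R] j) fi) => i.
  have M0 : M i 3%:R = 0 by apply/eqP/negPn/negP => H'; apply: H; exists i.
  exists (fun j => nth 0 [:: M i 0; M i 1; M i 2%:R] j); apply/eqP.
  by rewrite subr_eq0 {1}(HM i) M0 scale0r addr0 !big_ord_recr big_ord0 /= add0r.
exists (Ordinal k8), (Ordinal k'8), i1, j1, i0; split; first by rewrite /= /k'; lia.
exists m, c', d'; split=> // i.
have LS' := linpred_span (fam4 (m * (c' * c')) (m * (d' * d')) (m * (c' * d')) (f i0)) L0.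
apply: (span_mod_min LS' _ _ (fs' i)) => [q ->|l]; first by case: LS'.
have mem j := span_mod_mem (fam4 (m * (c' * c')) (m * (d' * d')) (m * (c' * d')) (f i0)) j L0.
case: l => -[|[|[|[|//]]]] lt.
- exact: (mem 0).
- exact: (mem 1).
- exact: (mem 2%:R).
rewrite /e' /fam4 /=; apply/span_fam4.
exists (- M i0 0 / M i0 3%:R), (- M i0 1 / M i0 3%:R), (- M i0 2%:R / M i0 3%:R), (M i0 3%:R)^-1.
apply: (scalerI Mi0); rewrite !scalerDr !scalerA mulfV // scale1r {1}(HM i0).
have cc (a : C) : M i0 3%:R * (- a / M i0 3%:R) = - a by rewrite mulrC divfK.
by rewrite !cc !scaleNr /e' /fam4 /=; ring.
Qed.
End Special.

(** * Curves that are not birational to the line *)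

Section Multiple.
Variable C : closedFieldType.

Lemma fresh_points (l : seq C) m : exists u : seq C, [/\ size u = m, uniq u & forall x, x \in u -> x \notin l].
Proof.
elim: m => [|m [u [su uu ul]]]; first by exists [::].
have [x] := closed_infinite (l ++ u); rewrite mem_cat negb_or => /andP[xl xu].
exists (x :: u); split; rewrite /= ?su ?xu //.
by move=> y; rewrite inE => /predU1P[->|/ul].
Qed.

(* [f] identifies the distinct points [gam a] and [bet a]. *)
Definition multiple_at n (f : 'I_n.+1 -> {poly C}) r (gam bet : 'I_r -> C) :=
  [/\ forall a, (f ord0).[gam a] != 0,
      forall a k, (f ord0).[gam a] * (f k).[bet a] = (f k).[gam a] * (f ord0).[bet a],
      forall a, (f ord0).[gam a] *: f (inord 1) - (f (inord 1)).[gam a] *: f ord0 != 0 &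
      uniq ([seq gam a | a <- enum 'I_r] ++ [seq bet a | a <- enum 'I_r])].

Variables (T : Type) (d : nat).
Implicit Types (A : T -> Prop) (Y : (T -> C) -> Prop).

Lemma polyfun_eval A Y m k (p : T -> {poly C}) z : polyfunp A Y m p ->
  (forall t, A t -> size (p t) <= k)%N -> Y z -> polyfun A Y (m + k) (fun t => (p t).[z t]).
Proof.
move=> Pp sp Yz; apply: (@polyfun_ext _ _ _ _ _ (fun t => \sum_(i < k) (p t)`_i * z t ^+ i)) => [|t At].
  apply: polyfun_sum => i _; apply: polyfun_mul => //.
  by apply: polyfun_leq (polyfun_exp i (polyfun_gen A 0 Yz)); rewrite muln1 ltnW.
by rewrite (horner_coef_wide _ (sp t At)).
Qed.

Lemma growth_multiple A n (f : T -> 'I_n.+1 -> {poly C}) r (gam : T -> 'I_r -> C) :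
  (0 < n)%N -> (2 * r <= d.+1)%N ->
  (forall t, A t -> (forall k, size (f t k) <= d.+1)%N /\ exists bet, multiple_at (f t) (gam t) bet) ->
  growth A (fun y => (exists k, coefs_of (fun t => f t k) d.+1 y) \/ exists a, y = fun t => gam t a)
    (2 * d.+1 + (n - 1) * (d.+1 - r) + r).
Proof.
move=> n0 rd HA; pose k1 : 'I_n.+1 := inord 1.
have [bet Hbet] : exists bet : T -> 'I_r -> C, forall t, A t -> multiple_at (f t) (gam t) (bet t).
  by apply: (@choose_on _ _ A (fun t bet => multiple_at (f t) (gam t) bet) (fun=> 0)) => t /HA[].
pose f0 t := f t ord0; pose f1 t := f t k1.

pose Y1 (y : T -> C) := ((False \/ coefs_of f0 d.+1 y) \/ coefs_of f1 d.+1 y) \/ exists a, y = fun t => gam t a.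
have g1 : growth A Y1 _ := growth_frees (fun a t => gam t a)
  (growth_coefs f1 d.+1 (growth_coefs f0 d.+1 (growth_const C A))).
have s0 t : A t -> (size (f0 t) <= d.+1)%N by move=> /HA[sf _]; apply: sf.
have s1 t : A t -> (size (f1 t) <= d.+1)%N by move=> /HA[sf _]; apply: sf.
have P0 : polyfunp A Y1 1 f0 by apply: (polyfunp_coefs (k := d.+1)) => // y Hy; left; left; right.
have P1 : polyfunp A Y1 1 f1 by apply: (polyfunp_coefs (k := d.+1)) => // y Hy; left; right.
have Pe p a : polyfunp A Y1 1 p -> (forall t, A t -> size (p t) <= d.+1)%N ->
    polyfun A Y1 (1 + d.+1) (fun t => (p t).[gam t a]).
  by move=> Pp sp; apply: polyfun_eval => //; right; exists a.
pose PP a t := (f0 t).[gam t a] *: f1 t - (f1 t).[gam t a] *: f0 t.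
have g2 : growth A (fun y => Y1 y \/ exists a, y = fun t => bet t a) (0 + d.+1 + d.+1 + r).
  apply: (@growth_roots C T A Y1 _ r (fun a t => bet t a) PP (1 + d.+1 + 1) d.+1 g1).
    move=> a; apply: polyfunp_add; last apply: polyfunp_opp.
      by apply: polyfunp_scale => //; apply: Pe.
    by apply: polyfunp_scale => //; apply: Pe.
  move=> a t At; have [_ H2 H3 _] := Hbet t At; split.
  - apply: (linpredB (linpred_size C d.+1)).
      by rewrite (leq_trans (size_scale_leq _ _)) // s1.
    by rewrite (leq_trans (size_scale_leq _ _)) // s0.
  - exact: H3.
  by rewrite /PP hornerD hornerN !hornerZ (H2 a k1) subrr.
pose Y2 (y : T -> C) := Y1 y \/ exists a, y = fun t => bet t a.
have Y12 y : Y1 y -> Y2 y by left.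
pose ks := [seq k <- enum 'I_n.+1 | k \notin [:: ord0; k1]].
have n01 : ord0 != k1 by rewrite -val_eqE /= inordK.
have sks : size ks = (n - 1)%N.
  rewrite /ks size_filter -[LHS]/(count (predC (mem [:: ord0; k1])) (enum 'I_n.+1)).
  have := count_predC (mem [:: ord0; k1]) (enum 'I_n.+1); rewrite size_enum_ord.
  have -> : count (mem [:: ord0; k1]) (enum 'I_n.+1) = 2.
    rewrite -size_filter; apply/eqP; rewrite eqn_leq; apply/andP; split.
      apply: (@uniq_leq_size _ _ [:: ord0; k1]); first exact: filter_uniq (enum_uniq _).
      by move=> k; rewrite mem_filter => /andP[].
    apply: (@uniq_leq_size _ [:: ord0; k1]) => [|k ki]; last by rewrite mem_filter mem_enum andbT.
    by rewrite /= inE n01.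
  by lia.
have g3 := @growth_polys C T d A Y2 _ (d.+1 - r) _ f ks g2 _.
apply: growth_sub (growth_leq _ (g3 _)) => //.
- move=> y [[k [l ->]]|[a ->]]; last by left; left; right; exists a.
  have [->|k0] := eqVneq k ord0; first by left; do 3 left; right; exists l.
  have [->|kk1] := eqVneq k k1; first by left; do 2 left; right; exists l.
  right; exists k; split; last by exists l.
  by rewrite mem_filter mem_enum !inE negb_or k0 kk1.
- by rewrite sks; set B := (_ * _)%N; lia.
move=> k Y' D' YY gY'.
pose col (a : 'I_r) t (u : 'I_d.+1) : C := (f0 t).[gam t a] * bet t a ^+ u - (f0 t).[bet t a] * gam t a ^+ u.
have colE t a (v : 'I_d.+1 -> C) : \sum_u v u * col a t u =
    (f0 t).[gam t a] * (\sum_(u < d.+1) v u *: 'X^u).[bet t a] - (f0 t).[bet t a] * (\sum_(u < d.+1) v u *: 'X^u).[gam t a].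
  rewrite !horner_sum !mulr_sumr -sumrB; apply: eq_bigr => u _.
  by rewrite /col !hornerZ !hornerXn; ring.
apply: (@growth_ker_fin C T A Y' D' (1 + d.+1 + d.+1) _ r col (d.+1 - r) (fun t u => (f t k)`_u) gY').
- move=> a u; have Y2' y : Y2 y -> Y' y by apply: YY.
  have Pg z : Y2 z -> polyfun A Y' d.+1 (fun t => z t ^+ u).
    by move=> Yz; apply: polyfun_leq (polyfun_exp u (polyfun_gen A 0 (YY _ Yz))); rewrite muln1 ltnW.
  have P0' : polyfunp A Y' 1 f0 by apply: polyfunp_sub P0 => y /Y12 /YY.
  apply: polyfun_add; last apply: polyfun_opp.
    apply: polyfun_mul; first by apply: polyfun_eval => //; apply: YY; left; right; exists a.
    by apply: (Pg (fun t => bet t a)); right; exists a.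
  apply: polyfun_mul; first by apply: polyfun_eval => //; apply: YY; right; exists a.
  by apply: (Pg (fun t => gam t a)); left; right; exists a.
- move=> t At a; have [sf _] := HA t At; have [_ H2 _ _] := Hbet t At.
  by rewrite colE poly_sum_coef // (H2 a k) mulrC subrr.
move=> t At; have [H1 _ _ H4] := Hbet t At.
(* The functionals evaluate at the [gam] points and at d + 1 - 2r fresh points. The r equations then
   add zeros at the [bet] points, d + 1 distinct zeros in all, too many for a nonzero polynomial of
   degree d. *)
pose L := [seq gam t a | a <- enum 'I_r] ++ [seq bet t a | a <- enum 'I_r].
have [ext [sext uext fext]] := fresh_points L (d.+1 - 2 * r).
pose pts := [seq gam t a | a <- enum 'I_r] ++ ext.
exists (fun (i : 'I_(d.+1 - r)) (u : 'I_d.+1) => (nth 0 pts i) ^+ u); move=> v kv Lv.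
pose p := \sum_(u < d.+1) v u *: 'X^u.
have Lp i : (i < d.+1 - r)%N -> p.[nth 0 pts i] = 0.
  move=> ir; rewrite -[RHS](Lv (Ordinal ir)) /p horner_sum; apply: eq_bigr => u _.
  by rewrite hornerZ hornerXn.
have spts : size pts = (d.+1 - r)%N by rewrite size_cat size_map size_enum_ord sext; lia.
have pts0 x : x \in pts -> p.[x] = 0.
  by move=> xp; rewrite -[x](nth_index 0 xp); apply: Lp; rewrite -spts index_mem.
have pg a : p.[gam t a] = 0 by apply: pts0; rewrite mem_cat map_f ?mem_enum.
have pb a : p.[bet t a] = 0.
  have := kv a; rewrite colE -/p pg mulr0 subr0 => /eqP; rewrite mulf_eq0.
  by rewrite (negPf (H1 a)) => /eqP.
have p0 : p = 0.
  apply: (@roots_geq_poly_eq0 _ p (L ++ ext)).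
  - apply/allP => x; rewrite rootE !mem_cat -orbA => /or3P[/mapP[a _ ->]|/mapP[a _ ->]|xe]; apply/eqP=> //.
    by apply: pts0; rewrite mem_cat xe orbT.
  - rewrite cat_uniq H4 uext andbT /=; apply/hasPn => x xe; exact: fext.
  rewrite (leq_trans (size_poly_sum v)) // /L !size_cat !size_map -enumT size_enum_ord sext; lia.
by move=> u; have := congr1 (fun q : {poly C} => q`_u) p0; rewrite coef_poly_sum valK coef0.
Qed.

End Multiple.

Section Dehom.
Variables (C : closedFieldType) (n d : nat) (x : 'I_(npar n d) -> C).

Lemma dehomE i : dehom x i = \sum_(u < d.+1) coefs x i (rev_ord u) *: 'X^u.
Proof.
rewrite /dehom (reindex_inj rev_ord_inj) /=; apply: eq_bigr => u _.
by rewrite subSS subKn // -ltnS.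
Qed.

Lemma coef_dehom i (u : 'I_d.+1) : (dehom x i)`_u = coefs x i (rev_ord u).
Proof. by rewrite dehomE coef_poly_sum valK. Qed.

Lemma size_dehom i : (size (dehom x i) <= d.+1)%N.
Proof. by rewrite dehomE size_poly_sum. Qed.

Lemma horner_dehom i b : (dehom x i).[b] = form_eval x i b 1.
Proof.
rewrite /dehom horner_sum; apply: eq_bigr => j _.
by rewrite hornerZ hornerXn expr1n mulr1.
Qed.

Lemma dehom_bpf : is_morphism x -> base_point_free (dehom x) d.
Proof.
move=> mx; split=> [b|].
  apply: NNPP => H; have [//|_ /eqP] := mx b 1 _; last by rewrite oner_eq0.
  move=> i; apply/eqP; rewrite -horner_dehom; apply/negPn/negP => hi; apply: H; exists i; exact: hi.
apply: NNPP => H; have [//|/eqP + _] := mx 1 0 _; last by rewrite oner_eq0.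
move=> i; rewrite /form_eval big_ord_recl expr0 !mulr1 big1 ?addr0 => [|j _]; last first.
  by rewrite expr0n /= mulr0.
rewrite expr1n mulr1; apply/eqP/negPn/negP => hi; apply: H; exists i.
have := coef_dehom i ord_max; rewrite /= => ->.
suff -> : rev_ord ord_max = ord0 :> 'I_d.+1 by [].
by apply: val_inj; rewrite /= subnn.
Qed.

Lemma dehom_indep : Defs.nondegenerate x -> indep_mod (fun p => p = 0) (dehom x).
Proof.
move=> nx a H; apply: nx => j.
have := congr1 (fun p : {poly C} => p`_(rev_ord j)) H; rewrite coef0 coef_sum => E.
rewrite -[RHS]E; apply: eq_bigr => i _.
by rewrite coefZ coef_dehom rev_ordK.
Qed.

End Dehom.

(** * The Wronskian in characteristic zero *)

Section Wronskian.
Variable C : closedFieldType.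
Hypothesis charC0 : [pchar C] =i pred0.

Lemma natr_neq0 k : (k.+1%:R : C) != 0.
Proof. by have /pcharf0P -> := charC0. Qed.

Lemma size_deriv0 (p : {poly C}) : size p^`() = (size p).-1.
Proof.
case E: (size p) => [|[|k]] /=.
- by move/eqP: E; rewrite size_poly_eq0 => /eqP ->; rewrite deriv0 size_poly0.
- by have [c _ ->] := size_poly1P p (introT eqP E); rewrite derivC size_poly0.
have := lt_size_deriv (p := p); rewrite -size_poly_eq0 E ltnS => /(_ isT) le.
apply/eqP; rewrite eqn_leq le ltnNge; apply/negP => le'.
have := coef_deriv p k; rewrite nth_default // => /esym/eqP.
rewrite -mulr_natr mulf_eq0 (negPf (natr_neq0 _)) orbF.
by have := lead_coef_eq0 p; rewrite lead_coefE E /= => ->; rewrite -size_poly_eq0 E.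
Qed.

Lemma lead_coef_deriv0 (p : {poly C}) : (1 < size p)%N ->
  lead_coef p^`() = lead_coef p *+ (size p).-1.
Proof.
move=> p1; rewrite !lead_coefE size_deriv0 coef_deriv; congr (_`_ _ *+ _); lia.
Qed.

Lemma deriv_eq0 (p : {poly C}) : (p^`() == 0) = (size p <= 1)%N.
Proof. by rewrite -size_poly_eq0 size_deriv0; case: (size p) => [|[]]. Qed.

Lemma wronskian_size (p q : {poly C}) : p != 0 -> q != 0 -> p * q^`() = p^`() * q -> size p = size q.
Proof.
move=> p0 q0 W; have := congr1 lead_coef W; rewrite !lead_coefM.
have s1 (r : {poly C}) : r != 0 -> (size r <= 1)%N -> size r = 1.
  by rewrite -size_poly_gt0; case: (size r) => [|[]].
case: (leqP (size p) 1) => p1.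
  move: W; have /eqP -> : p^`() == 0 by rewrite deriv_eq0.
  by move/eqP; rewrite mul0r mulf_eq0 (negPf p0) /= deriv_eq0 => q1 _; rewrite (s1 p) // (s1 q).
case: (leqP (size q) 1) => q1.
  move: W; have /eqP -> : q^`() == 0 by rewrite deriv_eq0.
  by move/eqP; rewrite mulr0 eq_sym mulf_eq0 (negPf q0) orbF deriv_eq0 => p1' _; rewrite (s1 p) // (s1 q).
rewrite !lead_coef_deriv0 // mulrnAl mulrnAr => /eqP.
rewrite -[_ *+ (size q).-1]mulr_natr -[_ *+ (size p).-1]mulr_natr => /eqP H.
have lpq : lead_coef p * lead_coef q != 0 by rewrite mulf_neq0 // lead_coef_eq0.
move/(mulfI lpq): H => H.
wlog le : p q p0 q0 W p1 q1 lpq H / (size p <= size q)%N.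
  move=> WH; have [le|/ltnW le] := leqP (size p) (size q); first exact: WH.
  by apply/esym/WH => //; [rewrite mulrC -W mulrC|rewrite mulrC].
have [k E] : exists k, ((size q).-1 = (size p).-1 + k)%N by exists ((size q).-1 - (size p).-1)%N; lia.
case: k E => [|k] E; first by lia.
move/eqP: H; rewrite E natrD -subr_eq0 addrAC subrr add0r => /eqP H.
by have := natr_neq0 k; rewrite H eqxx.
Qed.

(** A vanishing Wronskian forces equal degrees, by comparing leading coefficients. Subtracting from
    [q] the multiple of [p] that cancels its leading term keeps the Wronskian zero but lowers the
    degree. *)
Lemma wronskian_neq0 (p q : {poly C}) :
  (forall a b : C, a *: p + b *: q = 0 -> a = 0 /\ b = 0) -> p * q^`() - p^`() * q != 0.
Proof.
move=> ind; apply/negP; rewrite subr_eq0 => /eqP W.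
have p0 : p != 0.
  by apply/eqP=> E; have [] := ind 1 0; rewrite ?E ?scaler0 ?scale0r ?addr0 // => /eqP; rewrite oner_eq0.
have q0 : q != 0.
  by apply/eqP=> E; have [] := ind 0 1; rewrite ?E ?scaler0 ?scale0r ?addr0 // => _ /eqP; rewrite oner_eq0.
have spq := wronskian_size p0 q0 W.
pose a := lead_coef q / lead_coef p; pose r := q - a *: p.
have r0 : r != 0.
  apply/eqP=> E; have [] := ind (- a) 1; first by rewrite scale1r scaleNr addrC.
  by move=> _ /eqP; rewrite oner_eq0.
have Wr : p * r^`() = p^`() * r.
  rewrite /r derivB derivZ !mulrBr W; congr (_ - _).
  by rewrite -!scalerAr mulrC.
have spr := wronskian_size p0 r0 Wr.
have : (size r < size p)%N; last by rewrite spr ltnn.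
have lp : lead_coef p != 0 by rewrite lead_coef_eq0.
have sp : (0 < size p)%N by rewrite size_poly_gt0.
rewrite -(prednK sp) ltnS; apply/leq_sizeP => j; rewrite leq_eqVlt => /predU1P[<-|lt].
  by rewrite coefB coefZ -lead_coefE /a divfK // spq -lead_coefE subrr.
by rewrite coefB coefZ !nth_default ?mulr0 ?subrr // -?spq -(prednK sp).
Qed.

End Wronskian.

Lemma ncofinite_imp (C : closedFieldType) m (Z Z' : seq C -> Prop) :
  (forall l, size l = m -> Z l -> Z' l) -> ncofinite m Z -> ncofinite m Z'.
Proof.
elim: m Z Z' => [|m IH] Z Z' H /=; first exact: H.
by apply: cofinite_imp => s; apply: IH => l sl; apply: H; rewrite /= sl.
Qed.

Lemma ncofinite_pairwise (C : closedFieldType) (R : rel C) r (S : C -> Prop) : cofinite S ->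
  (forall x, S x -> cofinite (R x)) ->
  ncofinite r (fun l => (forall x, x \in l -> S x) /\ pairwise R l).
Proof.
elim: r S => [|r IH] S cS cR /=; first by split.
apply: cofinite_imp (cS) => s Ss.
have := IH (fun x => S x /\ R s x) (cofinite_and cS (cR s Ss)) (fun x Sx => cR x Sx.1).
apply: ncofinite_imp => l _ [Sl Rl]; split.
  by move=> x; rewrite inE => /predU1P[->|/Sl[]].
by rewrite /= Rl andbT; apply/allP => x /Sl[].
Qed.

(** * Partners of generic points *)

Section Nonbirational.
Variables (C : closedFieldType) (n d : nat) (f : 'I_n.+1 -> {poly C}).
Hypothesis charC0 : [pchar C] =i pred0.
Hypotheses (n0 : (0 < n)%N) (d0 : (0 < d)%N) (bf : base_point_free f d).
Hypothesis sf : forall i, (size (f i) <= d.+1)%N.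
Hypothesis fi : indep_mod (fun p => p = 0) f.
Hypothesis nogood : forall g, ~ good f d g.

Let k1 : 'I_n.+1 := inord 1.

Lemma indep_pair k l (a b : C) : k != l -> a *: f k + b *: f l = 0 -> a = 0 /\ b = 0.
Proof.
move=> kl E; pose c i := if i == k then a else if i == l then b else 0.
have H : \sum_i c i *: f i = 0.
  rewrite (bigD1 k) //= (bigD1 l) 1?eq_sym //= big1 => [|i /andP[ik il]].
    by rewrite /c eqxx eq_sym (negPf kl) eqxx addr0.
  by rewrite /c (negPf ik) (negPf il) scale0r.
have := fi H k; have := fi H l; rewrite /c eqxx eq_sym (negPf kl) eqxx; by split.
Qed.

Let n01 : ord0 != k1. Proof. by rewrite -val_eqE /= inordK. Qed.

Definition meets_again (g : C) := (f ord0).[g] != 0 /\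
  exists b, b != g /\ forall k, (f ord0).[g] * (f k).[b] = (f k).[g] * (f ord0).[b].

(** As [g] is not good, all sections through its image share another zero once [g] is divided out.
    For generic [g] this zero is not [g], where the Wronskian would vanish, and not infinity. *)
Lemma cofinite_meets_again : cofinite meets_again.
Proof.
have f00 : f ord0 != 0.
  apply/eqP=> E; have [] := @indep_pair ord0 k1 1 0 n01; first by rewrite E scaler0 scale0r addr0.
  by move/eqP; rewrite oner_eq0.
pose W := f ord0 * (f k1)^`() - (f ord0)^`() * f k1.
have W0 : W != 0 by apply: (wronskian_neq0 charC0) => a b; apply: indep_pair.
(* Coefficients of index [d] are values at infinity; a nonzero value of this polynomial at [g] means
   that [g] and infinity have different images. *)
have [k H0] : exists k, (f k)`_d *: f ord0 - (f ord0)`_d *: f k != 0.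
  have [k hk] := bf.2; case: (eqVneq k ord0) hk => [->|k0] hk.
    exists k1; apply/eqP=> E; have [|_] := @indep_pair ord0 k1 (f k1)`_d (- (f ord0)`_d) n01.
      by rewrite scaleNr.
    by move/eqP; rewrite oppr_eq0 (negPf hk).
  exists k; apply/eqP=> E; have [||] := @indep_pair ord0 k (f k)`_d (- (f ord0)`_d).
  - by rewrite eq_sym.
  - by rewrite scaleNr.
  by move/eqP; rewrite (negPf hk).
apply: cofinite_imp (cofinite_and (cofinite_poly f00) (cofinite_and (cofinite_poly W0) (cofinite_poly H0))).
move=> g [g0 [Wg Hg]]; split=> //.
have G l : graded f 1 (('X - g%:P) * through f g (f ord0) l).
  by apply: through_graded; apply: graded_gen.
have [[b Hb]|H] := classic (exists b, forall l, (through f g (f ord0) l).[b] = 0).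
  have E l : (f ord0).[g] * (f l).[b] = (f l).[g] * (f ord0).[b].
    have := congr1 (fun p : {poly C} => p.[b]) (throughE f g (f ord0) l).
    rewrite hornerM Hb mulr0 hornerD hornerN !hornerZ => /esym/eqP.
    by rewrite subr_eq0 => /eqP.
  exists b; split=> //; apply/eqP=> bg; subst b.
  have := congr1 (fun p : {poly C} => (p^`()).[g]) (throughE f g (f ord0) k1).
  rewrite /= derivM derivXsubC mul1r derivB !derivZ hornerD hornerM hornerXsubC Hb subrr mul0r addr0.
  rewrite hornerD hornerN !hornerZ => /esym E'.
  move/eqP: Wg; apply; rewrite /W hornerD hornerN !hornerM -[RHS]E'; congr (_ - _); exact: mulrC.
case: (nogood (g := g)); split=> [b|].
  apply: NNPP => H'; apply: H; exists b => l; apply/eqP/negPn/negP => h.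
  by apply: H'; exists (through f g (f ord0) l).
exists (through f g (f ord0) k); split=> //; apply/eqP => h.
have := congr1 (fun p : {poly C} => p`_d) (throughE f g (f ord0) k).
have st : (size (through f g (f ord0) k) <= d)%N.
  apply: (@size_factor _ d g); rewrite throughE.
  by apply: (linpredB (linpred_size C d.+1)); rewrite (leq_trans (size_scale_leq _ _)).
rewrite mulrBl coefB coefXM coefCM (negPf (lt0n_neq0 d0)) h (nth_default _ st) mulr0 subr0.
rewrite coefB !coefZ => /esym/eqP E; move/negP: Hg; apply.
by rewrite hornerD hornerN !hornerZ mulrC [X in _ - X]mulrC.
Qed.

(** [R] says that two points are separated by the first two coordinates. Successive generic points
    are pairwise separated, so their fibres are disjoint and the 2r points are distinct. *)
Lemma ncofinite_multiple r :
  ncofinite r (fun l => exists bet, multiple_at f (fun a : 'I_r => nth 0 l a) bet).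
Proof.
pose R (g g' : C) := (f ord0).[g] * (f k1).[g'] - (f k1).[g] * (f ord0).[g'] != 0.
have PP g : (f ord0).[g] != 0 -> (f ord0).[g] *: f k1 - (f k1).[g] *: f ord0 != 0.
  move=> g0; apply/eqP=> E; have [|_] := @indep_pair ord0 k1 (- (f k1).[g]) (f ord0).[g] n01.
    by rewrite scaleNr addrC.
  by move/eqP; rewrite (negPf g0).
have cR g : meets_again g -> cofinite (R g).
  move=> [g0 _]; apply: cofinite_imp (cofinite_poly (PP g g0)) => g'.
  by rewrite hornerD hornerN !hornerZ.
apply: ncofinite_imp (ncofinite_pairwise r cofinite_meets_again cR) => l sl [Sl Rl].
have Sa (a : 'I_r) : meets_again (nth 0 l a) by apply/Sl/mem_nth; rewrite sl.
have [bet Hb] : exists bet : 'I_r -> C, forall a, True -> bet a != nth 0 l a /\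
    forall k, (f ord0).[nth 0 l a] * (f k).[bet a] = (f k).[nth 0 l a] * (f ord0).[bet a].
  apply: (@choose_on _ _ (fun=> True) (fun (a : 'I_r) b => b != nth 0 l a /\
    forall k, (f ord0).[nth 0 l a] * (f k).[b] = (f k).[nth 0 l a] * (f ord0).[b]) 0) => a _.
  by have [_] := Sa a.
exists bet; split.
- by move=> a; have [] := Sa a.
- by move=> a; have [] := Hb a I.
- by move=> a; apply: PP; have [] := Sa a.
have Rab (a b : 'I_r) : a != b -> R (nth 0 l a) (nth 0 l b).
  have R_sym g g' : R g g' = R g' g.
    by rewrite /R -oppr_eq0 opprB [X in X - _]mulrC [X in _ - X]mulrC.
  wlog lt : a b / (a < b)%N.
    move=> WH ab; have [lt|lt|/val_inj E] := ltngtP a b; first exact: WH.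
      by rewrite R_sym; apply: WH; rewrite // eq_sym.
    by rewrite E eqxx in ab.
  by move=> _; apply: (pairwiseP 0 Rl); rewrite ?inE ?sl.
have Rirr g g' : R g g' -> g != g' by apply: contraTneq => ->; rewrite /R mulrC subrr eqxx.
have fb a : (f ord0).[bet a] != 0.
  apply/eqP=> E; have [_ H] := Hb a I; have [g0 _] := Sa a.
  have [k] := bf.1 (bet a); have /eqP := H k; rewrite E mulr0 mulf_eq0 (negPf g0) /=.
  by move=> ->.
have gb (a b : 'I_r) : nth 0 l a != bet b.
  have [->|ab] := eqVneq a b; first by have [] := Hb b I; rewrite eq_sym.
  apply/eqP=> E; have [_ /(_ k1)] := Hb b I; rewrite -E => /eqP; rewrite -subr_eq0.
  by apply/negP; apply: Rab; rewrite eq_sym.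
have bb a b : a != b -> bet a != bet b.
  move=> ab; apply/eqP=> E; have [_ /(_ k1) H1] := Hb a I; have [_ /(_ k1)] := Hb b I; rewrite -E => H2.
  have := Rab a b ab; rewrite /R; apply/negP/negPn; rewrite subr_eq0; apply/eqP.
  apply: (mulIf (fb a)).
  by rewrite -mulrA -H2 mulrCA H1; ring.
rewrite cat_uniq; apply/and3P; split.
- rewrite map_inj_uniq ?enum_uniq // => a b E.
  by apply/eqP/negPn/negP => /Rab/Rirr; rewrite E eqxx.
- by apply/hasPn => _ /mapP[b _ ->]; apply/mapP => -[a _ E]; have := gb a b; rewrite E eqxx.
rewrite map_inj_uniq ?enum_uniq // => a b E.
by apply/eqP/negPn/negP => /bb; rewrite E eqxx.
Qed.

End Nonbirational.

Section NonbirationalDimension.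
Variable C : closedFieldType.

Lemma growth_lift n d m (A : ('I_(npar n d) -> C) * seq C -> Prop) Y D : growth A Y D ->
  (forall k y, coefs_of (fun t : ('I_(npar n d) -> C) * seq C => dehom t.1 k) d.+1 y -> Y y) ->
  (forall k : 'I_m, Y (fun t => nth 0 t.2 k)) ->
  growth A (@lift_coord C (npar n d) m) D.
Proof.
move=> gY Yf Ys; apply: (growth_comp (k := 1) _ gY) => y [[i ->]|[k ->]]; last exact: polyfun_gen.
case/mxvec_indexP: i => i j.
apply: (@polyfun_ext _ _ _ _ _ (fun t => (dehom t.1 i)`_(rev_ord j))) => [|t _].
  by apply: polyfun_gen; apply: (Yf i); exists (rev_ord j).
by rewrite coef_dehom rev_ordK.
Qed.

(** For n = d the coordinates span all forms of degree d: the curve is a rational normal curve, and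
    every point is good. *)
Lemma full_good n (f : 'I_n.+1 -> {poly C}) d g : (0 < d)%N -> (forall i, size (f i) <= d.+1)%N ->
  indep_mod (fun p => p = 0) f -> n = d -> good f d g.
Proof.
move=> d0 sf fi nd; have L0 := @linpred_eq0 C {poly C}.
have full (p : {poly C}) : (size p <= d.+1)%N -> graded f 1 p.
  move=> sp; apply/graded1P; apply: NNPP => H.
  have ns : ~ span_mod (fun p => p = 0) f p.
    by move=> [a /eqP]; rewrite subr_eq0 => /eqP E; apply: H; exists a.
  have [_ _ Bs] := @basis_forms C d.+1.
  have := indep_le_span L0 (indep_extend_fam L0 fi ns) (v := fun i : 'I_d.+1 => 'X^i : {poly C}).
  have Hs i : span_mod (fun p : {poly C} => p = 0) (fun i : 'I_d.+1 => 'X^i) (extend_fam f p i).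
    by apply: Bs; rewrite /extend_fam; case: unlift => [j|].
  by move/(_ Hs); rewrite nd ltnn.
split=> [b|].
  exists 1; rewrite hornerC oner_eq0 mulr1; split=> //; apply: full.
  by rewrite size_XsubC.
exists 'X^(d.-1); rewrite coefXn eqxx oner_eq0; split=> //; apply: full.
by rewrite size_Mmonic ?monicXn ?polyXsubC_eq0 // size_XsubC size_polyXn; lia.
Qed.

Lemma alg_dep_multiple n d g (charC0 : [pchar C] =i pred0) : (2 < n)%N -> (g <= 4)%N -> (n <= d)%N ->
  (2 * g - 2 <= d)%N ->
  alg_dep (fun x : 'I_(npar n d) -> C => Mnd x /\ forall c, ~ good (dehom x) d c)
    (npar n d - (n - 2) * g).
Proof.
move=> n3 g4 nd gd; have [E|nd'] := eqVneq n d.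
  apply: (@alg_dep_sub _ _ _ (fun=> False)); last by move=> p; exists 1; split=> //; apply/eqP; rewrite oner_eq0.
  move=> x [[_ nx] H]; apply: (H 0); apply: full_good E; first by lia.
    exact: size_dehom.
  exact: dehom_indep.
pose r := d.+1./2.
have r2 : (2 * r <= d.+1)%N by rewrite /r mul2n -[leqRHS]odd_double_half leq_addl.
pose A (t : ('I_(npar n d) -> C) * seq C) :=
  exists bet, multiple_at (dehom t.1) (fun a : 'I_r => nth 0 t.2 a) bet.
apply: (@alg_dep_lift _ _ _ _ r A).
  have g1 := @growth_multiple C (('I_(npar n d) -> C) * seq C) d A n (fun t => dehom t.1) r
    (fun t a => nth 0 t.2 a) _ r2 _.
  apply: growth_leq (growth_lift (g1 _ _) _ _).
  (* From d >= 2g - 2, r >= g - 1. If r = g - 1, then d <= 2r and n < d give n - 2 <= 2r - 3, which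
     is at most r because r <= 3; this makes up for the missing unit. *)
  - have R : ((n - 2) * g <= (n - 1) * r)%N.
      have [gr|gr] := leqP g r; first by rewrite leq_mul //; lia.
      have [E n2] : g = r.+1 /\ (n - 2 <= r)%N by rewrite /r; lia.
      have -> : (n - 1 = (n - 2).+1)%N by lia.
      by rewrite E mulnS mulSn leq_add2r.
    have rB : ((n - 1) * r <= (n - 1) * d.+1)%N by rewrite leq_mul2l; apply/orP; right; lia.
    have -> : npar n d = (2 * d.+1 + (n - 1) * d.+1)%N by rewrite /npar -mulnDl; congr (_ * _)%N; lia.
    rewrite mulnBr; move: R rB; move: (_ * g)%N (_ * r)%N (_ * d.+1)%N (2 * _)%N; lia.
  - lia.
  - by move=> t At; split=> // k; apply: size_dehom.
  - by move=> k y Hy; left; exists k.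
  by move=> k; right; exists k.
move=> x [[mx nx] ng].
have n0 : (0 < n)%N by lia.
have d0 : (0 < d)%N by lia.
exact: (ncofinite_multiple charC0 n0 d0 (dehom_bpf mx) (@size_dehom _ _ _ x) (dehom_indep nx) ng).
Qed.

End NonbirationalDimension.

(** * Density of nondegenerate morphisms *)

Section Density.
Variable C : closedFieldType.

Lemma horner_mmap r (h : 'I_r -> {poly C}) (p : {mpoly C[r]}) t :
  (mmap (@polyC C) h p).[t] = p.@[fun i => (h i).[t]].
Proof.
rewrite mevalE /mmap horner_sum; apply: eq_bigr => m _.
rewrite hornerM hornerC /mmap1 horner_prod; congr (_ * _).
by apply: eq_bigr => i _; rewrite horner_exp.
Qed.

(** On each line of direction [x0], a polynomial vanishing on [S] has cofinitely many zeros, so it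
    vanishes on the line. *)
Lemma dense_on_lines N (S : ('I_N -> C) -> Prop) (x0 : 'I_N -> C) :
  (forall v, cofinite (fun t => S (fun i => v i + t * x0 i))) ->
  forall p : {mpoly C[N]}, vanishing_ideal S p -> p = 0.
Proof.
move=> H p Sp; apply: mpoly_nonvanish => v.
pose P := mmap (@polyC C) (fun i => (v i)%:P + x0 i *: 'X) p.
have PE t : P.[t] = p.@[fun i => v i + t * x0 i].
  by rewrite horner_mmap; apply: meval_eq => i; rewrite hornerD hornerC hornerZ hornerX mulrC.
have P0 : P = 0 by apply: cofinite_poly0; apply: cofinite_imp (H v) => t /Sp; rewrite PE.
have := PE 0; rewrite P0 horner0 => /esym E; rewrite -[RHS]E.
by apply: meval_eq => i; rewrite mul0r addr0.
Qed.

Variables (n d : nat).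
Hypotheses (n0 : (0 < n)%N) (nd : (n <= d)%N).

Let idx (i : 'I_n.+1) : 'I_d.+1 := if (i < n)%N then inord i else ord_max.
(** The direction of the lines: distinct monomials, starting with t^d and ending with u^d, hence a
    nondegenerate morphism. *)
Definition monomial_tuple (k : 'I_(npar n d)) : C := mxvec (\matrix_(i < n.+1, j < d.+1) (j == idx i)%:R) 0 k.

Let idx_inj : injective idx.
Proof.
have idxE (i : 'I_n.+1) : idx i = (if i < n then (i : nat) else d)%N :> nat.
  by rewrite /idx; case: ltnP => // lt; rewrite inordK // ltnS (leq_trans (ltnW lt)).
move=> i j /(congr1 val) /=; rewrite !idxE => E; apply: val_inj.
have := ltn_ord i; have := ltn_ord j; move: E; case: ltnP => hi; case: ltnP => hj; move=> /= E; lia.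
Qed.

Variable v : 'I_(npar n d) -> C.
Let xt t (k : 'I_(npar n d)) := v k + t * monomial_tuple k.

Let coefs_xt t i j : coefs (xt t) i j = coefs v i j + t * (j == idx i)%:R.
Proof. by rewrite /coefs /xt /monomial_tuple mxvecE mxE. Qed.

Let dehom_xt t i : dehom (xt t) i = dehom v i + t *: 'X^(d - idx i).
Proof.
rewrite /dehom; transitivity (\sum_(j < d.+1) (coefs v i j *: 'X^(d - j) + (t * (j == idx i)%:R) *: 'X^(d - j)) : {poly C}).
  by apply: eq_bigr => j _; rewrite coefs_xt scalerDl.
rewrite big_split /=; congr (_ + _); rewrite (bigD1 (idx i)) //= big1 => [|j ji].
  by rewrite eqxx mulr1 addr0.
by rewrite (negPf ji) mulr0 scale0r.
Qed.

(** On the columns [idx k] the coefficient matrix is [V] plus [t] times the identity, which is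
    singular only when [t] is an eigenvalue of [- V]. *)
Lemma cofinite_nondegenerate : cofinite (fun t => Defs.nondegenerate (xt t)).
Proof.
pose V : 'M[C]_n.+1 := \matrix_(i, k) coefs v i (idx k).
apply: cofinite_imp (cofinite_poly (monic_neq0 (char_poly_monic (- V)))) => t ht lam H.
suff /rowP E : \row_i lam i = 0 by move=> i; have := E i; rewrite !mxE.
apply/eqP/negPn/negP => l0; move/negP: ht; apply.
rewrite -[_ == 0]/(root _ _) -eigenvalue_root_char; apply/eigenvalueP; exists (\row_i lam i) => //.
apply/rowP => k; rewrite mulmxN !mxE; apply/esym/eqP; rewrite -addr_eq0; apply/eqP.
rewrite -[RHS](H (idx k)).
transitivity (\sum_i (lam i * coefs v i (idx k) + lam i * (t * (idx k == idx i)%:R))); last first.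
  by apply: eq_bigr => i _; rewrite coefs_xt mulrDr.
rewrite big_split /= addrC; congr (_ + _); last by apply: eq_bigr => i _; rewrite !mxE.
rewrite (bigD1 k) //= eqxx mulr1 big1 ?addr0 1?mulrC // => i ik.
by rewrite (inj_eq idx_inj) eq_sym (negPf ik) !mulr0.
Qed.

Lemma form_eval_dehom (x : 'I_(npar n d) -> C) i a b : b != 0 ->
  form_eval x i a b = b ^+ d * (dehom x i).[a / b].
Proof.
move=> b0; rewrite /dehom horner_sum mulr_sumr; apply: eq_bigr => j _.
rewrite hornerZ hornerXn expr_div_n.
have -> : b ^+ d = b ^+ (d - j) * b ^+ j by rewrite -exprD subnK // -ltnS.
have := expf_neq0 (d - j) b0.
by move: (b ^+ (d - j)) => z z0; field.
Qed.

(** Eliminating [t] between the first and last forms, a finite common zero is a root of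
    [F0 - Fn * 'X^d]. Each root excludes one [t]; if that polynomial is zero, [Fn] is constant and
    one [t] is excluded. Infinity excludes one more. *)
Lemma cofinite_morphism : cofinite (fun t => is_morphism (xt t)).
Proof.
have i0 : idx ord0 = ord0 by rewrite /idx /= n0; apply: val_inj; rewrite /= inordK.
have i1 : idx ord_max = ord_max by rewrite /idx /= ltnn.
pose F0 := dehom v ord0; pose Fn := dehom v ord_max.
have c1 : cofinite (fun t => forall z, F0.[z] + t * z ^+ d = 0 -> Fn.[z] + t = 0 -> False).
  have [G0|G0] := eqVneq (F0 - Fn * 'X^d) 0.
    have sF : (size Fn <= 1)%N.
      have [->|Fn0] := eqVneq Fn 0; first by rewrite size_poly0.
      have := size_dehom v ord0; rewrite -/F0 (subr0_eq G0) size_mulXn //.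
      by rewrite -[X in (_ <= X)%N]addn1 leq_add2l.
    apply: cofinite_imp (cofinite_neq (- Fn`_0)) => t ht z _ /eqP.
    rewrite [Fn]size1_polyC // hornerC addrC addr_eq0 => /eqP E; apply: ht; rewrite E.
    by rewrite ?coefC.
  have [rs E] := closed_field_poly_normal (F0 - Fn * 'X^d).
  apply: cofinite_imp (@cofinite_all _ _ rs (fun z t => t <> - Fn.[z]) _) => [t ht z h0 hn|z _].
    have tE : t = - Fn.[z] by apply/eqP; rewrite -addr_eq0 addrC hn.
    apply: (ht z) => //; rewrite -root_prod_XsubC -(rootZ _ _ (a := lead_coef (F0 - Fn * 'X^d))) ?lead_coef_eq0 //.
    by rewrite -E rootE hornerD hornerN hornerM hornerXn -mulNr -tE h0.
  exact: cofinite_neq.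
apply: cofinite_imp (cofinite_and c1 (cofinite_neq (- coefs v ord0 ord0))) => t [h1 h2] a b H.
have [b0|b0] := eqVneq b 0.
  split=> //; have := H ord0; rewrite b0 /form_eval big_ord_recl big1 => [|j _]; last first.
    by rewrite expr0n /= mulr0.
  rewrite addr0 mulr1 subn0 coefs_xt i0 eqxx mulr1 => /eqP.
  rewrite mulf_eq0 addr_eq0 => /orP[/eqP E|]; last by rewrite expf_eq0 => /andP[_ /eqP].
  by case: h2; rewrite E opprK.
case: (h1 (a / b)).
  have := H ord0; rewrite form_eval_dehom // dehom_xt i0 hornerD hornerZ hornerXn subn0 => /eqP.
  by rewrite mulf_eq0 expf_eq0 (negPf b0) andbF => /eqP.
have := H ord_max; rewrite form_eval_dehom // dehom_xt i1 hornerD hornerZ hornerXn subnn mulr1 => /eqP.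
by rewrite mulf_eq0 expf_eq0 (negPf b0) andbF => /eqP.
Qed.

End Density.

Lemma dim_ge_Mnd (C : closedFieldType) n d : (0 < n)%N -> (n <= d)%N ->
  dim_ge (@Mnd C n d) (npar n d).
Proof.
move=> n0 nd; apply: dim_ge_full; apply: (dense_on_lines (x0 := @monomial_tuple C n d)) => v.
exact: cofinite_and (cofinite_morphism n0 v) (cofinite_nondegenerate n0 nd v).
Qed.

(** * Curves with a conductor *)

Section ConductorPackage.
Variables (C : closedFieldType) (k d : nat) (f : 'I_k -> {poly C}).
Hypotheses (d0 : (0 < d)%N) (sf : forall i, (size (f i) <= d.+1)%N).
Hypothesis bf : base_point_free f d.

(** What the sequel uses of a minimal conductor, made monic. The last clause bounds by [b] every
    graded piece modulo [c], in small degrees too. *)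
Definition curve_conductor b g c :=
  [/\ c \is monic, (size c <= (b + g).+1)%N, (b <= g)%N,
      (forall P : {poly C}, P != 0 -> conductor f d (d.+1 * d) P d.+2 -> c %| P) &
      forall m l (v : 'I_l -> {poly C}), (forall i, graded f m (v i)) ->
        indep_mod (fdvd c (b + g) (m * d)) v -> (l <= b)%N].

Lemma min_conductor_scale e c a : a != 0 -> min_conductor d f e c -> min_conductor d f e (a *: c).
Proof.
move=> a0 [c0 sc [m [em cm]] H]; split=> //; last 1 first.
- exists m; split=> // r sr; rewrite -scalerAl; apply: linpredZ (linpred_graded f m) _; exact: cm.
- by rewrite scaler_eq0 negb_or a0.
by rewrite size_scale.
Qed.

Lemma ex_curve_conductor hh g g0 :
  good f d g0 ->
  (forall m, exists v : 'I_(hh m) -> {poly C}, basis_mod (fun p => p = 0) (graded f m) v) ->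
  (exists a : int, exists m0 : nat, forall m, (m0 <= m)%N -> (hh m)%:Z = a * m%:Z + 1 - g%:Z) ->
  exists b c, curve_conductor b g c.
Proof.
move=> gd hb hg; have [D [D0 cD]] := good_conductor d0 sf bf gd.
have de : (d.+1 * d <= d.+2 * d)%N by rewrite leq_mul2r orbC leqnSn.
have de' : (d.+1 * d + d <= (d.+2 * d).+1)%N by rewrite mulSn addnC leqnSn.
have [e [c1 mc1]] : exists e c, min_conductor d f e c.
  apply: ex_min_conductor; exists (d.+1 * d)%N, D, d.+2; split=> //.
  exact: conductor_size cD.
have [c10 _ _ _] := mc1.
have l0 : (lead_coef c1)^-1 != 0 by rewrite invr_eq0 lead_coef_eq0.
have := min_conductor_scale l0 mc1; set c := _ *: c1 => mc.
have [c0 sc _ _] := mc.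
have [b [m1 [eE H]]] := conductor_dims d0 sf bf hb hg mc.
exists b, c; subst e; split=> //.
- by rewrite monicE lead_coefZ mulVf // lead_coef_eq0.
- have [h1 h2 h3 h4] := H m1 (leqnn _).
  have [_ h5 _ _] := H (2 * m1)%N (leq_pmull m1 (isT : 0 < 2)%N).
  by apply: (conductor_duality d0 sf mc h1 h2 h5) => //; exists (hh (2 * m1)%N).
- move=> P P0 cP; apply: (min_conductor_dvd d0 sf bf mc P0 _ de' cP).
  exact: conductor_size cP.
move=> m l v gv iv.
(* Multiplication by a form without common zero with [c] is injective modulo [c]; powers of it carry
   degree [m] into the large degrees where the dimension is exactly [b]. *)
have [s [sh ch]] := cofinite_ex (moment_coprime (b + g) bf sf c0).
set h := moment f s in sh ch; have gh : graded f 1 h by apply: graded1_moment.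
pose M := maxn m m1; pose j := (M - m)%N.
have mM : (j + m = M)%N by rewrite subnK // leq_maxl.
have [_ _ [w [_ _ sw]] _] := H M (leq_maxr _ _).
have iw : indep_mod (fdvd c (b + g) (M * d)) (fun i => h ^+ j * v i).
  move=> a Ha i; apply: iv; apply: (fdvd_cancel_exp c0 sc (_ : size h <= d.+1)%N ch (j := j)).
  - by rewrite sh.
  - apply: (size_graded sf (m := m)); apply: linpred_sum (linpred_graded f m) _ => i' _.
    exact: linpredZ (linpred_graded f m) (gv i').
  rewrite [X in fdvd _ _ X _](_ : _ = M * d)%N; last by rewrite -mM mulnDl addnC.
  rewrite [X in fdvd _ _ _ X](_ : _ = \sum_i' a i' *: (h ^+ j * v i')) //.
  by rewrite mulr_sumr; apply: eq_bigr => i' _; rewrite scalerAr.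
apply: (indep_le_span (linpred_fdvd c (b + g) (M * d)) iw) => i; apply: sw.
by rewrite -mM; apply: gradedM => //; apply: graded_exp.
Qed.

End ConductorPackage.

(** The gcd of two squares is the square of the gcd. *)
Lemma dvdp_sq_gcd (F : fieldType) (c a b : {poly F}) : c %| a * a -> c %| b * b ->
  c %| gcdp a b * gcdp a b.
Proof.
move=> ca cb; have [/eqP|G0] := eqVneq (gcdp a b) 0; first by rewrite gcdp_eq0 => /andP[/eqP-> /eqP->]; rewrite gcd0p mulr0 dvdp0.
set G := gcdp a b in G0 *.
have Ga : a = a %/ G * G by rewrite divpK // dvdp_gcdl.
have Gb : b = b %/ G * G by rewrite divpK // dvdp_gcdr.
have co : coprimep (a %/ G) (b %/ G) by apply: coprimep_div_gcd; rewrite -negb_and -gcdp_eq0.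
set a' := a %/ G in Ga co; set b' := b %/ G in Gb co.
have co2 : gcdp (a' * a') (b' * b') %= 1.
  by rewrite gcdp_eqp1 coprimepMl !coprimepMr co.
have : c %| gcdp (G * G * (a' * a')) (G * G * (b' * b')).
  rewrite dvdp_gcd; apply/andP; split.
    by rewrite (_ : _ * _ = a * a) // Ga; ring.
  by rewrite (_ : _ * _ = b * b) // Gb; ring.
by rewrite (eqp_dvdr _ (gcdp_mul2l _ _ _)) (eqp_dvdr _ (eqp_mull _ co2)) mulr1.
Qed.

Lemma fresh_index n (l : seq 'I_n.+1) : (size l <= n)%N -> exists p, p \notin l.
Proof.
move=> sl; apply: NNPP => H; have : (n.+1 <= size l)%N; last by rewrite ltnNge sl.
rewrite -[X in (X <= _)%N](size_enum_ord n.+1); apply: uniq_leq_size => [|p _]; first exact: enum_uniq.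
by apply/negPn/negP => pl; apply: H; exists p.
Qed.

(** All data quantified here are discrete and bounded in terms of n and d, so the family is a finite
    union of sets counted by [growth_planar]. *)
Definition planar_type (C : closedFieldType) n d g (f : 'I_n.+1 -> {poly C}) (s0 s2 : C) :=
  exists (i j p q : 'I_n.+1) (kap : 'I_3) e e' b (sel : 'I_b -> 'I_3 * 'I_3),
  [/\ uniq [:: i; j; p; q], (e' <= e)%N && (e <= d.+1)%N, (b + g <= e)%N,
      s0 ^+ p * s2 ^+ q - s0 ^+ q * s2 ^+ p != 0 &
      planar_at d f s0 s2 (f i + kap%:R *: f j) e e' sel].

Definition quad_type (C : closedFieldType) n d g (f : 'I_n.+1 -> {poly C}) (s0 : C) :=
  exists (ii : 'I_3 -> 'I_n.+1) sg sg' e' (phi : 'I_e' -> 'I_sg'),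
  [/\ injective ii, (4 <= sg <= d)%N && (sg' <= sg)%N, [&& e' <= d.+1, g == 4 & 8 <= d.+1]%N, s0 != 0 &
      quad_at d f (moment f s0) ii sg phi].

(** * Choice of the projection modulo the conductor *)

Section Projections.
Variables (C : closedFieldType) (n d : nat) (f : 'I_n.+1 -> {poly C}).
Hypotheses (d0 : (0 < d)%N) (n0 : (0 < n)%N) (sf : forall i, (size (f i) <= d.+1)%N).
Hypothesis bf : base_point_free f d.
Hypothesis fi : indep_mod (fun p => p = 0) f.
Variables (b g : nat) (c : {poly C}) (g0 : C).
Hypotheses (hc : curve_conductor d f b g c) (gpos : (0 < g)%N) (gd : good f d g0).

Let e := (b + g)%N.
Let U1 := fdvd c e d.
Let U2 := fdvd c e (d + d).
Let L1 : linpred U1 := linpred_fdvd c e d.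
Let L2 : linpred U2 := linpred_fdvd c e (d + d).

Lemma cond_neq0 : c != 0. Proof. by have [/monic_neq0] := hc. Qed.

Lemma rank1 l (v : 'I_l -> {poly C}) : (forall i, graded f 1 (v i)) -> indep_mod U1 v -> (l <= b)%N.
Proof. by have [_ _ _ _ H] := hc; have := H 1%N l v; rewrite mul1n. Qed.

Lemma rank2 l (v : 'I_l -> {poly C}) : (forall i, graded f 2 (v i)) -> indep_mod U2 v -> (l <= b)%N.
Proof. by have [_ _ _ _ H] := hc; have := H 2%N l v; rewrite mul2n -addnn. Qed.

Lemma max_span U (V : {poly C} -> Prop) l (v : 'I_l -> {poly C}) p : linpred U ->
  (forall (v : 'I_l.+1 -> {poly C}), (forall i, V (v i)) -> ~ indep_mod U v) ->
  (forall i, V (v i)) -> indep_mod U v -> V p -> span_mod U v p.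
Proof.
move=> LU H Vv iv Vp; apply: NNPP => ns.
apply: (H (extend_fam v p)); last exact: indep_extend_fam.
by move=> i; rewrite /extend_fam; case: unlift.
Qed.

Definition admissible (s0 : C) := [/\ s0 != 0, (moment f s0).[g0] != 0,
  size (moment f s0) = d.+1 & coprime_form e d c (moment f s0)].

Lemma cofinite_admissible : cofinite admissible.
Proof.
have c1 : cofinite (fun s => ~ (moment f s).[g0] = 0).
  apply: moment_notin (linpred_horner0 g0) _; have [i hi] := bf.1 g0; exists i; exact/eqP.
apply: cofinite_imp (cofinite_and (cofinite_neq 0) (cofinite_and c1 (moment_coprime e bf sf cond_neq0))).
by move=> s [s0 [h1 [h2 h3]]]; split=> //; exact/eqP.
Qed.

Variable s0 : C.
Hypothesis as0 : admissible s0.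
Let h : {poly C} := moment f s0.

Lemma gh : graded f 1 h. Proof. exact: graded1_moment. Qed.

Lemma h_cancel N (p : {poly C}) : (size p <= N.+1)%N -> fdvd c e (N + d) (h * p) -> fdvd c e N p.
Proof.
have [_ _ sh ch] := as0; have [_ sc _ _ _] := hc.
by apply: fdvd_cancel => //; [apply: cond_neq0|rewrite sh].
Qed.

Lemma h_notin : ~ U1 h.
Proof.
have [_ _ sh ch] := as0 => -[r [E sr]].
have : fdvd c e 0 1.
  by apply: h_cancel; rewrite ?size_poly1 // mulr1 add0n; exists r.
move=> [r' [E' sr']]; have r'0 : r' = 0.
  by apply/eqP; rewrite -size_poly_leq0 (leq_trans sr') //; rewrite /e; lia.
by move/eqP: E'; rewrite r'0 mulr0 oner_eq0.
Qed.

Lemma U12 p : U1 p -> U2 (h * p).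
Proof. by move=> H; rewrite mulrC; apply: fdvdM H _; have [_ _ ->] := as0. Qed.

Lemma U21 p : graded f 1 p -> U2 (h * p) -> U1 p.
Proof. by move=> gp; apply: h_cancel; have := size_graded sf gp; rewrite mul1n. Qed.

Lemma linpred_mul U (q : {poly C}) : linpred U -> linpred (fun p => U (q * p)).
Proof.
by move=> LU; split=> [|a p p' hp hp']; rewrite ?mulr0 ?mulrDr -?scalerAr; case: LU => // U0 H; apply: H.
Qed.

Lemma indep_hmul l (v : 'I_l -> {poly C}) : (forall i, graded f 1 (v i)) -> indep_mod U1 v ->
  indep_mod U2 (fun i => h * v i).
Proof.
move=> gv iv a Ha; apply: iv; apply: U21.
  by apply: linpred_sum (linpred_graded f 1) _ => j _; apply: linpredZ (linpred_graded f 1) (gv j).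
rewrite mulr_sumr; under eq_bigr do rewrite -scalerAr; exact: Ha.
Qed.

Definition products (y : 'I_3 -> {poly C}) (i : 'I_#|{: 'I_3 * 'I_3}|) :=
  y (enum_val i).1 * y (enum_val i).2.

Lemma span_products y k l : span_mod U2 (products y) (y k * y l).
Proof.
have := span_mod_mem (products y) (enum_rank (k, l)) L2.
by rewrite {2}/products enum_rankK.
Qed.

(** The plane curve generates a subring, so its conductors are conductors of [f] and divisible by
    [c]. A basis extracted from the products has at most [b] elements, since degree two has
    dimension at most [b] modulo [c]. *)
Lemma planar_of_span w : graded f 1 w -> (forall a, w <> a *: h) ->
  cofinite (fun s2 => forall k, span_mod U2 (products (triple h w (moment f s2))) (h * f k)) ->
  cofinite (fun s2 => exists e' b' (sel : 'I_b' -> 'I_3 * 'I_3),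
    [/\ (e' <= e)%N, (b' <= b)%N & planar_at d f s0 s2 w e e' sel]).
Proof.
move=> gw wh; have [_ h0 sh ch] := as0.
move=> csp; have := cofinite_and csp (plane_conductor d0 sf gd h0 gh gw wh).
apply: cofinite_imp => s2 [Sp Pc]; set y := triple h w (moment f s2) in Sp Pc *.
have gy k : graded f 1 (y k).
  by case: k => -[|[|[|//]]] lt; rewrite /y /triple /=; [apply: gh|apply: gw|apply: graded1_moment].
have [l [s [is_ ss]]] := sub_basis (products y) L2.
have [mc sc _ dc _] := hc.
exists (size c).-1, l, (fun i => enum_val (s i)); split.
- by rewrite -ltnS prednK // size_poly_gt0 cond_neq0.
- by apply: (rank2 (v := fun i => products y (s i))) => // i; apply: (@gradedM _ _ f 1 1).
exists c; split=> //.
- by split=> //; rewrite prednK // size_poly_gt0 cond_neq0.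
- by apply: Pc; rewrite /y /triple /= ?inordK.
- move=> P P0 sP cP; apply: dc => // r sr; apply: graded_sub (cP r sr); exact: gy.
move=> k; apply: (span_mod_min _ _ _ (Sp k)) => //; first exact: linpred_span.
by move=> q; apply: span_mod_sub.
Qed.

Lemma Sp_of_span1 w s2 l (v : 'I_l -> {poly C}) : (forall i, span_mod U2 (products (triple h w (moment f s2))) (h * v i)) ->
  (forall k, span_mod U1 v (f k)) ->
  forall k, span_mod U2 (products (triple h w (moment f s2))) (h * f k).
Proof.
move=> Hv H k; set S := span_mod U2 _; have LS : linpred S by apply: linpred_span.
apply: (span_mod_min (V := fun p => S (h * p)) _ _ _ (H k)) => //; first exact: linpred_mul.
by move=> q Uq; apply: span_mod_sub => //; apply: U12.
Qed.

Let fam0 : 'I_0 -> {poly C} := fun=> 0.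
Let ind0 U : indep_mod U fam0. Proof. by move=> a _ []. Qed.
Let span0 U p : span_mod U fam0 p -> U p. Proof. by move=> [a]; rewrite big_ord0 subr0. Qed.

Lemma not_multiple : exists i, forall a, f i <> a *: h.
Proof.
apply: NNPP => H; have H' i : exists a, f i = a *: h.
  by apply: NNPP => H'; apply: H; exists i => a E; apply: H'; exists a.
have n01 : (ord0 : 'I_n.+1) != inord 1 by rewrite -val_eqE /= inordK.
have [a Ea] := H' ord0; have [a' Ea'] := H' (inord 1).
have [a'0 a0] : a' = 0 /\ - a = 0.
  by apply: (indep_pair fi n01); rewrite Ea Ea' !scalerA mulNr mulrC scaleNr subrr.
have [/eqP] : (1 : C) = 0 /\ (0 : C) = 0; last by rewrite oner_eq0.
by apply: (indep_pair fi n01); rewrite Ea -[a]opprK a0 oppr0 !scale0r scaler0 addr0.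
Qed.

(** With at most three dimensions modulo [c], [h], a coordinate outside its span and a generic
    combination already span the coordinates, so products by [h] suffice. If [h] alone spans, any
    coordinate not proportional to it keeps the plane curve suitable. *)
Lemma planar_small : (forall v : 'I_4 -> {poly C}, (forall i, graded f 1 (v i)) -> ~ indep_mod U1 v) ->
  exists i, cofinite (fun s2 => exists e' b' (sel : 'I_b' -> 'I_3 * 'I_3),
    [/\ (e' <= e)%N, (b' <= b)%N & planar_at d f s0 s2 (f i) e e' sel]).
Proof.
move=> H4; pose E1 := extend_fam fam0 h.
have i1 : indep_mod U1 E1 by apply: indep_extend_fam => // /span0 /h_notin.
have gE1 i : graded f 1 (E1 i) by rewrite /E1 /extend_fam; case: unlift => [[]//|]; apply: gh.
have hE1 : span_mod U1 E1 h by have := span_mod_mem E1 ord0 L1; rewrite {2}/E1 extend_fam0.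
have pE1 w s2 i : span_mod U2 (products (triple h w (moment f s2))) (h * E1 i).
  rewrite /E1 /extend_fam; case: unlift => [[]//|].
  exact: (span_products (triple h w (moment f s2)) (@Ordinal 3 0 isT) (@Ordinal 3 0 isT)).
have [H|H] := classic (forall k, span_mod U1 E1 (f k)).
  have [i wh] := not_multiple; exists i; apply: planar_of_span => //; first exact: graded_gen.
  by exists [::] => s2 _; apply: Sp_of_span1 H; apply: pE1.
have [i Hi] := not_all_ex_not _ _ H; exists i.
have wh a : f i <> a *: h.
  by move=> E; apply: Hi; rewrite E; apply: linpredZ => //; apply: linpred_span.
apply: planar_of_span => //; first exact: graded_gen.
pose E2 := extend_fam E1 (f i).
have i2 : indep_mod U1 E2 by apply: indep_extend_fam.
have pE2 s2 j : span_mod U2 (products (triple h (f i) (moment f s2))) (h * E2 j).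
  rewrite /E2 /extend_fam; case: unlift => [j'|]; first exact: pE1.
  exact: (span_products (triple h (f i) (moment f s2)) (@Ordinal 3 0 isT) (@Ordinal 3 1 isT)).
have [H2|H2] := classic (forall k, span_mod U1 E2 (f k)).
  by exists [::] => s2 _; apply: Sp_of_span1 H2; apply: pE2.
apply: cofinite_imp (moment_notin (linpred_span E2 L1) (not_all_ex_not _ _ H2)) => s2 Hs.
pose E3 := extend_fam E2 (moment f s2).
apply: (@Sp_of_span1 _ _ _ E3) => [j|k].
  rewrite /E3 /extend_fam; case: unlift => [j'|]; first exact: pE2.
  exact: (span_products (triple h (f i) (moment f s2)) (@Ordinal 3 0 isT) (@Ordinal 3 2 isT)).
apply: (max_span (V := graded f 1)) => //; last exact: graded_gen.
- move=> j; rewrite /E3 /extend_fam; case: unlift => [j'|]; last exact: graded1_moment.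
  by rewrite /E2 /extend_fam; case: unlift => [j''|]; [apply: gE1|apply: graded_gen].
exact: indep_extend_fam.
Qed.

Section Large.
Hypotheses (g4 : (g <= 4)%N) (two0 : (2%:R : C) != 0).
Variable v4 : 'I_4 -> {poly C}.
Hypotheses (gv4 : forall i, graded f 1 (v4 i)) (iv4 : indep_mod U1 v4).

Lemma b_eq4 : b = 4 /\ g = 4.
Proof.
have := rank1 gv4 iv4; have [_ _ bg _ _] := hc => b4.
by split; apply/eqP; rewrite eqn_leq; apply/andP; split=> //; [apply: leq_trans bg g4|apply: leq_trans b4 bg].
Qed.

Lemma no5 m U (v : 'I_5 -> {poly C}) : (forall l (v : 'I_l -> {poly C}), (forall i, graded f m (v i)) ->
  indep_mod U v -> (l <= b)%N) -> (forall i, graded f m (v i)) -> ~ indep_mod U v.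
Proof. by move=> H gv /(H _ _ gv); rewrite b_eq4.1. Qed.

Lemma extend_by_gen l (v : 'I_l -> {poly C}) : (l < 4)%N -> exists k, ~ span_mod U1 v (f k).
Proof.
move=> l4; apply: not_all_ex_not => H.
have : (4 <= l)%N; last by rewrite leqNgt l4.
apply: (indep_le_span L1 iv4) => i; have /graded1P[a ->] := gv4 i.
have LS := linpred_span v L1.
by apply: linpred_sum (LS) _ => j _; apply: (linpredZ _ LS (H j)).
Qed.

(** A quadratic relation between [h] and [w] modulo [c]; by [planar_large] it is the only
    obstruction to projecting with [w]. *)
Definition quad_dep w := ~ forall a0 a1 a2 : C,
  U2 (a0 *: (h * h) + a1 *: (h * w) + a2 *: (w * w)) -> [/\ a0 = 0, a1 = 0 & a2 = 0].

(** Degree two has dimension at most 4 modulo [c]. The products of [h] and [w] give three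
    dimensions, and [h] times a generic combination gives the fourth, because [h] times four
    independent forms does not fit in three dimensions. *)
Lemma planar_large w : graded f 1 w -> ~ quad_dep w ->
  cofinite (fun s2 => exists e' b' (sel : 'I_b' -> 'I_3 * 'I_3),
    [/\ (e' <= e)%N, (b' <= b)%N & planar_at d f s0 s2 w e e' sel]).
Proof.
move=> gw /NNPP Hw.
have wh a : w <> a *: h.
  move=> E; have [|_ /eqP] := Hw (- a) 1 0; last by rewrite oner_eq0.
  by rewrite E scale0r addr0 scale1r -scalerAr scaleNr addNr; case: L2.
apply: planar_of_span => //.
pose W3 := extend_fam (extend_fam (extend_fam fam0 (h * h)) (h * w)) (w * w).
have W3E (a : 'I_3 -> C) : \sum_i a i *: W3 i =
    a (lift ord0 (lift ord0 ord0)) *: (h * h) + a (lift ord0 ord0) *: (h * w) + a ord0 *: (w * w).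
  by rewrite !big_ord_recl big_ord0 /W3 !(extend_fam0, extend_famS) addr0 addrC; congr (_ + _); rewrite addrC.
have i3 : indep_mod U2 W3.
  move=> a; rewrite W3E => /Hw[h0 h1 h2] i.
  case: (unliftP ord0 i) => [i' ->|-> //]; case: (unliftP ord0 i') => [i'' ->|-> //].
  by rewrite (ord1 i'').
have gW3 i : graded f 2 (W3 i).
  have G := @gradedM _ _ f 1 1; have gh' := gh.
  rewrite /W3 /extend_fam; case: unlift => [i'|]; last exact: G.
  by case: unlift => [i''|]; last exact: G; case: unlift => [[]//|]; apply: G.
have [k Hk] : exists k, ~ span_mod U2 W3 (h * f k).
  apply: not_all_ex_not => H; have : (4 <= 3)%N; last by [].
  apply: (indep_le_span L2 (indep_hmul gv4 iv4)) => i; have /graded1P[a ->] := gv4 i.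
  have LS := linpred_mul h (linpred_span W3 L2).
  by apply: linpred_sum (LS) _ => j _; apply: (linpredZ _ LS (H j)).
apply: cofinite_imp (moment_notin (linpred_mul h (linpred_span W3 L2)) (ex_intro _ k Hk)) => s2 Hs l.
have sp (i j : 'I_3) := span_products (triple h w (moment f s2)) i j.
apply: (span_mod_min (U := U2) (v := extend_fam W3 (h * moment f s2))).
- exact: linpred_span.
- by move=> q; apply: span_mod_sub.
- move=> i; rewrite /extend_fam; case: unlift => [i'|]; last exact: (sp (@Ordinal 3 0 isT) (@Ordinal 3 2 isT)).
  rewrite /W3 /extend_fam; case: unlift => [j|]; last exact: (sp (@Ordinal 3 1 isT) (@Ordinal 3 1 isT)).
  case: unlift => [j'|]; last exact: (sp (@Ordinal 3 0 isT) (@Ordinal 3 1 isT)).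
  by case: unlift => [[]//|]; exact: (sp (@Ordinal 3 0 isT) (@Ordinal 3 0 isT)).
have G := @gradedM _ _ f 1 1.
apply: (max_span (V := graded f 2)) => //.
- by move=> v; apply: (no5 (U := U2)); apply: rank2.
- move=> i; rewrite /extend_fam; case: unlift => [i'|]; first exact: gW3.
  by apply: G; [apply: gh|apply: graded1_moment].
- exact: indep_extend_fam.
by apply: G; [apply: gh|apply: graded_gen].
Qed.

Lemma U_comb2 (U : {poly C} -> Prop) x y z (a a' : C) : linpred U -> U x -> U y -> z = a *: x + a' *: y -> U z.
Proof. by move=> LU Ux Uy ->; apply: linpredD => //; apply: linpredZ. Qed.

Definition ind3 p q := forall a0 a1 a2 : C, U1 (a0 *: h + a1 *: p + a2 *: q) ->
  [/\ a0 = 0, a1 = 0 & a2 = 0].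

Lemma quad_depE p : graded f 1 p -> (forall a0 a1 : C, U1 (a0 *: h + a1 *: p) -> a0 = 0 /\ a1 = 0) ->
  quad_dep p -> exists al be : C, U2 (p * p - al *: (h * h) - be *: (h * p)).
Proof.
move=> gp ip dp; apply: NNPP => H; apply: dp => a0 a1 a2 Ha.
have a20 : a2 = 0.
  apply/eqP/negPn/negP => a20; apply: H; exists (- (a0 / a2)), (- (a1 / a2)).
  apply: (U_comb2 (a := a2^-1) (a' := 0) L2 Ha Ha).
  rewrite scale0r addr0 !scalerDr !scalerA mulVf // scale1r !scaleNr !opprK ![_^-1 * _]mulrC.
  by rewrite -addrA addrC.
suff [-> ->] : a0 = 0 /\ a1 = 0 by rewrite a20.
apply: ip; apply: U21.
  have LG := linpred_graded f 1; have gh' := gh.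
  by apply: linpredD (LG) _ _; apply: linpredZ (LG) _.
by move: Ha; rewrite a20 scale0r addr0 mulrDr -!scalerAr.
Qed.

Lemma complete_square p (m : C) (al be : C) : U2 (p * p - al *: (h * h) - be *: (h * p)) ->
  U2 ((p - m *: h) * (p - m *: h) - (al + be * m - m * m) *: (h * h) - (be - 2%:R * m) *: (h * (p - m *: h))).
Proof. by move=> H; rewrite (_ : _ - _ = p * p - al *: (h * h) - be *: (h * p)) //; rewrite -!mul_polyC; ring. Qed.

(** Completing squares gives P and Q with P P and Q Q multiples of h h modulo [c]. The relations for
    p + q and p + 2q give two expressions of P Q; comparing them removes the linear terms, so P Q is
    a multiple of h h too. Computing P P Q in two ways and cancelling h h relates P and Q linearly,
    and independence forces P P to be 0. *)
Lemma bad_square p q : graded f 1 p -> graded f 1 q -> ind3 p q ->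
  quad_dep p -> quad_dep q -> quad_dep (p + q) -> quad_dep (p + 2%:R *: q) ->
  exists la : C, U2 ((p - la *: h) * (p - la *: h)).
Proof.
move=> gp gq ipq dp dq d1 d2; have LG := linpred_graded f 1; have gh' := gh.
have [al [be Hp]] : exists al be : C, U2 (p * p - al *: (h * h) - be *: (h * p)).
  apply: quad_depE => // a0 a1 Ha; have [|-> -> _] := ipq a0 a1 0; last by [].
  by rewrite scale0r addr0.
have [al' [be' Hq]] : exists al be : C, U2 (q * q - al *: (h * h) - be *: (h * q)).
  apply: quad_depE => // a0 a1 Ha; have [|-> _ ->] := ipq a0 0 a1; last by [].
  by rewrite scale0r addr0.
have [al1 [be1 H1]] : exists al be : C, U2 ((p + q) * (p + q) - al *: (h * h) - be *: (h * (p + q))).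
  apply: quad_depE => //; first exact: linpredD.
  by move=> a0 a1 Ha; have [|-> -> _] := ipq a0 a1 a1; last by []; rewrite -addrA -scalerDr.
have [al2 [be2 H2]] : exists al be : C, U2 ((p + 2%:R *: q) * (p + 2%:R *: q) - al *: (h * h) - be *: (h * (p + 2%:R *: q))).
  apply: quad_depE => //; first by apply: linpredD (LG) gp _; apply: linpredZ (LG) gq.
  by move=> a0 a1 Ha; have [|-> -> _] := ipq a0 a1 (a1 * 2%:R); last by []; rewrite -addrA -scalerA -scalerDr.
pose la := be / 2%:R; pose mu := be' / 2%:R.
pose P := p - la *: h; pose Q := q - mu *: h.
have {Hp}HP := complete_square la Hp; have {Hq}HQ := complete_square mu Hq.
have {H1}H1 := complete_square (la + mu) H1; have {H2}H2 := complete_square (la + 2%:R * mu) H2.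
have E1 : be - 2%:R * la = 0 by rewrite /la mulrC divfK ?subrr.
have E2 : be' - 2%:R * mu = 0 by rewrite /mu mulrC divfK ?subrr.
rewrite E1 scale0r subr0 -/P in HP; rewrite E2 scale0r subr0 -/Q in HQ.
have F1 : p + q - (la + mu) *: h = P + Q by rewrite /P /Q -!mul_polyC; ring.
have F2 : p + 2%:R *: q - (la + 2%:R * mu) *: h = P + 2%:R *: Q by rewrite /P /Q -!mul_polyC; ring.
rewrite F1 in H1; rewrite F2 in H2.
move: HP HQ H1 H2; set dl := al + _ - _; set dl' := al' + _ - _; set a1 := al1 + _ - _; set a2 := al2 + _ - _.
set b1 := be1 - _; set b2 := be2 - _ => HP HQ H1 H2.
have gP : graded f 1 P by apply: linpredB (LG) _ _ => //; apply: linpredZ.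
have gQ : graded f 1 Q by apply: linpredB (LG) _ _ => //; apply: linpredZ.
have iPQ : ind3 P Q.
  move=> x0 x1 x2 Hx; have [|h0 h1 h2] := ipq (x0 - x1 * la - x2 * mu) x1 x2.
    suff -> : (x0 - x1 * la - x2 * mu) *: h + x1 *: p + x2 *: q = x0 *: h + x1 *: P + x2 *: Q by [].
    by rewrite /P /Q -!mul_polyC; ring.
  by split=> //; move: h0; rewrite h1 h2 !mul0r !subr0.
have K1 : U2 (2%:R *: (P * Q) - (a1 - dl - dl') *: (h * h) - b1 *: (h * (P + Q))).
  apply: (U_comb2 (a := 1) (a' := -1) L2 H1 (linpredD L2 HP HQ)).
  by rewrite -!mul_polyC; ring.
have K2 : U2 (4%:R *: (P * Q) - (a2 - dl - 4%:R * dl') *: (h * h) - b2 *: (h * (P + 2%:R *: Q))).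
  apply: (U_comb2 (a := 1) (a' := -1) L2 H2 (linpredD L2 HP (linpredZ 4%:R L2 HQ))).
  by rewrite -!mul_polyC; ring.
set r1 := a1 - _ - _ in K1; set r2 := a2 - _ - _ in K2.
have [_ B1 B2] : [/\ r2 - 2%:R * r1 = 0, b2 - 2%:R * b1 = 0 & 2%:R * b2 - 2%:R * b1 = 0].
  apply: iPQ; apply: U21.
    by apply: linpredD (LG) _ _; [apply: linpredD (LG) _ _|]; apply: linpredZ (LG) _.
  apply: (U_comb2 (a := 2%:R) (a' := -1) L2 K1 K2).
  by rewrite -!mul_polyC; ring.
have b10 : b1 = 0.
  have : 2%:R * b1 = (2%:R * b2 - 2%:R * b1) - 2%:R * (b2 - 2%:R * b1) by ring.
  by rewrite B1 B2 mulr0 subr0 => /eqP; rewrite mulf_eq0 (negPf two0) => /eqP.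
have K : U2 (P * Q - (r1 / 2%:R) *: (h * h)).
  rewrite b10 scale0r subr0 in K1; apply: (U_comb2 (a := 2%:R^-1) (a' := 0) L2 K1 K1).
  by rewrite scale0r addr0 scalerBr !scalerA mulVf // scale1r [2%:R^-1 * _]mulrC.
pose U3 := fdvd c e (d + d + d); have L3 : linpred U3 by apply: linpred_fdvd.
have U23 x y : graded f 1 y -> U2 x -> U3 (x * y).
  by move=> gy Ux; apply: fdvdM => //; have := size_graded sf gy; rewrite mul1n.
have : U3 (h * (h * (dl *: Q - (r1 / 2%:R) *: P))).
  apply: (U_comb2 (a := 1) (a' := -1) L3 (U23 _ P gP K) (U23 _ Q gQ HP)).
  by rewrite -!mul_polyC; ring.
have gPQ : graded f 1 (dl *: Q - (r1 / 2%:R) *: P).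
  by apply: linpredB (LG) _ _; apply: linpredZ (LG) _.
move/h_cancel => H3; have {H3} : U2 (h * (dl *: Q - (r1 / 2%:R) *: P)).
  by apply: H3; have := size_graded sf (gradedM gh' gPQ); rewrite addn1 mul2n -addnn.
move/(U21 gPQ) => H4; have [|_ _ d20] := iPQ 0 (- (r1 / 2%:R)) dl.
  by rewrite scale0r add0r scaleNr addrC.
by exists la; rewrite d20 scale0r subr0 in HP.
Qed.

(** [c] divides the squares of the three differences, hence the square of their gcd [s]. As [c] has
    degree 8 as a form, counting zeros at infinity too gives a common divisor of degree at least
    4. *)
Lemma quad_of_squares (ii : 'I_3 -> 'I_n.+1) (lam : 'I_3 -> C) : (e <= d.+1)%N ->
  (forall a, f (ii a) - lam a *: h != 0) ->
  (forall a, U2 ((f (ii a) - lam a *: h) * (f (ii a) - lam a *: h))) ->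
  (forall k, span_mod U1 (fun b : 'I_4 => if unlift ord0 b is Some a then f (ii a) else h) (f k)) ->
  exists sg sg' e' (phi : 'I_e' -> 'I_sg'), [/\ (4 <= sg <= d)%N, (sg' <= sg)%N, (e' <= d.+1)%N &
    quad_at d f h ii sg phi].
Proof.
move=> ed w0 Uw Sp; pose w a := f (ii a) - lam a *: h; have e8 : e = 8 by rewrite /e b_eq4.1 b_eq4.2.
have [mc sc _ _ _] := hc; have [_ _ sh _] := as0.
have sw a : (size (w a) <= d.+1)%N.
  apply: (linpredB (linpred_size C d.+1)); first exact: sf.
  by rewrite (leq_trans (size_scale_leq _ _)) // sh.
pose o0 : 'I_3 := ord0; pose o1 : 'I_3 := @Ordinal 3 1 isT; pose o2 : 'I_3 := @Ordinal 3 2 isT.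
pose G := gcdp (gcdp (w o0) (w o1)) (w o2).
have G0 : G != 0 by rewrite !gcdp_eq0 (negPf (w0 o0)).
pose s := (lead_coef G)^-1 *: G.
have ms : s \is monic by rewrite monicE lead_coefZ mulVf // lead_coef_eq0.
have sG : s %= G by apply: eqp_scale; rewrite invr_eq0 lead_coef_eq0.
have sdv a : s %| w a.
  rewrite (eqp_dvdl _ sG); case: a => -[|[|[|//]]] lt; rewrite /G.
  - have -> : Ordinal lt = o0 by apply: val_inj.
    exact: dvdp_trans (dvdp_gcdl _ _) (dvdp_gcdl _ _).
  - have -> : Ordinal lt = o1 by apply: val_inj.
    exact: dvdp_trans (dvdp_gcdl _ _) (dvdp_gcdr _ _).
  have -> : Ordinal lt = o2 by apply: val_inj.
  exact: dvdp_gcdr.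
have cdv a : c %| w a * w a by have [r [-> _]] := Uw a; apply: dvdp_mulr.
have cs : c %| s * s.
  rewrite (eqp_dvdr _ (eqp_trans (eqp_mull s sG) (eqp_mulr G sG))); apply: dvdp_sq_gcd => //; exact: dvdp_sq_gcd.
have sn0 : s != 0 := monic_neq0 ms; have c0 := cond_neq0.
have [al Eal] := @monic_roots C s (size s).-1 ms (esym (prednK (etrans (size_poly_gt0 s) sn0))).
have [rs Ers] := @monic_roots C c (size c).-1 mc (esym (prednK (etrans (size_poly_gt0 c) c0))).
(* Every root of [c] is a root of [s]; recording which one makes [c] a function of the roots of
   [s]. *)
have [phi Hphi] : exists phi : 'I_(size c).-1 -> 'I_(size s).-1, forall l, rs l = al (phi l).
  apply: (@fin_all_exists _ _ (fun l k => rs l = al k)) => l.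
  have : root (s * s) (rs l).
    have /dvdpP[q Eq] := cs; rewrite Eq rootM {1}Ers; apply/orP; right.
    by apply/rootP; rewrite horner_prod (bigD1 l) //= hornerXsubC subrr mul0r //.
  rewrite rootM orbb {1}Eal => /rootP/eqP; rewrite horner_prod prodf_seq_eq0 => /hasP[k _ /=].
  by rewrite hornerXsubC subr_eq0 => /eqP E; exists k.
have I3 : (0 < #|'I_3|)%N by rewrite card_ord.
have [ma Ema] := eq_bigmax (fun a : 'I_3 => size (w a)) I3.
have maxw a : (size (w a) <= size (w ma))%N by rewrite -Ema; apply: (leq_bigmax (F := fun a => size (w a))).
have S1 : (size c <= size (s * s)%R)%N by apply: dvdp_leq => //; rewrite mulf_neq0.
rewrite size_mul // in S1.
(* The part at infinity: the square of [w ma] vanishes there at least as often as [c], a form of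
   degree 8. *)
have S2 : (2 * size (w ma) + 6 <= (size c).-1 + 2 * d)%N.
  have [r [Er sr]] := Uw ma; rewrite -/(w ma) in Er.
  have r0 : r != 0 by apply: contraNneq (w0 ma) => r0; move/eqP: Er; rewrite r0 mulr0 mulf_eq0 orbb.
  have := congr1 (fun p : {poly C} => size p) Er; rewrite /= !size_mul // ?(w0 ma) //.
  move: sr; rewrite e8; move: r0 c0 (w0 ma); rewrite -!size_poly_gt0 -/(w ma).
  move: (size r) (size c) (size (w ma)) => x y z; lia.
have S3 : (size s <= size (w ma))%N by apply: dvdp_leq (sdv ma); apply: w0.
have S4 := sw ma; have s_gt0 : (0 < size s)%N by rewrite size_poly_gt0.
have c_gt0 : (0 < size c)%N by rewrite size_poly_gt0.
(* [sg] adds to the degree of the polynomial [s] the common order of vanishing at infinity, read off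
   from the difference of largest size. *)
exists ((size s).-1 + (d.+1 - size (w ma)))%N, (size s).-1, (size c).-1, phi; split.
- move: S1 S2 S3 S4 s_gt0 c_gt0; move: (size s) (size c) (size (w ma)) => x y z; lia.
- exact: leq_addr.
- by rewrite -ltnS prednK // (leq_trans sc) // ltnS; rewrite -/e; apply: leq_trans ed _.
exists al, lam, (fun a => w a %/ s); split=> [a|a|k].
- by rewrite -Eal mulrC divpK // /w addrC subrK.
- rewrite size_divp //; have := maxw a; move: S3 S4 s_gt0.
  move: (size s) (size (w ma)) (size (w a)) => x y z; lia.
rewrite [X in fdvd X](_ : _ = c); last by rewrite [RHS]Ers; apply: eq_bigr => l _; rewrite Hphi.
by have := Sp k; rewrite /U1 e8.
Qed.

(** If no combination f_i + k f_j with k = 0, 1, 2 can serve as [w], then f_i, f_j, f_i + f_j and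
    f_i + 2 f_j all satisfy quadratic relations, as [bad_square] requires. It is applied to three
    coordinates that are independent together with [h] modulo [c]. *)
Lemma large_case : (e <= d.+1)%N ->
  (exists i j (k : 'I_3), i != j /\
    cofinite (fun s2 => exists e' b' (sel : 'I_b' -> 'I_3 * 'I_3),
    [/\ (e' <= e)%N, (b' <= b)%N & planar_at d f s0 s2 (f i + k%:R *: f j) e e' sel])) \/
  exists (ii : 'I_3 -> 'I_n.+1) sg sg' e' (phi : 'I_e' -> 'I_sg'),
    injective ii /\ [/\ (4 <= sg <= d)%N, (sg' <= sg)%N, (e' <= d.+1)%N & quad_at d f h ii sg phi].
Proof.
move=> ed; have LG := linpred_graded f 1; have gg := graded_gen f.
have [[i [j [k [ij H]]]]|H] := classic (exists i j (k : 'I_3), i != j /\ ~ quad_dep (f i + k%:R *: f j)).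
  left; exists i, j, k; split=> //; apply: planar_large => //.
  by apply: linpredD (LG) _ _ => //; apply: linpredZ.
right; have {}H i j (k : 'I_3) : i != j -> quad_dep (f i + k%:R *: f j).
  by move=> ij; apply: NNPP => nd; apply: H; exists i, j, k.
have H0 i j : i != j -> quad_dep (f i).
  by move=> /(H i j (@Ordinal 3 0 isT)); rewrite /= scale0r addr0.
have H1 i j : i != j -> quad_dep (f i + f j).
  by move=> /(H i j (@Ordinal 3 1 isT)); rewrite /= scale1r.
have H2 i j : i != j -> quad_dep (f i + 2%:R *: f j).
  by move=> /(H i j (@Ordinal 3 2 isT)).
pose E1 := extend_fam fam0 h.
have in1 : indep_mod U1 E1 by apply: indep_extend_fam => // /span0 /h_notin.
have [i1 ni1] := @extend_by_gen _ E1 isT; have in2 := indep_extend_fam L1 in1 ni1.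
have [i2 ni2] := @extend_by_gen _ (extend_fam E1 (f i1)) isT; have in3 := indep_extend_fam L1 in2 ni2.
have [i3 ni3] := @extend_by_gen _ (extend_fam (extend_fam E1 (f i1)) (f i2)) isT.
have in4 := indep_extend_fam L1 in3 ni3.
have ind4 a0 a1 a2 a3 : U1 (a0 *: h + a1 *: f i1 + a2 *: f i2 + a3 *: f i3) ->
    [/\ a0 = 0, a1 = 0, a2 = 0 & a3 = 0].
  move=> Ha; have := in4 (fun i : 'I_4 => nth 0 [:: a3; a2; a1; a0] i).
  rewrite !big_ord_recl big_ord0 /E1 !(extend_fam0, extend_famS) /= addr0 => H4.
  have {H4} H4 : forall i : 'I_4, nth 0 [:: a3; a2; a1; a0] i = 0.
    apply: H4; move: Ha; rewrite (_ : a0 *: h + _ + _ + _ =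
      a3 *: f i3 + (a2 *: f i2 + (a1 *: f i1 + a0 *: h))) //.
    by rewrite -!mul_polyC; ring.
  by split; [apply: (H4 (@Ordinal 4 3 isT))|apply: (H4 (@Ordinal 4 2 isT))|
             apply: (H4 (@Ordinal 4 1 isT))|apply: (H4 (@Ordinal 4 0 isT))].
have one0 : (1 : C) <> 0 by apply/eqP; rewrite oner_eq0.
have U10 : U1 0 by case: L1.
have n12 : i1 != i2.
  apply/eqP=> E; have [|_ /one0 //] := ind4 0 1 (-1) 0.
  by rewrite E !scale0r add0r addr0 scale1r scaleN1r subrr.
have n13 : i1 != i3.
  apply/eqP=> E; have [|_ /one0 //] := ind4 0 1 0 (-1).
  by rewrite E !scale0r add0r addr0 scale1r scaleN1r subrr.
have n23 : i2 != i3.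
  apply/eqP=> E; have [|_ _ /one0 //] := ind4 0 0 1 (-1).
  by rewrite E !scale0r !add0r scale1r scaleN1r subrr.
pose ii (a : 'I_3) := nth i1 [:: i1; i2; i3] a.
have iinj : injective ii.
  move=> a a' E; apply: val_inj; apply/eqP.
  have u : uniq [:: i1; i2; i3] by rewrite /= !inE negb_or n12 n13 n23.
  by rewrite -(nth_uniq i1 _ _ u) //=; apply/eqP.
have bs i j : i != j -> ind3 (f i) (f j) -> exists la : C, U2 ((f i - la *: h) * (f i - la *: h)).
  by move=> ij ind; apply: (@bad_square (f i) (f j)) => //; [apply: (H0 i j)|apply: (H0 j i); rewrite eq_sym|apply: H1|apply: H2].
have [lam Hlam] : exists lam : 'I_3 -> C, forall a, U2 ((f (ii a) - lam a *: h) * (f (ii a) - lam a *: h)).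
  apply: (@fin_all_exists _ _ (fun a la => U2 ((f (ii a) - la *: h) * (f (ii a) - la *: h)))).
  case=> -[|[|[|//]]] lt; rewrite /ii /=.
  - apply: (bs i1 i2) => // a0 a1 a2 Ha; have [|-> -> -> _] := ind4 a0 a1 a2 0; last by [].
    by rewrite scale0r addr0.
  - apply: (bs i2 i1); first by rewrite eq_sym.
    move=> a0 a1 a2 Ha; have [|-> -> -> _] := ind4 a0 a2 a1 0; last by [].
    by rewrite scale0r addr0 addrAC.
  apply: (bs i3 i1); first by rewrite eq_sym.
  move=> a0 a1 a2 Ha; have [|-> -> _ ->] := ind4 a0 a2 0 a1; last by [].
  by rewrite scale0r addr0 addrAC.
exists ii; have [||k|sg [sg' [e' [phi Hq]]]] := @quad_of_squares ii lam ed; last by exists sg, sg', e', phi.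
- move=> a; apply/eqP=> E.
  have {}E : U1 (f (ii a) - lam a *: h) by rewrite E.
  case: a E => -[|[|[|//]]] lt; set x := lam _; rewrite /ii /= => E.
  + have [|_ /one0 //] := ind4 (- x) 1 0 0.
    by rewrite !scale0r !addr0 scaleNr scale1r addrC.
  + have [|_ _ /one0 //] := ind4 (- x) 0 1 0.
    by rewrite !scale0r !addr0 scaleNr scale1r addrC.
  have [|_ _ _ /one0 //] := ind4 (- x) 0 0 1.
  by rewrite !scale0r !addr0 scaleNr scale1r addrC.
- exact: Hlam.
apply: (max_span (V := graded f 1)) => //.
- by move=> v; apply: (no5 (U := U1)); apply: rank1.
- by move=> i; case: unlift => [a|]; [apply: gg|apply: gh].
move=> a; rewrite !big_ord_recl big_ord0 addr0 => Ha.
have [|h0 h1 h2 h3] := ind4 (a ord0) (a (lift ord0 ord0)) (a (lift ord0 (lift ord0 ord0))) (a (lift ord0 (lift ord0 (lift ord0 ord0)))).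
  by move: Ha; rewrite unlift_none !liftK /ii /= !addrA.
move=> i; case: (unliftP ord0 i) => [i' ->|-> //]; case: (unliftP ord0 i') => [j ->|-> //].
by case: (unliftP ord0 j) => [j' ->|-> //]; rewrite (ord1 j').
Qed.

End Large.

Lemma generic_type : (2 < n)%N -> (e <= d.+1)%N -> (g <= 4)%N -> (2%:R : C) != 0 ->
  cofinite (fun s2 => planar_type d g f s0 s2 \/ quad_type d g f s0).
Proof.
move=> n3 ed g4 two0; have [s00 _ _ _] := as0.
have planar i j (k : 'I_3) : i != j ->
    cofinite (fun s2 => exists e' b' (sel : 'I_b' -> 'I_3 * 'I_3),
    [/\ (e' <= e)%N, (b' <= b)%N & planar_at d f s0 s2 (f i + k%:R *: f j) e e' sel]) ->
    cofinite (fun s2 => planar_type d g f s0 s2 \/ quad_type d g f s0).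
  move=> ij cpl.
  have [p] := @fresh_index n [:: i; j] (ltnW n3); rewrite !inE negb_or => /andP[pi pj].
  have [q] := @fresh_index n [:: i; j; p] n3; rewrite !inE !negb_or => /and3P[qi qj qp].
  (* The determinant needed to recover the coordinates p and q, as a polynomial in [s2]; it is
     nonzero since [s0] is. *)
  have D0 : s0 ^+ p *: 'X^q - s0 ^+ q *: 'X^p != 0 :> {poly C}.
    apply/eqP=> /(congr1 (fun r : {poly C} => r`_q)).
    rewrite coefB !coefZ !coefXn eqxx mulr1 (inj_eq val_inj) (negPf qp) mulr0 subr0 coef0 => /eqP.
    by rewrite expf_eq0 (negPf s00) andbF.
  apply: cofinite_imp (cofinite_and cpl (cofinite_poly D0)) => s2 [[e' [b' [sel [ee bb H]]]] hD].
  left; exists i, j, p, q, k, e, e', b', sel; split=> //.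
  - by rewrite /= !inE !negb_or ij eq_sym pi eq_sym qi eq_sym pj eq_sym qj eq_sym qp.
  - by rewrite ee.
  - by rewrite leq_add2r.
  by move: hD; rewrite hornerD hornerN !hornerZ !hornerXn.
have [[v4 [gv4 iv4]]|H] := classic (exists v : 'I_4 -> {poly C}, (forall i, graded f 1 (v i)) /\ indep_mod U1 v).
  have [[i [j [k [ij H]]]]|[ii [sg [sg' [e' [phi [iinj [h1 h2 h3 h4]]]]]]]] := large_case g4 two0 gv4 iv4 ed.
    exact: planar H.
  have [b4 g4'] := b_eq4 g4 gv4 iv4.
  exists [::] => s2 _; right; exists ii, sg, sg', e', phi; split=> //; first by rewrite h1.
  by rewrite h3 g4' eqxx /=; move: ed; rewrite /e b4 g4'.
have [|i Hi] := planar_small; first by move=> v gv iv; apply: H; exists v.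
have [j] := @fresh_index n [:: i] (ltn_trans (ltn0Sn _) (ltnW n3)); rewrite inE eq_sym => ij.
apply: (planar i j (@Ordinal 3 0 isT) ij); apply: cofinite_imp Hi => s2.
by rewrite /= scale0r addr0.
Qed.

End Projections.

Lemma finfun_fun (I : finType) (R : Type) (u : I -> R) : (fun i => finfun u i) = u.
Proof. by apply: functional_extensionality => i; rewrite ffunE. Qed.

(** * Dimension of the two generic families *)

Section GenericDimension.
Variables (C : closedFieldType) (n d g : nat).
Hypotheses (n3 : (2 < n)%N) (d0 : (0 < d)%N).

Local Notation T := (('I_(npar n d) -> C) * seq C)%type.
Let F (t : T) := dehom t.1.
Let s0 (t : T) : C := nth 0 t.2 0.
Let s2 (t : T) : C := nth 0 t.2 1.

Lemma growth_lift2 (A : T -> Prop) D :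
  growth A (fun y => (exists k, coefs_of (fun t => F t k) d.+1 y) \/ (y = s0 \/ y = s2)) D ->
  growth A (@lift_coord C (npar n d) 2) D.
Proof.
move=> gA; apply: growth_lift gA _ _ => [k y Hy|]; first by left; exists k.
by case=> -[|[|//]] lt; right; [left|right].
Qed.

Lemma growth_planar_type : growth (fun t : T => planar_type d g (F t) (s0 t) (s2 t))
  (@lift_coord C (npar n d) 2) (npar n d - (n - 2) * g + 2).
Proof.
pose J := ('I_n.+1 * 'I_n.+1 * ('I_n.+1 * 'I_n.+1) * 'I_3 * ('I_d.+2 * 'I_d.+2 * 'I_d.+2))%type.
pose ok (j : J) := let: ((i, k, (p, q), kap), (e, e', b)) := j in
  [&& uniq [:: i; k; p; q], e' <= e & b + g <= e]%N.
pose B (j : J) t := ok j /\ let: ((i, k, (p, q), kap), (e, e', b)) := j in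
  [/\ forall k, (size (F t k) <= d.+1)%N, s0 t ^+ p * s2 t ^+ q - s0 t ^+ q * s2 t ^+ p != 0 &
   exists sel : {ffun 'I_b -> 'I_3 * 'I_3},
     planar_at d (F t) (s0 t) (s2 t) (F t i + kap%:R *: F t k) e e' (fun i => sel i)].
apply: (growth_union (B := B)) => [t|].
  move=> [i [k [p [q [kap [e [e' [b [sel [u /andP[ee ed] be D P]]]]]]]]]].
  have e2 : (e < d.+2)%N by [].
  have e2' : (e' < d.+2)%N by apply: leq_ltn_trans ee e2.
  have b2 : (b < d.+2)%N by apply: leq_ltn_trans e2; apply: leq_trans be; apply: leq_addr.
  exists ((i, k, (p, q), kap), (Ordinal e2, Ordinal e2', Ordinal b2)); split.
    by apply/and3P; split.
  split=> //; first by move=> l; apply: size_dehom.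
  by exists (finfun sel); rewrite finfun_fun.
move=> [[[[i k] [p q]] kap] [[e e'] b]]; have [o|no] := boolP (ok ((i, k, (p, q), kap), (e, e', b))); last first.
  by apply: growth_empty => -[t [_ [o _]]]; rewrite o in no.
apply: (@growth_union _ _ {ffun 'I_b -> 'I_3 * 'I_3} _ (fun sel t =>
    planar_at d (F t) (s0 t) (s2 t) (F t i + kap%:R *: F t k) e e' (fun i => sel i))).
  by move=> t [_ [_ [_ _]]].
have /and3P[u ee be] := o; have ed : (e <= d.+1)%N by rewrite -ltnS.
move=> sel; apply: growth_lift2; apply: growth_leq; last first.
  apply: (@growth_planar C T d _ n F s0 s2 i k p q kap%:R e e' b g sel d0 u ee ed be) => t.
  by move=> [[_ [_ [h1 h2 _]]] h3]; split.
rewrite leq_add2r; have gB : (g <= d.+1)%N by apply: leq_trans ed; apply: leq_trans be; apply: leq_addl.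
have -> : npar n d = (3 * d.+1 + (n - 2) * d.+1)%N by rewrite /npar -mulnDl; congr (_ * _)%N; lia.
by rewrite mulnBr addnBA // leq_mul2l gB orbT.
Qed.

Lemma growth_quad_type : growth (fun t : T => quad_type d g (F t) (s0 t))
  (@lift_coord C (npar n d) 2) (npar n d - (n - 2) * g + 2).
Proof.
pose J := ('I_d.+2 * 'I_d.+2 * 'I_d.+2 * {ffun 'I_3 -> 'I_n.+1})%type.
pose ok (j : J) := let: ((sg, sg', e'), ii) := j in
  [&& injectiveb ii, 4 <= sg, sg <= d, sg' <= sg, g == 4 & 8 <= d.+1]%N.
pose B (j : J) t := ok j /\ let: ((sg, sg', e'), ii) := j in
  [/\ forall k, (size (F t k) <= d.+1)%N, s0 t != 0 &
   exists phi : {ffun 'I_e' -> 'I_sg'},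
     quad_at d (F t) (moment (F t) (s0 t)) (fun i => ii i) sg (fun i => phi i)].
apply: (growth_union (B := B)) => [t|].
  move=> [ii [sg [sg' [e' [phi [inj /andP[/andP[h1 h2] h3] /and3P[h4 h5 h6] s00 P]]]]]].
  have a1 : (sg < d.+2)%N by rewrite ltnS (leq_trans h2).
  have a2 : (sg' < d.+2)%N by apply: leq_ltn_trans a1.
  exists ((Ordinal a1, Ordinal a2, Ordinal (h4 : e' < d.+2)%N), finfun ii); split.
    by apply/and5P; split=> //; [apply/injectiveP => x y; rewrite !ffunE; apply: inj|rewrite h5].
  split=> //; first by move=> l; apply: size_dehom.
  by exists (finfun phi); rewrite !finfun_fun.
move=> [[[sg sg'] e'] ii]; have [o|no] := boolP (ok ((sg, sg', e'), ii)); last first.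
  by apply: growth_empty => -[t [_ [o _]]]; rewrite o in no.
apply: (@growth_union _ _ {ffun 'I_e' -> 'I_sg'} _ (fun phi t =>
    quad_at d (F t) (moment (F t) (s0 t)) (fun i => ii i) sg (fun i => phi i))).
  by move=> t [_ [_ [_ _]]].
have /and5P[/injectiveP inj h1 h2 h3 /andP[/eqP g4 h8]] := o.
have [|i0 Hi0] := @fresh_index n [seq ii a | a <- enum 'I_3].
  by rewrite size_map size_enum_ord.
move=> phi; apply: growth_lift2; apply: growth_leq; last first.
  apply: (@growth_quad C T d _ n F s0 s2 (fun i => ii i) i0 sg sg' e' phi inj) => [a|t].
    by apply: contraNneq Hi0 => <-; rewrite map_f ?mem_enum.
  by move=> [[_ [_ [k1 k2 _]]] k3]; split.
(* With sg' <= sg and sg >= 4, the part besides the n - 3 coordinates is at most 4(d + 1) + 3 - 2sg,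
   hence at most 4(d + 1) - 4. *)
rewrite leq_add2r g4.
have -> : (4 + (d.+1 - 8) = d.+1 - 4)%N by lia.
have -> : npar n d = (4 * d.+1 + (n - 3) * d.+1)%N by rewrite /npar -mulnDl; congr (_ * _)%N; lia.
have -> : ((n - 2) * 4 = 4 + (n - 3) * 4)%N by lia.
rewrite [((n - 3) * (_ - _))%N]mulnBr.
have : ((n - 3) * 4 <= (n - 3) * d.+1)%N by rewrite leq_mul2l; apply/orP; right; lia.
move: h1 h2 h3 h8; move: ((n - 3) * 4)%N ((n - 3) * d.+1)%N (nat_of_ord sg) (nat_of_ord sg') => x y z w; lia.
Qed.

Lemma alg_dep_generic (S : ('I_(npar n d) -> C) -> Prop) :
  (forall x, S x -> cofinite (fun s0 => cofinite (fun s2 =>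
     planar_type d g (dehom x) s0 s2 \/ quad_type d g (dehom x) s0))) ->
  alg_dep S (npar n d - (n - 2) * g).
Proof.
move=> H; apply: (@alg_dep_lift _ _ _ _ 2 (fun t : T =>
  planar_type d g (F t) (s0 t) (s2 t) \/ quad_type d g (F t) (s0 t))); last by move=> x /H.
apply: (@growth_union _ _ bool _ (fun j t => if j then planar_type d g (F t) (s0 t) (s2 t)
    else quad_type d g (F t) (s0 t))).
  by move=> t []; [exists true|exists false].
by case; [apply: growth_sub growth_planar_type|apply: growth_sub growth_quad_type] => // t [].
Qed.

End GenericDimension.

(** * The exceptional sextics *)

Section Sextics.
Variable C : closedFieldType.
Hypothesis two0 : (2%:R : C) != 0.
Local Notation is0 := (fun p : {poly C} => p = 0).

(** Explicit lists, so that the size and distinctness of the ten index pairs hold by computation. *)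
Let ords4 := [:: @Ordinal 4 0 isT; @Ordinal 4 1 isT; @Ordinal 4 2 isT; @Ordinal 4 3 isT].
Let pairs4 : seq ('I_4 * 'I_4) := [seq p : 'I_4 * 'I_4 <- [seq (i, j) | i <- ords4, j <- ords4] | (p.1 <= p.2)%N].
Let pr (k : 'I_10) := nth (ord0, ord0) pairs4 k.

Let pr_inj (k l : 'I_10) : (pr k == pr l) = (k == l).
Proof. by rewrite /pr nth_uniq. Qed.

Let pr_le (k : 'I_10) : ((pr k).1 <= (pr k).2)%N.
Proof. by have := mem_nth (ord0, ord0) (ltn_ord k : k < size pairs4)%N; rewrite mem_filter => /andP[]. Qed.

(** The ten products have degree 12. They span at most 4 dimensions modulo [c], and the multiples of
    [c] in that degree form a space of dimension 13 - 8 = 5. *)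
Lemma quadric_relation (f : 'I_4 -> {poly C}) c : (forall i, size (f i) <= 7)%N ->
  curve_conductor 6 f 4 4 c ->
  exists Q : 'M[C]_4, [/\ Q^T = Q, Q != 0 & \sum_i \sum_j Q i j *: (f i * f j) = 0].
Proof.
move=> sf [mc _ _ _ rk]; have L0 := @linpred_eq0 C {poly C}; have c0 := monic_neq0 mc.
pose w k := f (pr k).1 * f (pr k).2.
have dep : ~ indep_mod is0 w.
  move=> iw; have L2 := linpred_fdvd c (4 + 4) (2 * 6).
  have [l [s [is_ ss]]] := sub_basis w L2.
  have l4 : (l <= 4)%N by apply: (rk 2 _ _ _ is_) => i; apply: (@gradedM _ _ f 1 1); apply: graded_gen.
  have [_ _ bs] := @basis_fdvd C c (4 + 4) (2 * 6) c0.
  pose mu (i : 'I_(l + 5)) := match split i with inl a => w (s a) | inr b => c * 'X^b end.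
  have Lmu := linpred_span mu L0.
  have : (10 <= l + 5)%N; last by move: l4; clear; lia.
  apply: (indep_le_span L0 iw) => k; rewrite -/(span_mod is0 mu (w k)).
  apply: (span_mod_min (Lmu) _ _ (ss k)) => [q /bs|a].
    apply: span_mod_min => // [q' ->|j]; first by case: Lmu.
    by have := span_mod_mem mu (rshift l j) L0; rewrite {2}/mu (unsplitK (inr j)).
  by have := span_mod_mem mu (lshift 5 a) L0; rewrite {2}/mu (unsplitK (inl a)).
have [a Ha] : exists a : 'I_10 -> C, ~ (\sum_k a k *: w k = 0 -> forall i, a i = 0).
  exact: not_all_ex_not dep.
have [rel nz] := imply_to_and _ _ Ha; have [k /eqP ak] := not_all_ex_not _ _ nz.
(* The symmetrised relation, which is twice the original one; it stays nonzero because 2 is. *)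
pose Q : 'M[C]_4 := \matrix_(i, j) \sum_k a k * (((i, j) == pr k)%:R + ((j, i) == pr k)%:R).
exists Q; split.
- by apply/matrixP => i j; rewrite !mxE; apply: eq_bigr => l _; rewrite addrC.
- apply/eqP=> /matrixP/(_ (pr k).1 (pr k).2); rewrite !mxE (bigD1 k) //= -surjective_pairing eqxx.
  rewrite big1 ?addr0 => [|l lk].
    case: eqP => _ /eqP; rewrite mulf_eq0 (negPf ak) /= ?addr0 ?oner_eq0 //.
    by rewrite -[1 + 1]/(2%:R) (negPf two0).
  rewrite pr_inj eq_sym (negPf lk) add0r; case: eqP => [E|_]; last by rewrite mulr0.
  have := pr_le k; have := pr_le l; rewrite -E /= => h1 h2.
  have E12 : (pr k).1 = (pr k).2 by apply: val_inj; apply/eqP; rewrite eqn_leq h1 h2.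
  by move: lk; rewrite -pr_inj -E; case: (pr k) E12 => x y /= ->; rewrite eqxx.
transitivity (\sum_i \sum_j \sum_k (a k * (((i, j) == pr k)%:R + ((j, i) == pr k)%:R)) *: (f i * f j)).
  by apply: eq_bigr => i _; apply: eq_bigr => j _; rewrite mxE scaler_suml.
under eq_bigr do rewrite exchange_big /=; rewrite exchange_big /=.
suff H l : \sum_i \sum_j (a l * (((i, j) == pr l)%:R + ((j, i) == pr l)%:R)) *: (f i * f j) = 2%:R *: (a l *: w l).
  by under eq_bigr do rewrite H; rewrite -scaler_sumr rel scaler0.
transitivity (\sum_(p : 'I_4 * 'I_4) (a l * ((p == pr l)%:R + ((p.2, p.1) == pr l)%:R)) *: (f p.1 * f p.2)).
  by rewrite pair_big; apply: eq_bigr => -[].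
under eq_bigr do rewrite mulrDr scalerDl; rewrite big_split /=.
rewrite (bigD1 (pr l)) //= big1 => [|p pl]; last by rewrite (negPf pl) mulr0 scale0r.
rewrite (bigD1 ((pr l).2, (pr l).1)) //= big1 => [|p pl]; last first.
  case: eqP => [E|_]; last by rewrite mulr0 scale0r.
  by move: pl; rewrite -E -surjective_pairing eqxx.
by rewrite -surjective_pairing eqxx !addr0 mulr1 [f (pr l).2 * _]mulrC -/(w l) scaler_nat mulr2n.
Qed.

(** Here N = 28 and (n - 2)g = 4. Both families cost exactly 24: 16 + 2(k + k') - 8 with k + k' = 8,
    and 19 + 2k - 4 + k' with k' + 2k = 9. *)
Lemma alg_dep_sextic : alg_dep (fun x : 'I_(npar 3 6) -> C =>
  Defs.nondegenerate x /\ exists c, curve_conductor 6 (dehom x) 4 4 c) 24.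
Proof.
pose T := (('I_(npar 3 6) -> C) * seq C)%type.
pose F (t : T) : 'I_4 -> {poly C} := dehom t.1.
pose quad t := exists (k k' : 'I_8) (i1 j1 : 'I_k) (i2 j2 : 'I_k'),
  (k + k' = 8)%N /\ quad4_at (F t) i1 j1 i2 j2.
pose cone t := exists (k k' : 'I_8) (i1 j1 : 'I_k) (i0 : 'I_4),
  (k' + 2 * k = 9)%N /\ cone_at (F t) k' i1 j1 i0.
apply: (@alg_dep_lift _ _ _ _ 0 (fun t : T => quad t \/ cone t)); last first.
  move=> x [nx [c hc]] /=.
  have [Q [QT Q0 QE]] := quadric_relation (@size_dehom _ 3 6 x) hc.
  exact: sextic_quadric two0 (@size_dehom _ 3 6 x) QT Q0 (dehom_indep nx) QE.
have lift (A : T -> Prop) D : (D <= 24)%N -> growth A (fun y => exists i, coefs_of (fun t => F t i) 7 y) D ->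
    growth A (@lift_coord C (npar 3 6) 0) (24 + 0).
  move=> D24 gA; apply: growth_leq D24 _; apply: growth_lift gA _ _ => [k y Hy|[]//].
  by exists k.
apply: (@growth_union _ _ bool _ (fun j t => if j then quad t else cone t)).
  by move=> t []; [exists true|exists false].
case.
  pose J := {k : 'I_8 & {k' : 'I_8 & ('I_k * 'I_k * ('I_k' * 'I_k'))%type}}.
  apply: (@growth_union _ _ J _ (fun j t => let: existT k (existT k' ((i1, j1), (i2, j2))) := j in
    (k + k' = 8)%N /\ quad4_at (F t) i1 j1 i2 j2)).
    move=> t [_ [k [k' [i1 [j1 [i2 [j2 H]]]]]]].
    by exists (existT _ k (existT _ k' ((i1, j1), (i2, j2)))).
  move=> [k [k' [[i1 j1] [i2 j2]]]].
  have [/and3P[/eqP kk n1 n2]|H] := boolP [&& k + k' == 8, i1 != j1 & i2 != j2]%N; last first.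
    apply: growth_empty => -[t [_ [kk [a [b [c [d' [[[_ _ n1] _ _ _ _] [[_ _ n2] _ _ _ _] _]]]]]]]].
    by move/and3P: H; apply; split=> //; apply/eqP.
  apply: (lift _ _ _ (@growth_quad4 _ T _ F k k' i1 j1 i2 j2 _)); last by move=> t [_ []].
  (* Two distinct pivots require k >= 2, so that k - 2 is not truncated. *)
  have : (1 < k)%N by move: n1; rewrite -val_eqE /=; have := ltn_ord i1; have := ltn_ord j1; lia.
  have : (1 < k')%N by move: n2; rewrite -val_eqE /=; have := ltn_ord i2; have := ltn_ord j2; lia.
  by move: kk; clear; move: (nat_of_ord k) (nat_of_ord k') => x y; lia.
pose J := {k : 'I_8 & ('I_8 * ('I_k * 'I_k) * 'I_4)%type}.
apply: (@growth_union _ _ J _ (fun j t => let: existT k (k', (i1, j1), i0) := j in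
    (k' + 2 * k = 9)%N /\ cone_at (F t) k' i1 j1 i0)).
  move=> t [_ [k [k' [i1 [j1 [i0 H]]]]]].
  by exists (existT _ k (k', (i1, j1), i0)).
move=> [k [[k' [i1 j1]] i0]].
have [/andP[/eqP kk n1]|H] := boolP ((k' + 2 * k == 9) && (i1 != j1))%N; last first.
  apply: growth_empty => -[t [_ [kk [a [b [c [[[_ _ n1] _ _ _ _] _ _ _]]]]]]].
  by move/andP: H; apply; split=> //; apply/eqP.
apply: (lift _ _ _ (@growth_cone _ T _ F k k' i1 j1 i0 _)); last by move=> t [_ []].
have : (1 < k)%N by move: n1; rewrite -val_eqE /=; have := ltn_ord i1; have := ltn_ord j1; lia.
by move: kk; clear; move: (nat_of_ord k) (nat_of_ord k') => x y; lia.
Qed.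

End Sextics.

Lemma alg_dep_empty (C : closedFieldType) N (S : ('I_N -> C) -> Prop) D :
  (forall x, ~ S x) -> alg_dep S D.
Proof. by move=> H p; exists 1; split=> [|x /H //]; apply/eqP; rewrite oner_eq0. Qed.

Lemma dim_ge_sub (C : fieldType) N (S S' : ('I_N -> C) -> Prop) k :
  (forall x, S x -> S' x) -> dim_ge S k -> dim_ge S' k.
Proof.
move=> SS [P [P1 P2]]; exists P; split=> // i /P1[pr H]; split=> // p Hp.
by apply: H => x /SS; apply: Hp.
Qed.

Lemma alg_dep_Mndg (C : closedFieldType) (charC0 : [pchar C] =i pred0) n d g :
  (2 < n)%N -> (0 < g)%N -> (g <= 4)%N -> (n <= d)%N -> (2 * g - 2 <= d)%N ->
  alg_dep (@Mndg C n d g%:Z) (npar n d - (n - 2) * g).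
Proof.
move=> n3 g0 g4 nd gd; have d0 : (0 < d)%N by apply: leq_trans (nd); apply: ltn_trans n3.
have two0 : (2%:R : C) != 0 := natr_neq0 charC0 1.
pose S1 (x : 'I_(npar n d) -> C) := Mnd x /\ forall c, ~ good (dehom x) d c.
pose S2 (x : 'I_(npar n d) -> C) := cofinite (fun s0 => cofinite (fun s2 =>
     planar_type d g (dehom x) s0 s2 \/ quad_type d g (dehom x) s0)).
pose S3 (x : 'I_(npar n d) -> C) := [/\ n = 3, d = 6, g = 4, Defs.nondegenerate x &
  exists c, curve_conductor d (dehom x) 4 4 c].
apply: (@alg_dep_sub _ _ _ (fun x => S1 x \/ (S2 x \/ S3 x))); last first.
  apply: alg_dep_or; first exact: alg_dep_multiple.
  apply: alg_dep_or; first exact: alg_dep_generic.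
  have [[n3' [d6 g4']]|H] := classic (n = 3 /\ (d = 6 /\ g = 4)); last first.
    by apply: alg_dep_empty => x [h1 h2 h3 _ _]; apply: H.
  subst n d g; apply: alg_dep_sub (alg_dep_sextic two0) => x [_ _ _ nx hc]; by split.
move=> x [mx [a [m0 Ha]]]; have [mor nx] := mx; set f := dehom x in S1 S2 S3 *.
have [[c0 gc]|H] := classic (exists c, good f d c); last first.
  by left; split=> // c Hc; apply: H; exists c.
right; have bf : base_point_free f d := dehom_bpf mor.
have sf : forall i, (size (f i) <= d.+1)%N := @size_dehom _ _ _ x.
have fi : indep_mod (fun p => p = 0) f := dehom_indep nx.
have [b [c hc]] := ex_curve_conductor d0 sf bf gc (hilb_fun_basis x) (ex_intro _ a (ex_intro _ m0 Ha)).
have [_ _ bg _ _] := hc.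
have [ed|ed] := leqP (b + g) d.+1.
  left; apply: cofinite_imp (cofinite_admissible sf bf c0 hc) => s0 as0.
  by apply: (generic_type d0 _ sf fi hc g0 gc as0) => //; apply: ltnW (ltnW n3).
(* When e > d + 1 no nonzero form of degree d is a multiple of [c], so the coordinates are
   independent modulo [c] and n + 1 <= b <= g <= 4. Then n = 3 and b = g = 4, and 6 <= d < 7. *)
right; have nb : (n.+1 <= b)%N.
  apply: (rank1 hc (v := f)) => [i|al [r [E sr]]]; first exact: graded_gen.
  apply: fi; rewrite E (_ : r = 0) ?mulr0 //; apply/eqP.
  by rewrite -size_poly_leq0 (leq_trans sr) // leqn0 subn_eq0 ltnW.
have [b4 h1 h2 h3] : [/\ b = 4, n = 3, d = 6 & g = 4] by split; lia.
by split=> //; exists c; move: hc; rewrite b4 h3.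
Qed.
Import Order.TTheory Num.Theory.

Theorem theorem2p1 (C : closedFieldType) (charC0 : [pchar C] =i pred0)
  (n d g : nat) (hn : (1 <= n)%N) (hd : (1 <= d)%N)
  (hg0 : (0 < g)%N) (hg4 : (g <= 4)%N)
  (hdn : (n <= d)%N) (hdg : (2 * g%:Z - 2 <= d%:Z)%R) :
  codim_ge (@Mndg C n d g%:Z) (@Mnd C n d) ((n%:Z - 2) * g%:Z).
Proof.
move=> k Hk; have [n2|n3] := leqP n 2.
  (* For n <= 2 the bound is not positive, so the inclusion of the two sets is enough. *)
  exists k; split; first by apply: dim_ge_sub Hk => x [].
  have : (n%:Z - 2) * g%:Z <= 0 by rewrite mulr_le0_ge0 // ?subr_le0; lia.
  lia.
exists (npar n d); split; first exact: dim_ge_Mnd.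
have gd : (2 * g - 2 <= d)%N by lia.
have := dim_ge_alg_dep (alg_dep_Mndg charC0 n3 hg0 hg4 hdn gd) Hk.
have le : ((n - 2) * g <= npar n d)%N by apply: leq_mul; lia.
have -> : (n%:Z - 2) * g%:Z = ((n - 2) * g)%N%:Z by rewrite PoszM -subzn // ltnW.
move: le; move: (npar n d) ((n - 2) * g)%N => x y; lia.
Qed.
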